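(* Let $E,A\in C(\mathbb I,\mathbb R^{n,n})$ be sufficiently smooth and let the associated linear DAE $E(t)\dot x=A(t)x+f(t)$ (with $f\in C(\mathbb I,\mathbb R^n)$ sufficiently smooth) satisfy the Hypothesis (H) stated in the context, with characteristic values $\mu,a,d$. If $(E,A)$ is self-adjoint, i.e. $E^T=-E$ and $A^T=A+\dot E$ as equality of functions on $\mathbb I$, then $d=2p$ is even, and a sufficiently smooth, pointwise nonsingular $Q\in C^1(\mathbb I,\mathbb R^{n,n})$ in the transformation $x=Q(t)\begin{bmatrix}x_1\\ x_2\end{bmatrix}$ can be chosen from the restricted class of transformations described in the context in such a way that the inherent ODE $\dot x_1=\tilde A(t)x_1+\tilde f_1(t)$ fixed by $Q$ possesses a symplectic flow, i.e., for $t_0\in\mathbb I$ the solution $\Phi$ of $\dot\Phi=\tilde A(t)\Phi$, $\Phi(t_0)=I_{2p}$, satisfies $\Phi(t)^TJ\Phi(t)=J$ for all $t\in\mathbb I$, where $J=\begin{bmatrix}0&I_p\\-I_p&0\end{bmatrix}$.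
   Context: $\mathbb I\subseteq\mathbb R$ is a compact non-trivial interval. Derivative array: for $\mu\ge 0$ let $M_\mu(t)$ be the $(\mu+1)\times(\mu+1)$ block lower triangular matrix function with $n\times n$ blocks $$(M_\mu)_{i,j}=\tbinom{i}{j}E^{(i-j)}-\tbinom{i}{j+1}A^{(i-j-1)},\quad 0\le j\le i\le\mu,$$ (the second term being absent for $i=j$), and let $\mathcal A_\mu$ and $g_\mu$ denote the stacked functions $\mathcal A_\mu=[\,A^T\ \dot A^T\ \cdots\ (A^{(\mu)})^T\,]^T$ and $g_\mu=[\,f^T\ \dot f^T\ \cdots\ (f^{(\mu)})^T\,]^T$. Hypothesis (H) (for linear DAEs): there exist integers $\mu,a,d$ with $d=n-a$ such that for all $t\in\mathbb I$: 1. $\operatorname{rank}M_\mu(t)=(\mu+1)n-a$, such that there exists a smooth $Z_2$ of size $(\mu+1)n\times a$ and pointwise maximal rank with $Z_2^TM_\mu=0$; 2. $\operatorname{rank}\hat A_2(t)=a$, where $\hat A_2=Z_2^T\mathcal A_\mu$, such that there exists a smooth function of size $n\times d$ and pointwise maximal rank whose columns span $\ker\hat A_2$; call it $K$; 3. $\operatorname{rank}E(t)K(t)=d$, such that there exists a smooth $Z_1$ of size $n\times d$ and pointwise maximal rank with $\operatorname{rank}(Z_1^TEK)=d$. Reduced DAE: with $\hat E_1=Z_1^TE$, $\hat A_1=Z_1^TA$, $\hat f_1=Z_1^Tf$, $\hat f_2=Z_2^Tg_\mu$, it reads $\hat E_1\dot x=\hat A_1x+\hat f_1$, $0=\hat A_2x+\hat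 f_2$. Inherent ODE fixed by $Q$: write $Q=[\,T_2\ \ T_2'\,]$ with $T_2$ of size $n\times d$ and $T_2'$ of size $n\times a$, and require that $\hat A_2T_2'$ is pointwise nonsingular. Substituting $x=T_2x_1+T_2'x_2$ in the reduced DAE gives $$\hat E_1T_2\dot x_1+\hat E_1T_2'\dot x_2=(\hat A_1T_2-\hat E_1\dot T_2)x_1+(\hat A_1T_2'-\hat E_1\dot T_2')x_2+\hat f_1,\qquad 0=\hat A_2T_2x_1+\hat A_2T_2'x_2+\hat f_2.$$ Solving the second equation for $x_2$, differentiating it, eliminating $x_2$ and $\dot x_2$ from the first equation, and solving for $\dot x_1$ yields an ODE $\dot x_1=\tilde A(t)x_1+\tilde f_1(t)$ for $x_1\in\mathbb R^d$, the inherent ODE. Once $Q$ is fixed, it is uniquely determined (independent of the choices of $Z_1,Z_2$). Restricted class of transformations (self-adjoint case): $Q=[\,T_2\ \ T_2'\,]$ with $T_2$ of size $n\times d$, $d=2p$, and $T_2'$ of size $n\times a$ such that $\hat A_2T_2'$ is pointwise nonsingular, where $T_2=VW_2$ with smooth $V$ of size $n\times 2p$ having pointwise orthonormal columns that span $\ker\hat A_2$, and with smooth $$W_2=\begin{bmatrix}I_p&0\\ K_{21}&K_{22}\end{bmatrix}$$ ($p\times p$ blocks, $K_{22}$ pointwise nonsingular) adapted such that $T_2^TET_2=J$, and where $T_2'$ is any smooth completion making $Q$ pointwise nonsingular. That is, only pointwise orthogonal transformations are used, with the exception of $W_2$, which adapts one half of the variables to obtain the matrix $J$. *)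

(* Defs.v *)
From HB Require Import structures.
From mathcomp Require Import all_boot all_order all_algebra.
From mathcomp Require Import all_classical all_reals all_analysis.

Set Implicit Arguments.
Unset Strict Implicit.
Unset Printing Implicit Defensive.

Import Order.TTheory GRing.Theory Num.Theory.
Import numFieldNormedType.Exports.

Local Open Scope classical_set_scope.
Local Open Scope ring_scope.

(* Functions on the interval [I] are represented by total functions on [R]; all
   notions below depend only on the values at points of [I].  In particular
   derivatives are taken relative to [I], hence are one-sided at its end points,
   unlike [derive1]. *)

Section CalculusOnI.
Context {R : realType}.
Implicit Type V : normedModType R.

Definition diff_quot V (F : R -> V) (t s : R) : V := (s - t)^-1 *: (F s - F t).

Definition deriveI (I : set R) V (F : R -> V) (t : R) : V :=
  lim (diff_quot F t s @[s --> within I t^']).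

Definition derivableI (I : set R) V (F : R -> V) (t : R) : Prop :=
  cvg (diff_quot F t s @[s --> within I t^']).

Definition derivenI (I : set R) V (k : nat) (F : R -> V) : R -> V :=
  iter k (@deriveI I V) F.

Fixpoint Ck (I : set R) V (k : nat) (F : R -> V) : Prop :=
  match k with
  | 0 => {within I, continuous F}
  | k'.+1 => (forall t, I t -> derivableI I F t) /\ Ck I k' (deriveI I F)
  end.

End CalculusOnI.

Section DAE.
Context {R : realType}.
Variable I : set R.

Definition columns_span_ker m n d (K : 'M[R]_(n, d)) (A : 'M[R]_(m, n)) : Prop :=
  (K^T == kermx A^T)%MS.

Definition J_mx p : 'M[R]_(p + p) := block_mx 0 1%:M (- 1%:M) 0.

Definition self_adjoint n (E A : R -> 'M[R]_n) : Prop :=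
  forall t, I t -> (E t)^T = - E t /\ (A t)^T = A t + deriveI I E t.

(* Both binomial coefficients vanish for j > i (block lower triangular shape),
   and 'C(i, j.+1) vanishes for j = i. *)
Definition M_array n (mu : nat) (E A : R -> 'M[R]_n) (t : R) :=
  \mxblock_(i < mu.+1, j < mu.+1)
    ('C(i, j)%:R *: derivenI I (i - j)%N E t
     - 'C(i, j.+1)%:R *: derivenI I (i - j - 1)%N A t).

Definition stacked n m (mu : nat) (F : R -> 'M[R]_(n, m)) (t : R) :=
  \mxcol_(i < mu.+1) derivenI I i F t.

Definition hatE1 n d (E : R -> 'M[R]_n) (Z1 : R -> 'M[R]_(n, d)) (t : R) :
  'M[R]_(d, n) := (Z1 t)^T *m E t.

Definition hatA1 n d (A : R -> 'M[R]_n) (Z1 : R -> 'M[R]_(n, d)) (t : R) :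
  'M[R]_(d, n) := (Z1 t)^T *m A t.

Definition hatf1 n d (f : R -> 'cV[R]_n) (Z1 : R -> 'M[R]_(n, d)) (t : R) :
  'cV[R]_d := (Z1 t)^T *m f t.

Definition hatA2 n mu a (A : R -> 'M[R]_n)
    (Z2 : R -> 'M[R]_(\sum_(i < mu.+1) n, a)) (t : R) : 'M[R]_(a, n) :=
  (Z2 t)^T *m stacked mu A t.

Definition hatf2 n mu a (f : R -> 'cV[R]_n)
    (Z2 : R -> 'M[R]_(\sum_(i < mu.+1) n, a)) (t : R) : 'cV[R]_a :=
  (Z2 t)^T *m stacked mu f t.

(* Hypothesis (H) with explicit witnesses; "smooth" is read as C^s. *)
Record hypH_with (s n mu a d : nat) (E A : R -> 'M[R]_n)
    (Z2 : R -> 'M[R]_(\sum_(i < mu.+1) n, a)) (K Z1 : R -> 'M[R]_(n, d)) :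
    Prop := HypHWith {
  hypH_dim : (d + a)%N = n;
  hypH_rankM : forall t, I t -> \rank (M_array mu E A t) = (mu.+1 * n - a)%N;
  hypH_Z2_smooth : Ck I s Z2;
  hypH_Z2_rank : forall t, I t -> \rank (Z2 t) = a;
  hypH_Z2_null : forall t, I t -> (Z2 t)^T *m M_array mu E A t = 0;
  hypH_rankA2 : forall t, I t -> \rank (hatA2 A Z2 t) = a;
  hypH_K_smooth : Ck I s K;
  hypH_K_rank : forall t, I t -> \rank (K t) = d;
  hypH_K_ker : forall t, I t -> columns_span_ker (K t) (hatA2 A Z2 t);
  hypH_rankEK : forall t, I t -> \rank (E t *m K t) = d;
  hypH_Z1_smooth : Ck I s Z1;
  hypH_Z1_rank : forall t, I t -> \rank (Z1 t) = d;
  hypH_Z1EK : forall t, I t -> \rank ((Z1 t)^T *m E t *m K t) = d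
}.

Definition hypH (s n mu a d : nat) (E A : R -> 'M[R]_n) : Prop :=
  exists (Z2 : R -> 'M[R]_(\sum_(i < mu.+1) n, a)) (K Z1 : R -> 'M[R]_(n, d)),
    hypH_with s E A Z2 K Z1.

Section InherentODE.
Variables (n mu a d : nat) (E A : R -> 'M[R]_n) (f : R -> 'cV[R]_n).
Variables (Z2 : R -> 'M[R]_(\sum_(i < mu.+1) n, a)) (Z1 : R -> 'M[R]_(n, d)).
Variables (T2 : R -> 'M[R]_(n, d)) (T2' : R -> 'M[R]_(n, a)).

Let E1 := hatE1 E Z1.
Let A1 := hatA1 A Z1.
Let A2 := hatA2 A Z2.
Let f1 := hatf1 f Z1.
Let f2 := hatf2 f Z2.

(* Solving the algebraic equation for x2 gives x2 = elimG x1 + elimh. *)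
Definition elimG (t : R) : 'M[R]_(a, d) :=
  - (invmx (A2 t *m T2' t) *m (A2 t *m T2 t)).

Definition elimh (t : R) : 'cV[R]_a :=
  - (invmx (A2 t *m T2' t) *m f2 t).

(* Inserting x2 and x2' = elimG x1' + elimG' x1 + elimh' into the differential
   equation gives elimN x1' = elimB x1 + elimb. *)
Definition elimN (t : R) : 'M[R]_d :=
  E1 t *m T2 t + E1 t *m T2' t *m elimG t.

Definition elimB (t : R) : 'M[R]_d :=
  (A1 t *m T2 t - E1 t *m deriveI I T2 t)
  + (A1 t *m T2' t - E1 t *m deriveI I T2' t) *m elimG t
  - E1 t *m T2' t *m deriveI I elimG t.

Definition elimb (t : R) : 'cV[R]_d :=
  f1 t + (A1 t *m T2' t - E1 t *m deriveI I T2' t) *m elimh t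
  - E1 t *m T2' t *m deriveI I elimh t.

Definition inherent_ode (At : R -> 'M[R]_d) (ft : R -> 'cV[R]_d) : Prop :=
  forall t, I t ->
    [/\ A2 t *m T2' t \in unitmx, elimN t \in unitmx,
        At t = invmx (elimN t) *m elimB t
      & ft t = invmx (elimN t) *m elimb t].

End InherentODE.

Definition restricted_class (s n mu a p : nat) (E A : R -> 'M[R]_n)
    (Z2 : R -> 'M[R]_(\sum_(i < mu.+1) n, a))
    (T2 : R -> 'M[R]_(n, p + p)) (T2' : R -> 'M[R]_(n, a)) : Prop :=
  exists (V : R -> 'M[R]_(n, p + p)) (K21 K22 : R -> 'M[R]_p),
    [/\ Ck I s V, Ck I s K21, Ck I s K22, Ck I s T2'
      & forall t, I t ->
        [/\ (V t)^T *m V t = 1%:M,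
            columns_span_ker (V t) (hatA2 A Z2 t),
            K22 t \in unitmx /\
              T2 t = V t *m block_mx 1%:M 0 (K21 t) (K22 t),
            (T2 t)^T *m E t *m T2 t = J_mx p
          & hatA2 A Z2 t *m T2' t \in unitmx]].

Definition fundamental_solution d (At : R -> 'M[R]_d) (t0 : R)
    (Phi : R -> 'M[R]_d) : Prop :=
  Phi t0 = 1%:M /\
  forall t, I t -> diff_quot Phi t s @[s --> within I t^'] --> At t *m Phi t.

Definition symplectic_flow p (At : R -> 'M[R]_(p + p)) : Prop :=
  forall t0, I t0 ->
    (exists Phi, fundamental_solution At t0 Phi) /\
    (forall Phi, fundamental_solution At t0 Phi ->
       forall t, I t -> (Phi t)^T *m J_mx p *m Phi t = J_mx p).

End DAE.

(* Main.v *)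
(* Let [D] be the derivation and [L = E D - A], which is formally self-adjoint. The
   rows of [Z2^T] are differential operators [Z] of order at most [mu] such that
   [Z L = - A2] has order 0. The crux is that extending the derivative array by one
   row produces no new constraint: if [w E = v A2], then [w + v D Z] is a
   combination of the rows of [Z]. On a dense set of points this follows from a
   dimension count, made with a basis of the left kernel of the array for which
   [Z = D u Z + g]; by continuity it then holds everywhere.

   As a consequence solutions of the reduced equation solve the original one, and
   the form [K^T E K] is nondegenerate: a solution [y] with [y^T E K = 0] satisfies
   [y^T = - D v Z] with [v A2 = y^T E], which forces [v Z = 0] and [y = 0].
   Self-adjointness makes this skew form invariant under the flow, so that the flow
   transports a symplectic basis at one point to a smooth frame [U] of the kernel
   of [A2] with [U^T E U = J]. Gram-Schmidt, starting with the Lagrangian half of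
   [U], yields the orthonormal [V], and [W2] is then explicit. Differentiating
   [T2^T E T2 = J] shows that the inherent equation is Hamiltonian. *)

Require Import Defs.
From HB Require Import structures.
From mathcomp Require Import all_boot all_order all_algebra.
From mathcomp Require Import all_classical all_reals all_analysis.
From mathcomp Require Import ring lra zify.
Import Order.TTheory GRing.Theory Num.Theory.
Import numFieldNormedType.Exports.
Local Open Scope classical_set_scope.
Local Open Scope ring_scope.

Set Implicit Arguments.
Unset Strict Implicit.
Unset Printing Implicit Defensive.

(** * Calculus relative to an interval *)

(** (H) speaks about the single level [mu] of the array and gives the invertibility of [Z1^T E K]
    for some [Z1]. Neither the consistency of the next level nor anything about [K^T E K] is part of
    it; the operator argument closes this gap. Two spaces of dimension [a] are compared: the
    operators whose product with [L] has order 0, and the left kernel of [E K]. Left division by [D]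
    maps the first into the second by taking the remainder [g]. Independence of the remainders is
    ensured by building the basis one operator at a time, each with its quotient in the span of its
    predecessors. These spans may jump with [t], so every extension shrinks the interval, and the
    count succeeds only at some point of each subinterval. Left division costs derivatives, so it is
    applied to a kernel basis as smooth as the array and not to [Z2]. Likewise the symplectic normal
    form is taken of one constant matrix; the flow stands in for a smooth normal form of a skew
    matrix function. *)

Section ScalarCalculus.
Context {R : realType}.
Implicit Types (J : set R) (f g h : R -> R) (k : nat).

Definition has_deriv J f g := forall t, J t ->
  (s - t)^-1 * (f s - f t) @[s --> within J t^'] --> g t.

(** An existential derivative in place of [deriveI]: the closure properties then hold on any set
    [J], and uniqueness of limits enters only where [deriveI] is evaluated. *)
Fixpoint smooth J k f : Prop :=
  if k is k'.+1 then exists2 g, has_deriv J f g & smooth J k' g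
  else forall t, J t -> f s @[s --> within J (nbhs t)] --> f t.

Lemma near_within_dnbhs J t (P : R -> Prop) :
  (forall s, J s -> s != t -> P s) -> \forall s \near within J t^', P s.
Proof.
move=> H; rewrite near_withinE near_withinE.
by near=> s => st Js; apply: H.
Unshelve. all: by end_near.
Qed.

Lemma eq_cvg_dnbhs J t f g (l : R) :
  (forall s, J s -> s != t -> f s = g s) ->
  f s @[s --> within J t^'] --> l -> g s @[s --> within J t^'] --> l.
Proof.
move=> fg; apply: cvg_trans; apply: (near_eq_cvg (F := within J t^')).
by apply: near_within_dnbhs => s Js st; rewrite fg.
Qed.

Lemma cvg_within_dnbhs J t f (l : R) :
  f s @[s --> within J (nbhs t)] --> l -> f s @[s --> within J t^'] --> l.
Proof.
apply: cvg_trans; apply: cvg_app => A HA.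
rewrite /within /dnbhs /= /within /=.
have : \forall s \near t, J s -> A s by exact: HA.
by apply: filterS => s AJ _.
Qed.

Lemma cvg_within_nbhs J t f :
  f s @[s --> within J t^'] --> f t -> f s @[s --> within J (nbhs t)] --> f t.
Proof.
move=> H A /= fA; have HA := H A fA.
have : \forall s \near t, s != t -> J s -> A (f s) by exact: HA.
rewrite /fmap /= /within /=.
apply: filterS => s Hs Js; have [->|st] := eqVneq s t; last exact: Hs.
exact: (nbhs_singleton fA).
Qed.

Lemma cvg_sub_within J t : s - t @[s --> within J t^'] --> (0 : R).
Proof.
apply: cvg_within_dnbhs; rewrite -[X in _ --> X](subrr t).
apply: cvgB; last exact: cvg_cst.
by apply: cvg_within_filter; exact: cvg_id.
Qed.

Lemma has_deriv_cvg J f g t : has_deriv J f g -> J t ->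
  f s @[s --> within J t^'] --> f t.
Proof.
move=> fg Jt.
rewrite -[X in _ --> X]addr0 -[X in _ + X](mul0r (g t)).
apply: (eq_cvg_dnbhs _ (cvgD (cvg_cst (f t))
  (cvgM (cvg_sub_within J t) (fg t Jt)))) => s _ st.
by rewrite /= mulrA divff ?subr_eq0// mul1r addrC subrK.
Qed.

Lemma has_deriv_continuous J f g : has_deriv J f g -> smooth J 0 f.
Proof. by move=> fg t Jt; apply: cvg_within_nbhs; apply: has_deriv_cvg fg Jt. Qed.

Lemma eq_has_deriv J f f' g g' : (forall t, J t -> f t = f' t) ->
  (forall t, J t -> g t = g' t) -> has_deriv J f g -> has_deriv J f' g'.
Proof.
move=> ff gg H t Jt; rewrite -gg//; apply: eq_cvg_dnbhs (H t Jt) => s Js _.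
by rewrite !ff.
Qed.

Lemma eq_smooth J k f f' : (forall t, J t -> f t = f' t) ->
  smooth J k f -> smooth J k f'.
Proof.
case: k => [|k] ff /=; last first.
  by move=> [g fg gk]; exists g => //; apply: eq_has_deriv fg.
move=> H t Jt; rewrite -ff//; apply: cvg_trans (H t Jt).
by apply: near_eq_cvg; rewrite near_withinE; near=> s => Js; rewrite ff.
Unshelve. all: by end_near.
Qed.

Lemma has_deriv_subset J J' f g : J' `<=` J -> has_deriv J f g ->
  has_deriv J' f g.
Proof.
move=> JJ H t Jt; apply: cvg_trans (H t (JJ t Jt)).
by apply: cvg_app; apply: within_subset.
Qed.

Lemma smooth_subset J J' k f : J' `<=` J -> smooth J k f -> smooth J' k f.
Proof.
move=> JJ; elim: k f => [|k IH] f /=; last first.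
  by move=> [g fg gk]; exists g; [apply: has_deriv_subset fg|apply: IH].
move=> H t Jt; apply: cvg_trans (H t (JJ t Jt)).
by apply: cvg_app; apply: within_subset.
Qed.

Lemma smoothW J k f : smooth J k.+1 f -> smooth J k f.
Proof.
elim: k f => [|k IH] f [g fg gk]; first exact: has_deriv_continuous fg.
by exists g => //; apply: IH.
Qed.

Lemma smooth_le J k k' f : (k' <= k)%N -> smooth J k f -> smooth J k' f.
Proof.
move=> /subnK <-; elim: (k - k')%N => // i IH /smoothW; exact: IH.
Qed.

Lemma smooth_cvg J k f t : J t -> smooth J k f ->
  f s @[s --> within J (nbhs t)] --> f t.
Proof. by move=> Jt /(smooth_le (leq0n k)); apply. Qed.

Lemma has_deriv_cst J (c : R) : has_deriv J (fun=> c) (fun=> 0).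
Proof.
move=> t Jt; under eq_fun do rewrite subrr mulr0; exact: cvg_cst.
Qed.

Lemma smooth_cst J k (c : R) : smooth J k (fun=> c).
Proof.
elim: k c => [|k IH] c /=; last by exists (fun=> 0) => //; exact: has_deriv_cst.
by move=> t _; exact: cvg_cst.
Qed.

Lemma has_derivD J f f' g g' : has_deriv J f f' -> has_deriv J g g' ->
  has_deriv J (fun t => f t + g t) (fun t => f' t + g' t).
Proof.
move=> Hf Hg t Jt; under eq_fun do rewrite opprD addrACA mulrDr.
by apply: cvgD; [apply: Hf|apply: Hg].
Qed.

Lemma has_derivN J f f' : has_deriv J f f' ->
  has_deriv J (fun t => - f t) (fun t => - f' t).
Proof.
move=> Hf t Jt; under eq_fun do rewrite -opprD mulrN.
by apply: cvgN; apply: Hf.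
Qed.

Lemma has_derivM J f f' g g' : has_deriv J f f' -> has_deriv J g g' ->
  has_deriv J (fun t => f t * g t) (fun t => f' t * g t + f t * g' t).
Proof.
move=> Hf Hg t Jt.
have -> : (fun s => (s - t)^-1 * (f s * g s - f t * g t)) =
  (fun s => (s - t)^-1 * (f s - f t) * g s + f t * ((s - t)^-1 * (g s - g t))).
  by apply/funext => s; ring.
apply: cvgD; first by apply: cvgM; [exact: Hf|exact: has_deriv_cvg Hg Jt].
by apply: cvgM; [exact: cvg_cst|exact: Hg].
Qed.

Lemma has_derivV J f f' : (forall t, J t -> f t != 0) -> has_deriv J f f' ->
  has_deriv J (fun t => (f t)^-1) (fun t => - ((f t)^-1 * (f t)^-1 * f' t)).
Proof.
move=> f0 Hf t Jt.
have Hc := has_deriv_cvg Hf Jt.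
apply: (eq_cvg_dnbhs _ (cvgN (cvgM (cvgM (cvgV (f0 t Jt) Hc)
  (cvg_cst (f t)^-1)) (Hf t Jt)))) => s Js st.
rewrite /=; field.
by rewrite subr_eq0 st !f0.
Qed.

(** Writing [f s - f t] as a difference of squares turns the quotient of the root into that of [f]
    divided by [sqrt (f s) + sqrt (f t)], so continuity of the root is enough. *)
Lemma has_deriv_sqrt J f f' : (forall t, J t -> 0 < f t) -> has_deriv J f f' ->
  has_deriv J (fun t => Num.sqrt (f t))
    (fun t => f' t * (Num.sqrt (f t) + Num.sqrt (f t))^-1).
Proof.
move=> f0 Hf t Jt.
have Hc := has_deriv_cvg Hf Jt.
have Hs : Num.sqrt (f s) @[s --> within J t^'] --> Num.sqrt (f t).
  by apply: (continuous_cvg _ _ Hc); exact: sqrt_continuous.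
have s0 : Num.sqrt (f t) + Num.sqrt (f t) != 0.
  by rewrite gt_eqF// addr_gt0// sqrtr_gt0 f0.
apply: (eq_cvg_dnbhs _ (cvgM (Hf t Jt)
  (cvgV s0 (cvgD Hs (cvg_cst (Num.sqrt (f t))))))) => s Js st.
rewrite [X in _ / X](_ : _ = Num.sqrt (f s) + Num.sqrt (f t))//.
rewrite /= -{1}(sqr_sqrtr (ltW (f0 s Js))) -{1}(sqr_sqrtr (ltW (f0 t Jt))).
have ss0 : Num.sqrt (f s) + Num.sqrt (f t) != 0.
  by rewrite gt_eqF// addr_gt0// sqrtr_gt0 f0.
by field; rewrite ss0 subr_eq0 st.
Qed.

Lemma smoothD J k f g : smooth J k f -> smooth J k g ->
  smooth J k (fun t => f t + g t).
Proof.
elim: k f g => [|k IH] f g /=.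
  by move=> Hf Hg t Jt; apply: cvgD; [apply: Hf|apply: Hg].
move=> [f' ff' sf] [g' gg' sg]; exists (fun t => f' t + g' t); last exact: IH.
exact: has_derivD.
Qed.

Lemma smoothN J k f : smooth J k f -> smooth J k (fun t => - f t).
Proof.
elim: k f => [|k IH] f /=; first by move=> Hf t Jt; apply: cvgN; apply: Hf.
by move=> [f' ff' sf]; exists (fun t => - f' t); [exact: has_derivN|exact: IH].
Qed.

Lemma smoothM J k f g : smooth J k f -> smooth J k g ->
  smooth J k (fun t => f t * g t).
Proof.
elim: k f g => [|k IH] f g; first by
  move=> Hf Hg t Jt; apply: cvgM; [apply: Hf|apply: Hg].
move=> sf sg; have [f' ff' sf'] := sf; have [g' gg' sg'] := sg.
exists (fun t => f' t * g t + f t * g' t); first exact: has_derivM.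
by apply: smoothD; apply: IH => //; exact: smoothW.
Qed.

Lemma smoothV J k f : (forall t, J t -> f t != 0) -> smooth J k f ->
  smooth J k (fun t => (f t)^-1).
Proof.
move=> f0; elim: k => [|k IH]; first by move=> Hf t Jt; apply: cvgV (f0 t Jt) (Hf t Jt).
move=> sf; have [f' ff' sf'] := sf.
exists (fun t => - ((f t)^-1 * (f t)^-1 * f' t)); first exact: has_derivV.
by apply: smoothN; do 2?[apply: smoothM => //]; exact: IH (smoothW sf).
Qed.

Lemma smooth_sqrt J k f : (forall t, J t -> 0 < f t) -> smooth J k f ->
  smooth J k (fun t => Num.sqrt (f t)).
Proof.
move=> f0; elim: k => [|k IH].
  move=> Hf t Jt; apply: (continuous_cvg _ _ (Hf t Jt)); exact: sqrt_continuous.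
move=> sf; have [f' ff' sf'] := sf.
eexists; first exact: has_deriv_sqrt f0 ff'.
apply: smoothM => //; apply: smoothV; last first.
  by apply: smoothD; exact: IH (smoothW sf).
by move=> t Jt; rewrite gt_eqF// addr_gt0// sqrtr_gt0 f0.
Qed.

Lemma has_deriv_sum J (T : Type) (r : seq T) (P : pred T) (F G : T -> R -> R) :
  (forall i, P i -> has_deriv J (F i) (G i)) ->
  has_deriv J (fun t => \sum_(i <- r | P i) F i t)
              (fun t => \sum_(i <- r | P i) G i t).
Proof.
move=> H; elim: r => [|i r IH].
  by apply: (eq_has_deriv _ _ (@has_deriv_cst J 0)) => t _; rewrite big_nil.
case Pi : (P i); last first.
  by apply: (eq_has_deriv _ _ IH) => t _; rewrite [RHS]big_cons Pi.
by apply: (eq_has_deriv _ _ (has_derivD (H i Pi) IH)) => t _;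
  rewrite [RHS]big_cons Pi.
Qed.

Lemma smooth_sum J k (T : Type) (r : seq T) (P : pred T) (F : T -> R -> R) :
  (forall i, P i -> smooth J k (F i)) ->
  smooth J k (fun t => \sum_(i <- r | P i) F i t).
Proof.
move=> H; elim: r => [|i r IH].
  by apply: (eq_smooth _ (smooth_cst J k 0)) => t _; rewrite big_nil.
case Pi : (P i); last by apply: (eq_smooth _ IH) => t _; rewrite [RHS]big_cons Pi.
by apply: (eq_smooth _ (smoothD (H i Pi) IH)) => t _; rewrite [RHS]big_cons Pi.
Qed.

Lemma smooth_prod J k (T : Type) (r : seq T) (P : pred T) (F : T -> R -> R) :
  (forall i, P i -> smooth J k (F i)) ->
  smooth J k (fun t => \prod_(i <- r | P i) F i t).
Proof.
move=> H; elim: r => [|i r IH].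
  by apply: (eq_smooth _ (smooth_cst J k 1)) => t _; rewrite big_nil.
case Pi : (P i); last by apply: (eq_smooth _ IH) => t _; rewrite [RHS]big_cons Pi.
by apply: (eq_smooth _ (smoothM (H i Pi) IH)) => t _; rewrite [RHS]big_cons Pi.
Qed.

End ScalarCalculus.

(** * Entrywise calculus of matrix functions *)

Section MatrixCalculus.
Context {R : realType}.
Implicit Types (J : set R) (k : nat).

Definition mderiv J m n (F G : R -> 'M[R]_(m, n)) :=
  forall i j, has_deriv J (fun t => F t i j) (fun t => G t i j).

Definition msmooth J k m n (F : R -> 'M[R]_(m, n)) :=
  forall i j, smooth J k (fun t => F t i j).

Lemma cvg_mx (T : Type) (FF : set_system T) {FFF : Filter FF} m n
    (f : T -> 'M[R]_(m, n)) (l : 'M[R]_(m, n)) :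
  f x @[x --> FF] --> l <-> forall i j, f x i j @[x --> FF] --> l i j.
Proof.
split=> [H i j A lA|H A [P lP PA]].
  have : nbhs l [set M : 'M[R]_(m, n) | A (M i j)].
    exists (fun i' j' => if (i' == i) && (j' == j) then A else setT).
      move=> i' j'; case: ifP => [/andP[/eqP -> /eqP ->] //|_].
      exact: filterT.
    by move=> M /(_ i j) /=; rewrite !eqxx.
  by move=> /H.
apply: (@filterS _ FF _ (fun x => forall i j, P i j (f x i j))).
  by move=> x Px; apply: PA.
apply: filter_forall => i; apply: filter_forall => j.
exact: (H i j _ (lP i j)).
Qed.

Arguments cvg_mx {T FF FFF m n f l}.

(** Non-triviality of the interval enters here: the filter is proper at the end points too, which
    makes [deriveI] well determined. A nearby point is taken to the right of [t], or to the left
    when [t = b]. *)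
Lemma proper_within_itv (a b t : R) : a < b -> `[a, b]%classic t ->
  ProperFilter (within `[a, b]%classic t^').
Proof.
move=> ab; rewrite /= in_itv /= => /andP[a_t tb].
apply: Build_ProperFilter => H.
have : \forall s \near t, s != t -> `[a, b]%classic s -> False by exact: H.
move=> /nbhs_ballP[e /= e0 He].
have [tb'|bt] := ltP t b.
  pose s := Num.min (t + e / 2) b.
  have st : t < s by rewrite lt_min tb' andbT ltrDl divr_gt0.
  apply: (He s) => /=.
  - rewrite -ball_normE /= ltr0_norm ?subr_lt0// opprB ltrBlDl.
    by rewrite gt_min ltrD2l ltr_pdivrMr// ltr_pMr// ltr1n.
  - by rewrite gt_eqF.
  - by rewrite in_itv /= (le_trans a_t (ltW st)) ge_min lexx orbT.
have at' : a < t by apply: lt_le_trans bt.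
pose s := Num.max (t - e / 2) a.
have st : s < t by rewrite gt_max at' andbT ltrBlDr ltrDl divr_gt0.
apply: (He s) => /=.
- rewrite -ball_normE /= gtr0_norm ?subr_gt0// ltrBlDl -ltrBlDr.
  by rewrite lt_max ltrD2l ltrN2 ltr_pdivrMr// ltr_pMr// ltr1n.
- by rewrite lt_eqF.
- by rewrite in_itv /= (le_trans (ltW st) tb) le_max lexx orbT.
Qed.

Lemma mderivP J m n (F G : R -> 'M[R]_(m, n)) : mderiv J F G <->
  forall t, J t -> diff_quot F t s @[s --> within J t^'] --> G t.
Proof.
split=> [H t Jt|H i j t Jt].
  apply/cvg_mx => i j; apply: eq_cvg_dnbhs (H i j t Jt) => s _ _.
  by rewrite /diff_quot !mxE.
have /cvg_mx/(_ i j) := H t Jt; apply: eq_cvg_dnbhs => s _ _.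
by rewrite /diff_quot !mxE.
Qed.

Lemma eq_mderiv J m n (F F' G G' : R -> 'M[R]_(m, n)) :
  (forall t, J t -> F t = F' t) -> (forall t, J t -> G t = G' t) ->
  mderiv J F G -> mderiv J F' G'.
Proof.
by move=> FF GG H i j; apply: eq_has_deriv (H i j) => t Jt; rewrite ?FF ?GG.
Qed.

Lemma eq_msmooth J k m n (F F' : R -> 'M[R]_(m, n)) :
  (forall t, J t -> F t = F' t) -> msmooth J k F -> msmooth J k F'.
Proof. by move=> FF H i j; apply: eq_smooth (H i j) => t Jt; rewrite FF. Qed.

Lemma mderiv_subset J J' m n (F G : R -> 'M[R]_(m, n)) :
  J' `<=` J -> mderiv J F G -> mderiv J' F G.
Proof. by move=> JJ H i j; apply: has_deriv_subset (H i j). Qed.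

Lemma msmooth_subset J J' k m n (F : R -> 'M[R]_(m, n)) :
  J' `<=` J -> msmooth J k F -> msmooth J' k F.
Proof. by move=> JJ H i j; apply: smooth_subset (H i j). Qed.

Lemma msmooth_le J k k' m n (F : R -> 'M[R]_(m, n)) :
  (k' <= k)%N -> msmooth J k F -> msmooth J k' F.
Proof. by move=> kk H i j; apply: smooth_le (H i j). Qed.

Lemma mderiv_msmooth J k m n (F G : R -> 'M[R]_(m, n)) :
  mderiv J F G -> msmooth J k G -> msmooth J k.+1 F.
Proof. by move=> FG sG i j; exists (fun t => G t i j). Qed.

Lemma msmooth_mderiv J k m n (F : R -> 'M[R]_(m, n)) : msmooth J k.+1 F ->
  exists2 G, mderiv J F G & msmooth J k G.
Proof.
move=> H.
have /choice[g Hg] : forall ij : 'I_m * 'I_n, exists g : R -> R,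
    has_deriv J (fun t => F t ij.1 ij.2) g /\ smooth J k g.
  by move=> [i j]; have [g gg sg] := H i j; exists g.
exists (fun t => \matrix_(i, j) g (i, j) t) => i j.
  by apply: eq_has_deriv (Hg (i, j)).1 => t _ //; rewrite mxE.
by apply: eq_smooth (Hg (i, j)).2 => t _ //; rewrite mxE.
Qed.

Lemma mderiv_cst J m n (C : 'M[R]_(m, n)) : mderiv J (fun=> C) (fun=> 0).
Proof.
by move=> i j; apply: (eq_has_deriv _ _ (@has_deriv_cst _ _ (C i j))) => // t _; rewrite mxE.
Qed.

Lemma mderivD J m n (F F' G G' : R -> 'M[R]_(m, n)) :
  mderiv J F F' -> mderiv J G G' ->
  mderiv J (fun t => F t + G t) (fun t => F' t + G' t).
Proof.
by move=> H K i j; apply: eq_has_deriv (has_derivD (H i j) (K i j)) => t _;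
  rewrite mxE.
Qed.

Lemma mderivN J m n (F F' : R -> 'M[R]_(m, n)) :
  mderiv J F F' -> mderiv J (fun t => - F t) (fun t => - F' t).
Proof.
by move=> H i j; apply: eq_has_deriv (has_derivN (H i j)) => t _; rewrite mxE.
Qed.

Lemma mderivB J m n (F F' G G' : R -> 'M[R]_(m, n)) :
  mderiv J F F' -> mderiv J G G' ->
  mderiv J (fun t => F t - G t) (fun t => F' t - G' t).
Proof. by move=> H K; apply: mderivD => //; apply: mderivN. Qed.

Lemma mderiv_tr J m n (F F' : R -> 'M[R]_(m, n)) :
  mderiv J F F' -> mderiv J (fun t => (F t)^T) (fun t => (F' t)^T).
Proof.
by move=> H i j; apply: eq_has_deriv (H j i) => t _; rewrite mxE.
Qed.

Lemma mderivM J m n p (F F' : R -> 'M[R]_(m, n)) (G G' : R -> 'M[R]_(n, p)) :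
  mderiv J F F' -> mderiv J G G' ->
  mderiv J (fun t => F t *m G t) (fun t => F' t *m G t + F t *m G' t).
Proof.
move=> H K i j.
apply: (eq_has_deriv _ _ (@has_deriv_sum _ _ _ (index_enum 'I_n) xpredT
  _ _ (fun l _ => has_derivM (H i l) (K l j)))) => t _.
  by rewrite mxE.
by rewrite !mxE big_split.
Qed.

Lemma mderiv_sum J m n (T : Type) (r : seq T) (P : pred T)
    (F G : T -> R -> 'M[R]_(m, n)) :
  (forall i, P i -> mderiv J (F i) (G i)) ->
  mderiv J (fun t => \sum_(i <- r | P i) F i t)
           (fun t => \sum_(i <- r | P i) G i t).
Proof.
move=> H i j; apply: (eq_has_deriv _ _
  (@has_deriv_sum _ _ _ r P _ _ (fun l Pl => H l Pl i j))) => t _;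
  by rewrite summxE.
Qed.

Lemma msmooth_cst J k m n (C : 'M[R]_(m, n)) : msmooth J k (fun=> C).
Proof. by move=> i j; exact: smooth_cst. Qed.

Lemma msmoothD J k m n (F G : R -> 'M[R]_(m, n)) :
  msmooth J k F -> msmooth J k G -> msmooth J k (fun t => F t + G t).
Proof.
by move=> H K i j; apply: eq_smooth (smoothD (H i j) (K i j)) => t _; rewrite mxE.
Qed.

Lemma msmoothN J k m n (F : R -> 'M[R]_(m, n)) :
  msmooth J k F -> msmooth J k (fun t => - F t).
Proof.
by move=> H i j; apply: eq_smooth (smoothN (H i j)) => t _; rewrite mxE.
Qed.

Lemma msmoothB J k m n (F G : R -> 'M[R]_(m, n)) :
  msmooth J k F -> msmooth J k G -> msmooth J k (fun t => F t - G t).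
Proof. by move=> H K; apply: msmoothD => //; apply: msmoothN. Qed.

Lemma msmooth_tr J k m n (F : R -> 'M[R]_(m, n)) :
  msmooth J k F -> msmooth J k (fun t => (F t)^T).
Proof. by move=> H i j; apply: eq_smooth (H j i) => t _; rewrite mxE. Qed.

Lemma msmoothM J k m n p (F : R -> 'M[R]_(m, n)) (G : R -> 'M[R]_(n, p)) :
  msmooth J k F -> msmooth J k G -> msmooth J k (fun t => F t *m G t).
Proof.
move=> H K i j.
apply: (eq_smooth _ (@smooth_sum _ _ _ _ (index_enum 'I_n) xpredT
  _ (fun l _ => smoothM (H i l) (K l j)))) => t _.
by rewrite mxE.
Qed.

Lemma msmoothZ J k m n (f : R -> R) (F : R -> 'M[R]_(m, n)) :
  smooth J k f -> msmooth J k F -> msmooth J k (fun t => f t *: F t).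
Proof.
by move=> H K i j; apply: eq_smooth (smoothM H (K i j)) => t _; rewrite mxE.
Qed.

Lemma smooth_det J k n (F : R -> 'M[R]_n) :
  msmooth J k F -> smooth J k (fun t => \det (F t)).
Proof.
move=> H; apply: smooth_sum => s _; apply: smoothM; first exact: smooth_cst.
by apply: smooth_prod.
Qed.

Lemma msmooth_inv J k n (F : R -> 'M[R]_n) :
  (forall t, J t -> F t \in unitmx) -> msmooth J k F ->
  msmooth J k (fun t => invmx (F t)).
Proof.
move=> uF sF.
apply: (@eq_msmooth _ _ _ _ (fun t => (\det (F t))^-1 *: \adj (F t))).
  by move=> t Jt; rewrite /invmx uF.
apply: msmoothZ.
  apply: smoothV; last exact: smooth_det.
  by move=> t /uF; rewrite unitmxE unitfE.
move=> i j; apply: (@eq_smooth _ _ _ (fun t => cofactor (F t) j i)).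
  by move=> t _; rewrite mxE.
apply: smoothM; first exact: smooth_cst.
apply: smooth_det => i' j'.
by apply: (@eq_smooth _ _ _ (fun t => F t (lift j i') (lift i j'))) => [t _|];
  [rewrite !mxE|exact: sF].
Qed.

Lemma msmooth_row_mx J k m n1 n2 (F : R -> 'M[R]_(m, n1))
    (G : R -> 'M[R]_(m, n2)) :
  msmooth J k F -> msmooth J k G -> msmooth J k (fun t => row_mx (F t) (G t)).
Proof.
move=> H K i j; case: (split_ordP j) => l ->.
  by apply: eq_smooth (H i l) => t _; rewrite row_mxEl.
by apply: eq_smooth (K i l) => t _; rewrite row_mxEr.
Qed.

Lemma msmooth_col_mx J k m1 m2 n (F : R -> 'M[R]_(m1, n))
    (G : R -> 'M[R]_(m2, n)) :
  msmooth J k F -> msmooth J k G -> msmooth J k (fun t => col_mx (F t) (G t)).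
Proof.
move=> H K i j; case: (split_ordP i) => l ->.
  by apply: eq_smooth (H l j) => t _; rewrite col_mxEu.
by apply: eq_smooth (K l j) => t _; rewrite col_mxEd.
Qed.

Lemma msmooth_lsubmx J k m n1 n2 (F : R -> 'M[R]_(m, n1 + n2)) :
  msmooth J k F -> msmooth J k (fun t => lsubmx (F t)).
Proof. by move=> H i j; apply: eq_smooth (H i (lshift n2 j)) => t _; rewrite mxE. Qed.

Lemma msmooth_rsubmx J k m n1 n2 (F : R -> 'M[R]_(m, n1 + n2)) :
  msmooth J k F -> msmooth J k (fun t => rsubmx (F t)).
Proof. by move=> H i j; apply: eq_smooth (H i (rshift n1 j)) => t _; rewrite mxE. Qed.

Section OnInterval.
Variables (a b : R).
Hypothesis ab : a < b.
Local Notation J := (`[a, b]%classic : set R).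

Lemma mderiv_deriveI_eq m n (F G : R -> 'M[R]_(m, n)) t :
  mderiv J F G -> J t -> deriveI J F t = G t.
Proof.
move=> /mderivP FG Jt; have FF := proper_within_itv ab Jt.
by apply: cvg_lim (FG t Jt); exact: norm_hausdorff.
Qed.

Lemma C0_msmooth m n (F : R -> 'M[R]_(m, n)) :
  {within J, continuous F} <-> msmooth J 0 F.
Proof.
split=> [/subspace_continuousP H i j t Jt|H].
  by have /cvg_mx/(_ i j) := H t Jt.
by apply/subspace_continuousP => t Jt; apply/cvg_mx => i j; exact: H.
Qed.

Lemma Ck_msmooth k m n (F : R -> 'M[R]_(m, n)) : Ck J k F <-> msmooth J k F.
Proof.
elim: k F => [|k IH] F /=; first exact: C0_msmooth.
split=> [[dF /IH sF]|sF].
  by apply: mderiv_msmooth sF; apply/mderivP => t /dF.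
have [G FG sG] := msmooth_mderiv sF.
split; first by move=> t Jt; apply/cvg_ex; exists (G t); move/mderivP: FG; apply.
apply/IH; apply: eq_msmooth sG => t Jt.
by rewrite (mderiv_deriveI_eq FG).
Qed.

Lemma mderiv_deriveI k m n (F : R -> 'M[R]_(m, n)) :
  msmooth J k.+1 F -> mderiv J F (deriveI J F).
Proof.
move=> sF; have [G FG _] := msmooth_mderiv sF.
by apply: (eq_mderiv _ _ FG) => // t Jt; rewrite (mderiv_deriveI_eq FG).
Qed.

Lemma msmooth_deriveI k m n (F : R -> 'M[R]_(m, n)) :
  msmooth J k.+1 F -> msmooth J k (deriveI J F).
Proof.
move=> sF; have [G FG sG] := msmooth_mderiv sF.
by apply: eq_msmooth sG => // t Jt; rewrite (mderiv_deriveI_eq FG).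
Qed.

Lemma msmooth_derivenI k i m n (F : R -> 'M[R]_(m, n)) :
  msmooth J (k + i) F -> msmooth J k (derivenI J i F).
Proof.
elim: i k => [|i IH] k; first by rewrite addn0.
by rewrite addnS => sF; apply: msmooth_deriveI; apply: IH.
Qed.

Lemma mderiv_derivenI i m n (F : R -> 'M[R]_(m, n)) :
  msmooth J i.+1 F -> mderiv J (derivenI J i F) (derivenI J i.+1 F).
Proof. by move=> sF; apply: (@mderiv_deriveI 0); apply: msmooth_derivenI. Qed.

End OnInterval.

End MatrixCalculus.

(** * Mean value inequality and functions of zero derivative *)

Section MeanValue.
Context {R : realType}.
Implicit Types (f g : R -> R).

Lemma cvg_shift_dnbhs (t : R) : s - t @[s --> t^'] --> (0 : R)^'.
Proof.
move=> A; rewrite /dnbhs /within /= => /nbhs_ballP[e /= e0 He].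
apply/nbhs_ballP; exists e => //= s st s0.
apply: He; last by rewrite subr_eq0.
by rewrite -ball_normE /= sub0r opprB; move: st; rewrite -ball_normE.
Qed.

Lemma cvg_unshift_dnbhs (t : R) : s + t @[s --> (0 : R)^'] --> t^'.
Proof.
move=> A; rewrite /dnbhs /within /= => /nbhs_ballP[e /= e0 He].
apply/nbhs_ballP; exists e => //= s st s0.
apply: He; last by rewrite -subr_eq0 addrK.
by rewrite -ball_normE /= opprD addrCA subrr addr0; move: st; rewrite -ball_normE /= sub0r.
Qed.

Lemma is_derive_has_deriv (J : set R) f g :
  (forall t, J t -> derivable f t 1 /\ derive1 f t = g t) -> has_deriv J f g.
Proof.
move=> H t Jt; have [df <-] := H t Jt; rewrite derive1E.
apply: cvg_within_filter.
have : (fun h => h^-1 *: ((f \o shift t) (h *: 1) - f t)) \o (fun s => s - t) @ t^'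
    --> 'D_1 f t.
  by apply: (cvg_comp _ _ (@cvg_shift_dnbhs t) df).
apply: cvg_trans; apply: near_eq_cvg; near=> s.
by rewrite /= -[_ *: 1]/(_ * 1) mulr1 subrK.
Unshelve. all: by end_near.
Qed.

Lemma has_deriv_is_derive (a b t : R) f g : has_deriv `[a, b]%classic f g ->
  t \in `]a, b[ -> is_derive t 1 f (g t).
Proof.
move=> H tab; have Jt : `[a, b]%classic t by apply: subset_itv_oo_cc.
have E : within `[a, b]%classic t^' = t^'.
  apply/seteqP; split => A.
    move=> HA'.
    have HA : \forall s \near t, s != t -> `[a, b]%classic s -> A s by exact: HA'.
    rewrite /dnbhs /within /=.
    apply: filterS2 (near_in_itvoo tab) HA => s sab HA st; apply: HA => //.
    exact: subset_itv_oo_cc.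
  exact: cvg_within.
have HH : h^-1 *: ((f \o shift t) (h *: 1) - f t) @[h --> 0^'] --> g t.
  have : (fun s => (s - t)^-1 * (f s - f t)) \o (fun s => s + t) @ 0^' --> g t.
    by apply: (cvg_comp _ _ (@cvg_unshift_dnbhs t)); rewrite -E; exact: H.
  apply: cvg_trans; apply: near_eq_cvg; near=> s.
  by rewrite /= -[_ *: 1]/(_ * 1) mulr1 addrK.
split; first by apply/cvg_ex; exists (g t).
by apply: cvg_lim HH; exact: norm_hausdorff.
Unshelve. all: by end_near.
Qed.

Lemma has_deriv_le (a b : R) f f' g g' : 
  has_deriv `[a, b]%classic f f' -> has_deriv `[a, b]%classic g g' ->
  (forall t, `[a, b]%classic t -> f' t <= g' t) ->
  forall x y, a <= x -> x <= y -> y <= b -> f y - f x <= g y - g x.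
Proof.
move=> Hf Hg fg x y ax xy yb.
have sub : `[x, y]%classic `<=` `[a, b]%classic.
  by move=> s; rewrite /= !in_itv /= => /andP[? ?]; rewrite (le_trans ax)// (le_trans _ yb).
have Hh := has_deriv_subset sub (has_derivD Hg (has_derivN Hf)).
have [s sxy||s sxy E] := @MVT_segment _ (fun t => g t + - f t)
    (fun t => g' t + - f' t) _ _ xy.
- exact: has_deriv_is_derive Hh sxy.
- apply/subspace_continuousP; exact: (has_deriv_continuous Hh).
have := fg s (sub s sxy); rewrite -subr_ge0 => H0.
have : 0 <= (g' s - f' s) * (y - x) by rewrite mulr_ge0// subr_ge0.
by rewrite -E; lra.
Qed.

Lemma has_deriv0_cst (a b : R) f : has_deriv `[a, b]%classic f (fun=> 0) ->
  forall x y, `[a, b]%classic x -> `[a, b]%classic y -> f x = f y.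
Proof.
move=> Hf x y; rewrite /= !in_itv /=.
wlog xy : x y / x <= y => [W|] /andP[ax xb] /andP[ay yb].
  have [xy|/ltW yx] := leP x y; first by apply: W => //; apply/andP.
  by apply/esym/W => //; apply/andP.
have H0 : has_deriv `[a, b]%classic (fun=> 0 : R) (fun=> 0) by exact: has_deriv_cst.
have H1 := has_deriv_le Hf H0 (fun _ _ => lexx 0) ax xy yb.
have H2 := has_deriv_le H0 Hf (fun _ _ => lexx 0) ax xy yb.
by apply/eqP; rewrite eq_le; apply/andP; split; lra.
Qed.

Lemma mderiv0_cst (a b : R) m n (F : R -> 'M[R]_(m, n)) :
  mderiv `[a, b]%classic F (fun=> 0) ->
  forall x y, `[a, b]%classic x -> `[a, b]%classic y -> F x = F y.
Proof.
move=> HF x y Jx Jy; apply/matrixP => i j.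
apply: (@has_deriv0_cst a b (fun t => F t i j)) => //.
by apply: eq_has_deriv (HF i j) => // t _; rewrite mxE.
Qed.

End MeanValue.

(** * Linear differential equations *)

Section LinearODE.
Context {R : realType}.
Variables (a b : R).
Hypothesis ab : a < b.
Local Notation J := (`[a, b]%classic : set R).

Lemma ex_antiderivative (h : R -> R) : smooth J 0 h ->
  exists H, has_deriv J H h /\ H a = 1.
Proof.
(* Clamping extends [h] continuously to the line, and the integral starts at [a - 1], so that every
   point of [[a, b]] is interior to the range of the fundamental theorem. *)
move=> sh; pose cl (t : R) := Num.max a (Num.min b t).
have Jcl t : J (cl t).
  by rewrite /= in_itv /= /cl le_max lexx /= ge_max ge_min lexx ltW.
have clE t : J t -> cl t = t.
  by rewrite /= in_itv /= => /andP[at_ tb]; rewrite /cl min_r// max_r.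
have ccl : continuous cl.
  move=> t; apply: max_fun_continuous; first exact: cst_continuous.
  by move=> s; apply: min_fun_continuous; [exact: cst_continuous|move=> ?; exact: cvg_id].
have ch : continuous (h \o cl).
  move=> t; apply: (@cvg_comp _ _ _ cl h _ (within J (nbhs (cl t)))).
    move=> A HA; have Hn : \forall s \near t, J (cl s) -> A (cl s).
      by apply: (ccl t (fun s => J s -> A s)); exact: HA.
    by apply: filterS Hn => s; apply; exact: Jcl.
  exact: sh.
pose F x := (\int[lebesgue_measure]_(t in `[(a - 1), x]) (h \o cl) t)%R.
exists (fun x => F x + (1 - F a)); split; last by rewrite addrCA subrr addr0.
have HF : has_deriv J F h.
  apply: is_derive_has_deriv => t Jt.
  have [at_ tb] : a <= t /\ t <= b by move: Jt; rewrite /= in_itv /= => /andP.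
  have [] := @continuous_FTC1_closed R (h \o cl) (a - 1) t (b + 1).
  - by rewrite (le_lt_trans tb)// ltrDl.
  - apply: continuous_compact_integrable; first exact: segment_compact.
    by apply: continuous_subspaceT => x; exact: ch.
  - by rewrite ltrBlDr (le_lt_trans at_)// ltrDl.
  - exact: ch.
  by move=> dF ->; split => //=; rewrite clE.
apply: (eq_has_deriv _ _ (has_derivD HF (@has_deriv_cst _ _ (1 - F a)))) => // t _.
by rewrite addr0.
Qed.

Lemma smooth_bounded k (h : R -> R) : smooth J k h ->
  exists2 B, 0 <= B & forall t, J t -> `|h t| <= B.
Proof.
move=> sh; have [c cJ Hc] : exists2 c, c \in `[a, b]%R &
    forall t, t \in `[a, b]%R -> `|h t| <= `|h c|.
  apply: EVT_max; first exact: ltW.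
  apply/subspace_continuousP => t Jt.
  by apply: cvg_norm; exact: smooth_cvg Jt sh.
by exists `|h c|.
Qed.

Lemma msmooth_bounded k m n (F : R -> 'M[R]_(m, n)) : msmooth J k F ->
  exists2 C : R, 0 <= C & forall t i, J t -> \sum_j `|F t i j| <= C.
Proof.
move=> sF.
have /choice[B HB] : forall ij : 'I_m * 'I_n, exists B, 0 <= B /\
    forall t, J t -> `|F t ij.1 ij.2| <= B.
  by move=> ij; have [B B0 HB] := smooth_bounded (sF ij.1 ij.2); exists B.
exists (\sum_i \sum_j B (i, j)).
  by do 2?[apply: sumr_ge0 => ? _]; exact: (HB _).1.
move=> t i Jt; rewrite (bigD1 i)//=; apply: ler_wpDr.
  by do 2?[apply: sumr_ge0 => ? _]; exact: (HB _).1.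
by apply: ler_sum => j _; exact: (HB (i, j)).2.
Qed.

Lemma has_deriv_bound (f f' g g' : R -> R) : has_deriv J f f' ->
  has_deriv J g g' -> (forall t, J t -> `|f' t| <= g' t) ->
  forall t, J t -> `|f t - f a| <= g t - g a.
Proof.
move=> Hf Hg fg t; rewrite /= in_itv /= => /andP[a_t tb].
have H1 := has_deriv_le Hf Hg (fun t Jt => le_trans (ler_norm _) (fg t Jt)) (lexx a) a_t tb.
have H2 : forall t, J t -> - f' t <= g' t.
  by move=> s Js; apply: le_trans (fg s Js); rewrite -normrN ler_norm.
have {}H2 := has_deriv_le (has_derivN Hf) Hg H2 (lexx a) a_t tb.
by rewrite ler_norml; apply/andP; split; lra.
Qed.

Lemma geometric_le0 (c x : R) : (forall n, x <= c * 2^-1 ^+ n) -> x <= 0.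
Proof.
move=> H; rewrite leNgt; apply/negP => x0.
have c0 : 0 < c by have := H 0%N; rewrite expr0 mulr1; apply: lt_le_trans.
have [n] : exists n, c / x < n%:R.
  by exists (Num.Def.archi_bound (c / x)); apply: archi_boundP; rewrite divr_ge0 ?ltW.
rewrite ltr_pdivrMr// => H1; have := H n.
rewrite exprVn ler_pdivlMr ?exprn_gt0// leNgt => /negP; apply.
apply: (lt_le_trans H1); rewrite mulrC ler_pM2l//.
by rewrite -natrX ler_nat ltnW// ltn_expl.
Qed.

(* Picard iteration; the weight [exp (2 C (t - a))] makes it a contraction of
   ratio 1/2 on the whole interval. *)
Lemma ex_fundamental_matrix_left d (M : R -> 'M[R]_d) : msmooth J 0 M ->
  exists2 X, mderiv J X (fun t => M t *m X t) & X a = 1%:M.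
Proof.
move=> sM.
have /choice[T HT] : forall F : R -> 'M[R]_d, exists G : R -> 'M[R]_d,
    msmooth J 0 F -> mderiv J G (fun t => M t *m F t) /\ G a = 1%:M.
  move=> F; have [sF|nF] := pselect (msmooth J 0 F); last by exists F.
  have sMF := msmoothM sM sF.
  have /choice[G HG] : forall ij : 'I_d * 'I_d, exists g,
      has_deriv J g (fun t => (M t *m F t) ij.1 ij.2) /\ g a = 1.
    by move=> ij; exact: ex_antiderivative (sMF ij.1 ij.2).
  (* All antiderivatives in [G] take the value 1 at [a]; subtracting 1 off the diagonal yields the
     identity there. *)
  exists (fun t => \matrix_(i, j) (G (i, j) t - (i != j)%:R)) => _; split.
    move=> i j; apply: (eq_has_deriv _ _
      (has_derivD (HG (i, j)).1 (@has_deriv_cst _ _ (- (i != j)%:R)))) => t _.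
      by rewrite mxE.
    by rewrite addr0.
  apply/matrixP => i j; rewrite !mxE (HG _).2.
  by case: eqP => _ /=; rewrite ?subr0 ?subrr.
pose Y n := iter n T (fun=> 0).
have sY n : msmooth J 0 (Y n).
  elim: n => [|n IH]; first exact: msmooth_cst.
  by move=> i j; apply: has_deriv_continuous; exact: (HT _ IH).1.
have dY n : mderiv J (Y n.+1) (fun t => M t *m Y n t) by exact: (HT _ (sY n)).1.
have Ya n : Y n.+1 a = 1%:M by exact: (HT _ (sY n)).2.
have [C C0 HC] := msmooth_bounded sM.
have bM (F : 'M[R]_d) (y : R) t i j : J t -> (forall l, `|F l j| <= y) ->
    `|(M t *m F) i j| <= C * y.
  move=> Jt HF; rewrite mxE; apply: le_trans (ler_norm_sum _ _ _) _.
  apply: (@le_trans _ _ (\sum_l `|M t i l| * y)).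
    by apply: ler_sum => l _; rewrite normrM ler_wpM2l.
  rewrite -mulr_suml ler_wpM2r// ?HC//; exact: le_trans (HF i).
pose E (t : R) := expR (2 * C * (t - a)).
have dE c : has_deriv J (fun t => c * E t) (fun t => c * (2 * C * E t)).
  apply: is_derive_has_deriv => t _.
  have H : is_derive t 1 (fun t => c * E t) (c * (2 * C * E t)).
    rewrite /E; apply: is_derive_eq.
    by rewrite /GRing.scale /= subr0 mulr1 [_ * (2 * C)]mulrC.
  by split; [|rewrite derive1E derive_val].
have Ea : E a = 1 by rewrite /E subrr mulr0 expR0.
have E0 t : 0 <= E t by exact: expR_ge0.
pose D n t := Y n.+1 t - Y n t.
have bD n t i j : J t -> `|D n t i j| <= 2^-1 ^+ n * E t.
  elim: n t i j => [|n IH] t i j Jt.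
    rewrite /D subr0 expr0 mul1r.
    have := has_deriv_bound (g := fun t => 1 * E t) (dY 0%N i j) (dE 1) _ Jt.
    rewrite !mul1r Ya Ea => H; apply: le_trans (_ : 1 + (E t - 1) <= _); last by lra.
    rewrite -[Y 1%N t i j](subrK ((1%:M : 'M[R]_d) i j)) [X in `|X|]addrC.
    apply: le_trans (ler_normD _ _) _; apply: lerD.
      by rewrite mxE; case: (i == j); rewrite ?normr1 ?normr0.
    apply: H => s Js; rewrite mulmx0 mxE normr0 !mulr_ge0//.
  have dD : has_deriv J (fun t => D n.+1 t i j) (fun t => (M t *m D n t) i j).
    have H : mderiv J _ _ := mderivB (dY n.+1) (dY n).
    by apply: (eq_has_deriv _ _ (H i j)) => s _ //; rewrite mulmxBr.
  have := has_deriv_bound dD (dE (2^-1 ^+ n.+1)) _ Jt.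
  have -> : D n.+1 a i j = 0 by rewrite /D !Ya subrr mxE.
  rewrite subr0 => H; apply: le_trans (H _) _.
    move=> s Js; apply: le_trans (bM _ _ _ i j Js (fun l => IH s l j Js)) _.
    by rewrite le_eqVlt exprS; apply/orP; left; apply/eqP; field.
  by rewrite lerBlDr lerDl mulr_ge0// ?exprn_ge0 ?invr_ge0.
(* The tail of the geometric series from [n] on is [2 * 2^-n * E b]. With this radius the intervals
   from [lo n] to [hi n] are nested, and the limit is the supremum of their left ends. *)
pose B := 2 * E b.
have B0 : 0 <= B by rewrite mulr_ge0.
have bDb n t i j : J t -> `|D n t i j| <= 2^-1 ^+ n * E b.
  move=> Jt; apply: le_trans (bD n t i j Jt) _.
  rewrite ler_wpM2l ?exprn_ge0 ?invr_ge0// /E ler_expR ler_wpM2l ?mulr_ge0//.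
  by move: Jt; rewrite /= in_itv /= => /andP[_]; rewrite lerD2r.
pose lo n t i j := Y n t i j - B * 2^-1 ^+ n.
pose hi n t i j := Y n t i j + B * 2^-1 ^+ n.
have lo_nd t i j : J t -> {homo (fun n => lo n t i j) : m n / (m <= n)%N >-> m <= n}.
  move=> Jt; apply: homo_leq => [//|x y z|n]; first exact: le_trans.
  have := bDb n t i j Jt; rewrite ler_norml => /andP[+ _].
  rewrite /D !mxE /lo /B exprS; set q := 2^-1 ^+ n; set e := E b; lra.
have hi_ni t i j : J t -> {homo (fun n => hi n t i j) : m n / (m <= n)%N >-> n <= m}.
  move=> Jt; apply: homo_leq => [//|x y z yx zy|n]; first exact: le_trans zy yx.
  have := bDb n t i j Jt; rewrite ler_norml => /andP[_].
  rewrite /D !mxE /hi /B exprS; set q := 2^-1 ^+ n; set e := E b; lra.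
have lohi m n t i j : J t -> lo m t i j <= hi n t i j.
  move=> Jt; apply: (@le_trans _ _ (lo (maxn m n) t i j)).
    by apply: lo_nd => //; rewrite leq_maxl.
  apply: (@le_trans _ _ (hi (maxn m n) t i j)).
    by rewrite lerD2l ge0_cp// mulr_ge0// exprn_ge0// invr_ge0.
  by apply: hi_ni => //; rewrite leq_maxr.
pose X t := \matrix_(i, j) sup (range (fun n => lo n t i j)).
have XY n t i j : J t -> `|X t i j - Y n t i j| <= B * 2^-1 ^+ n.
  move=> Jt; rewrite mxE ler_distl; apply/andP; split.
    apply: ub_le_sup; last by exists n.
    by exists (hi 0%N t i j) => _ [m _ <-]; exact: lohi.
  apply: sup_le_ub; first by exists (lo 0%N t i j), 0%N.
  by move=> _ [m _ <-]; exact: lohi.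
have sX : msmooth J 0 X.
  move=> i j t Jt; apply/cvgrPdist_le => e e0.
  have [n Hn] : exists n, B * 2^-1 ^+ n <= e / 3.
    apply: contrapT => /forallNP H; suff : e / 3 <= 0 by rewrite leNgt divr_gt0.
    apply: (@geometric_le0 B) => n; rewrite leNgt; apply/negP => /ltW; exact: H.
  have /cvgrPdist_le/(_ (e / 3) _) HY := sY n i j t Jt.
  have {}HY := HY (divr_gt0 e0 (ltr0n _ 3)).
  move: HY; rewrite !near_withinE; apply: filterS => s HY Js.
  have := HY Js; have := XY n t i j Jt; have := XY n s i j Js.
  rewrite !ler_norml => /andP[? ?] /andP[? ?] /andP[? ?].
  by apply/andP; split; lra.
have [dTX TXa] := HT _ sX.
have TX t : J t -> T X t = X t.
  move=> Jt; apply/matrixP => i j; apply/eqP; rewrite -subr_eq0 -normr_le0.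
  apply: (@geometric_le0 (C * B * (b - a) + B)) => n.
  have dTY : has_deriv J (fun t => T X t i j - Y n.+1 t i j)
      (fun t => (M t *m (X t - Y n t)) i j).
    have H : mderiv J _ _ := mderivB dTX (dY n).
    by apply: (eq_has_deriv _ _ (H i j)) => s _; rewrite ?mulmxBr !mxE.
  have dlin : has_deriv J (fun t => (C * B * 2^-1 ^+ n) * t)
      (fun t => C * B * 2^-1 ^+ n).
    apply: is_derive_has_deriv => s _.
    have H : is_derive s 1 (fun t => (C * B * 2^-1 ^+ n) * t) (C * B * 2^-1 ^+ n).
      apply: is_derive_eq.
      by rewrite /GRing.scale /= mulr1.
    by split; [|rewrite derive1E derive_val].
  have := has_deriv_bound dTY dlin _ Jt; rewrite TXa Ya subrr subr0 -mulrBr => H.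
  rewrite -[T X t i j](subrK (Y n.+1 t i j)) -addrA.
  apply: le_trans (ler_normD _ _) _; rewrite mulrDl; apply: lerD.
    apply: le_trans (H _) _ => [s Js|].
      rewrite -mulrA; apply: (bM _ _ _ _ _ Js) => l.
      have -> : (X s - Y n s) l j = X s l j - Y n s l j.
        by rewrite [LHS]mxE; congr (_ + _); rewrite mxE.
      exact: XY.
    rewrite [leRHS](_ : _ = C * B * 2^-1 ^+ n * (b - a)); last by ring.
    apply: ler_wpM2l; first by rewrite !mulr_ge0 ?exprn_ge0 ?invr_ge0.
    by move: Jt; rewrite /= in_itv /= => /andP[_]; rewrite lerD2r.
  rewrite distrC; apply: le_trans (XY _ _ _ _ Jt) _.
  by rewrite ler_wpM2l// exprS ler_piMl ?exprn_ge0 ?invr_ge0// invf_le1// ler1n.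
exists X; last by rewrite -TX//= in_itv /= lexx ltW.
exact: eq_mderiv TX (fun _ _ => erefl) dTX.
Qed.

End LinearODE.

Section FundamentalMatrix.
Context {R : realType}.
Variables (a b : R).
Hypothesis ab : a < b.
Local Notation J := (`[a, b]%classic : set R).

Lemma msmooth_ode k d p (M : R -> 'M[R]_d) (X : R -> 'M[R]_(d, p)) :
  msmooth J k M -> mderiv J X (fun t => M t *m X t) -> msmooth J k.+1 X.
Proof.
move=> sM dX; elim: k sM => [|k IH] sM.
  apply: (mderiv_msmooth dX); apply: msmoothM => //.
  by move=> i j; apply: has_deriv_continuous; exact: dX.
apply: (mderiv_msmooth dX); apply: msmoothM => //.
by apply: IH; exact: msmooth_le sM.
Qed.

(** The adjoint equation [W' = - M^T W] keeps [W^T X] constant, so [X] is invertible everywhere;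
    dividing by [X t0] moves the initial point from the left end to [t0]. *)
Lemma ex_fundamental_matrix k d (M : R -> 'M[R]_d) t0 : J t0 -> msmooth J k M ->
  exists X, [/\ mderiv J X (fun t => M t *m X t), X t0 = 1%:M,
    forall t, J t -> X t \in unitmx & msmooth J k.+1 X].
Proof.
move=> Jt0 sM; have sM0 := msmooth_le (leq0n k) sM.
have Ja : J a by rewrite /= in_itv /= lexx ltW.
have [X dX Xa] := ex_fundamental_matrix_left ab sM0.
have [W dW Wa] := ex_fundamental_matrix_left ab (msmoothN (msmooth_tr sM0)).
have WX t : J t -> (W t)^T *m X t = 1%:M.
  move=> Jt; have : mderiv J (fun t => (W t)^T *m X t) (fun=> 0).
    apply: (eq_mderiv _ _ (mderivM (mderiv_tr dW) dX)) => // s _.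
    by rewrite trmx_mul linearN /= trmxK mulmxN mulNmx mulmxA addNr.
  by move=> /mderiv0_cst/(_ t a Jt Ja) ->; rewrite Wa Xa trmx1 mulmx1.
have uX t : J t -> X t \in unitmx by move=> /WX /mulmx1_unit[].
exists (fun t => X t *m invmx (X t0)).
have dX' : mderiv J (fun t => X t *m invmx (X t0))
    (fun t => M t *m (X t *m invmx (X t0))).
  apply: (eq_mderiv _ _ (mderivM dX (@mderiv_cst _ _ _ _ (invmx (X t0))))) => // t _.
  by rewrite mulmx0 addr0 mulmxA.
split=> //; first by rewrite mulmxV// uX.
  by move=> t Jt; rewrite unitmx_mul uX// unitmx_inv uX.
exact: msmooth_ode sM dX'.
Qed.

End FundamentalMatrix.

(** * Smooth families of matrices *)

Section LinearAlgebra.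
Context {R : realType}.

Lemma mulmx_tr_eq0 m n (A : 'M[R]_(m, n)) : A *m A^T = 0 -> A = 0.
Proof.
move=> H; apply/matrixP => i j; rewrite mxE.
have /matrixP/(_ i i) := H; rewrite !mxE => /eqP.
rewrite psumr_eq0 => [/allP/(_ j)|l _]; last by rewrite mxE -expr2 sqr_ge0.
by rewrite mem_index_enum mxE -expr2 sqrf_eq0 => /(_ isT)/eqP.
Qed.

Lemma inj_row_free m n (A : 'M[R]_(m, n)) :
  (forall c : 'rV_m, c *m A = 0 -> c = 0) -> row_free A.
Proof.
move=> H; rewrite -kermx_eq0; apply/eqP/row_matrixP => i.
by rewrite row0; apply: H; rewrite -row_mul mulmx_ker row0.
Qed.

Lemma row_free_mul0 m n p (A : 'M[R]_(m, n)) (C : 'M[R]_(p, m)) :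
  row_free A -> C *m A = 0 -> C = 0.
Proof. by move=> fA CA; apply: (row_free_inj fA); rewrite CA mul0mx. Qed.

Lemma gram_unit m n (A : 'M[R]_(m, n)) : row_free A -> A *m A^T \in unitmx.
Proof.
move=> fA; rewrite -row_free_unit; apply: inj_row_free => c.
rewrite mulmxA => H; apply: (row_free_mul0 fA); apply: mulmx_tr_eq0.
by rewrite trmx_mul mulmxA H mul0mx.
Qed.

Lemma unit_gram m n (A : 'M[R]_(m, n)) : A *m A^T \in unitmx -> row_free A.
Proof.
move=> uA; apply: inj_row_free => c cA.
by rewrite -[c](mulmxK uA) mulmxA cA !mul0mx.
Qed.

(* The coefficients of the rows of [X] with respect to the rows of [A],
   meaningful when [A] has independent rows whose span contains those of [X]. *)
Definition rcoef m n p (X : 'M[R]_(p, n)) (A : 'M[R]_(m, n)) : 'M[R]_(p, m) :=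
  X *m A^T *m invmx (A *m A^T).

Lemma rcoefK m n p (C : 'M[R]_(p, m)) (A : 'M[R]_(m, n)) : row_free A ->
  rcoef (C *m A) A = C.
Proof. by move=> fA; rewrite /rcoef -(mulmxA C) mulmxK// gram_unit. Qed.

Lemma rcoef_sub m n p (X : 'M[R]_(p, n)) (A : 'M[R]_(m, n)) : row_free A ->
  (X <= A)%MS -> rcoef X A *m A = X.
Proof. by move=> fA /submxP[C ->]; rewrite rcoefK. Qed.

Lemma msmooth_rcoef (J : set R) k m n p (X : R -> 'M[R]_(p, n))
    (A : R -> 'M[R]_(m, n)) : (forall t, J t -> row_free (A t)) ->
  msmooth J k X -> msmooth J k A -> msmooth J k (fun t => rcoef (X t) (A t)).
Proof.
move=> fA sX sA; have sAt := msmooth_tr sA.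
apply: msmoothM; first exact: msmoothM.
apply: msmooth_inv; last exact: msmoothM.
by move=> t Jt; apply: gram_unit; exact: fA.
Qed.

Lemma row_free_extend m n (A : 'M[R]_(m, n)) (x : 'rV[R]_n) :
  row_free A -> ~~ (x <= A)%MS -> row_free (col_mx A x).
Proof.
move=> fA nx; apply: inj_row_free => c; rewrite -[c]hsubmxK mul_row_col.
set y := rsubmx c => H; have y0 : y = 0.
  apply/matrixP => i j; rewrite !ord1 [RHS]mxE; apply/eqP/negPn/negP => y0.
  move/negP: nx; apply; apply/submxP; exists (- (y 0 0)^-1 *: lsubmx c).
  move/eqP: H; rewrite addr_eq0 => /eqP H.
  rewrite -scalemxAl H scalerN scaleNr opprK [y in y *m x]mx11_scalar.
  by rewrite mul_scalar_mx scalerA mulVf ?scale1r.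
move: H; rewrite y0 mul0mx addr0 => /(row_free_mul0 fA) ->.
by rewrite row_mx0.
Qed.

(** Full row rank is the nonvanishing of a Gram determinant, an open condition. The interval found
    begins or ends at [t], which treats interior points and end points alike. *)
Lemma near_row_free (a b t : R) m n (F : R -> 'M[R]_(m, n)) : a < b ->
  `[a, b]%classic t -> msmooth `[a, b]%classic 0 F -> row_free (F t) ->
  exists a' b', [/\ a' < b', `[a', b']%classic `<=` `[a, b]%classic &
    forall s, `[a', b']%classic s -> row_free (F s)].
Proof.
move=> ab Jt sF fF; set J := `[a, b]%classic in Jt sF.
have sdet := smooth_det (msmoothM sF (msmooth_tr sF)).
have d0 : \det (F t *m (F t)^T) != 0 by rewrite -unitfE -unitmxE gram_unit.
have /(_ (fun x => x != 0)) := sdet t Jt.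
have nz : nbhs (\det (F t *m (F t)^T)) (fun x : R => x != 0).
  by apply: (open_nbhs_nbhs (A := [set x | x != 0])); split => //; exact: open_neq.
move=> /(_ nz) H.
have {}H : \forall s \near t, J s -> \det (F s *m (F s)^T) != 0 by exact: H.
have [e /= e0 He] := (nbhs_ballP _ _).1 H.
have H' s : J s -> `|t - s| < e -> row_free (F s).
  move=> Js ts; apply: unit_gram; rewrite unitmxE unitfE.
  by apply: (He s) => //; rewrite /ball /= /ball_ /=.
move: (Jt); rewrite /J /= in_itv /= => /andP[a_t tb].
have [tb'|bt] := ltP t b.
  pose s := Num.min (t + e / 2) b.
  have st : t < s by rewrite lt_min tb' andbT ltrDl divr_gt0.
  have sb : s <= b by rewrite ge_min lexx orbT.
  have se : s < t + e by rewrite gt_min ltrD2l ltr_pdivrMr// ltr_pMr// ltr1n.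
  have sub : `[t, s]%classic `<=` J.
    by move=> x; rewrite /J /= !in_itv /= => /andP[? ?]; apply/andP; split; lra.
  exists t, s; split=> // x xts; apply: H'; first exact: sub.
  by move: xts; rewrite /= in_itv /= => /andP[? ?]; rewrite ltr_norml; apply/andP; split; lra.
have at' : a < t by apply: lt_le_trans bt.
pose s := Num.max (t - e / 2) a.
have st : s < t by rewrite gt_max at' andbT ltrBlDr ltrDl divr_gt0.
have sa : a <= s by rewrite le_max lexx orbT.
have se : t - e < s by rewrite lt_max ltrD2l ltrN2 ltr_pdivrMr// ltr_pMr// ltr1n.
have sub : `[s, t]%classic `<=` J.
  by move=> x; rewrite /J /= !in_itv /= => /andP[? ?]; apply/andP; split; lra.
exists s, t; split=> // x xts; apply: H'; first exact: sub.
by move: xts; rewrite /= in_itv /= => /andP[? ?]; rewrite ltr_norml; apply/andP; split; lra.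
Qed.

End LinearAlgebra.

(** * The left kernel of the derivative array *)

Section LocalArray.
Context {R : realType}.
Implicit Types (J : set R).

(** Differential operators are families of coefficients indexed by [nat]; laying the first [N] of
    them side by side turns pointwise linear dependence of operators into inclusion of row
    spaces. *)
Definition pack N m n (Z : nat -> 'M[R]_(m, n)) : 'M[R]_(m, \sum_(i < N) n) :=
  \mxrow_(i < N) Z i.

Lemma mul_pack N p m n (C : 'M[R]_(p, m)) (Z : nat -> 'M[R]_(m, n)) :
  C *m pack N Z = pack N (fun i => C *m Z i).
Proof. by rewrite /pack mul_mxrow. Qed.

Lemma eq_packP N m n (Z Y : nat -> 'M[R]_(m, n)) :
  (forall i, (i < N)%N -> Z i = Y i) <-> pack N Z = pack N Y.
Proof.
have P := @eq_mxrowP R N (fun=> n) m (fun i => Z i) (fun i => Y i).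
split=> [H|H i iN]; first by apply/P => i; exact: H.
by move/P: H => /(_ (Ordinal iN)).
Qed.

Lemma pack0 N m n : pack N (fun=> 0 : 'M[R]_(m, n)) = 0.
Proof. exact: mxrow0. Qed.

Lemma col_pack N m1 m2 n (Z : nat -> 'M[R]_(m1, n)) (Y : nat -> 'M[R]_(m2, n)) :
  col_mx (pack N Z) (pack N Y) = pack N (fun i => col_mx (Z i) (Y i)).
Proof.
apply/matrixP => i j; rewrite mxE [RHS]mxE mxE.
by case: splitP => l _; rewrite mxE.
Qed.

Lemma pack_subP N p m n (X : nat -> 'M[R]_(p, n)) (Z : nat -> 'M[R]_(m, n)) :
  (pack N X <= pack N Z)%MS <->
  exists C, forall i, (i < N)%N -> X i = C *m Z i.
Proof.
split=> [/submxP[C]|[C H]]; first by rewrite mul_pack => /eq_packP H; exists C.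
by apply/submxP; exists C; rewrite mul_pack; apply/eq_packP.
Qed.

Lemma msmooth_pack J k N m n (Z : nat -> R -> 'M[R]_(m, n)) :
  (forall i, (i < N)%N -> msmooth J k (Z i)) ->
  msmooth J k (fun t => pack N (Z^~ t)).
Proof.
move=> H i j; apply: (eq_smooth _ (H (tagnat.sig1 j) (ltn_ord _) i (tagnat.sig2 j))) => t _.
by rewrite mxE.
Qed.

Lemma row_free_colP m n (A : 'M[R]_(m, n)) (x : 'rV[R]_n) :
  row_free (col_mx A x) -> row_free A /\ ~~ (x <= A)%MS.
Proof.
move=> H; split.
  apply: inj_row_free => c cA; have : row_mx c 0 *m col_mx A x = 0.
    by rewrite mul_row_col cA mul0mx addr0.
  by move=> /(row_free_mul0 H); rewrite -row_mx0 => /eq_row_mx[].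
apply/negP => /submxP[c xc]; have : row_mx c (- 1%:M) *m col_mx A x = 0.
  by rewrite mul_row_col -xc mulNmx mul1mx subrr.
move=> /(row_free_mul0 H); rewrite -row_mx0 => /eq_row_mx[_] /eqP.
by rewrite oppr_eq0 => /eqP/matrixP/(_ 0 0)/eqP; rewrite !mxE eqxx oner_eq0.
Qed.

Variables (n mu : nat).

(* [L i l] stands for the coefficient of the [l]-th derivative of [x] in the
   [i]-th derivative of [E x' - A x], and [Ld i l] for its derivative. *)
Record array_rec J (L Ld : nat -> nat -> R -> 'M[R]_n) := ArrayRec {
  array_deriv : forall i l, (i < mu)%N -> mderiv J (L i l) (Ld i l);
  arrayS0 : forall i t, (i < mu)%N -> J t -> L i.+1 0%N t = Ld i 0%N t;
  arraySS : forall i l t, (i < mu)%N -> J t ->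
    L i.+1 l.+1 t = Ld i l.+1 t + L i l t;
  array02 : forall l t, J t -> L 0%N l.+2 t = 0 }.

Lemma array_rec_subset J J' L Ld : J' `<=` J -> array_rec J L Ld ->
  array_rec J' L Ld.
Proof.
move=> JJ [H1 H2 H3 H4]; split.
- by move=> i l im; apply: (mderiv_subset JJ); exact: H1.
- by move=> i t im Jt; apply: H2 => //; exact: JJ.
- by move=> i l t im Jt; apply: H3 => //; exact: JJ.
- by move=> l t Jt; apply: H4 => //; exact: JJ.
Qed.

Variables (L Ld : nat -> nat -> R -> 'M[R]_n).

(* A family [h] stands for the differential operator [sum_i h_i D^i] acting on the
   left of [E D - A]; [asum h l] is the coefficient of [D^l] in the product. *)
Definition asum m (h : nat -> R -> 'M[R]_(m, n)) (l : nat) (t : R) :=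
  \sum_(i < mu.+1) h i t *m L i l t.

Lemma mul_asum p m (C : R -> 'M[R]_(p, m)) (h : nat -> R -> 'M[R]_(m, n)) l t :
  C t *m asum h l t = asum (fun i t => C t *m h i t) l t.
Proof. by rewrite /asum mulmx_sumr; apply: eq_bigr => i _; rewrite mulmxA. Qed.

Lemma eq_asum m (h h' : nat -> R -> 'M[R]_(m, n)) l t :
  (forall i, (i <= mu)%N -> h i t = h' i t) -> asum h l t = asum h' l t.
Proof. by move=> H; apply: eq_bigr => i _; rewrite H// -ltnS. Qed.

Section OnJ.
Variables (a b : R).
Hypothesis ab : a < b.
Local Notation J := (`[a, b]%classic : set R).
Hypothesis HL : array_rec J L Ld.

Lemma mderiv_eq0 m p (F G : R -> 'M[R]_(m, p)) : mderiv J F G ->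
  (forall t, J t -> F t = 0) -> forall t, J t -> G t = 0.
Proof.
move=> FG F0 t Jt; rewrite -(mderiv_deriveI_eq ab FG Jt).
apply: (mderiv_deriveI_eq ab _ Jt).
by apply: (eq_mderiv _ _ (@mderiv_cst _ _ _ _ 0)) => // s Js; rewrite F0.
Qed.

Lemma array_eq0 i l t : (i <= mu)%N -> (i.+1 < l)%N -> J t -> L i l t = 0.
Proof.
elim: i l t => [|i IH] [|[|l]] t //= im il Jt; first exact: array02 HL _ _ Jt.
rewrite (arraySS HL)// IH// ?addr0; last exact: ltnW.
have D : mderiv J (L i l.+2) (Ld i l.+2) by apply: (array_deriv HL).
apply: (mderiv_eq0 D) Jt => s Js.
by apply: IH => //; [exact: ltnW|exact: leq_trans il].
Qed.

(* As operators, [h = D k + g]: if [h (E D - A)] has order 0, then so has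
   [k (E D - A)], and it equals [- g E]. *)
Section Minus.
Variables (m : nat) (h k kd : nat -> R -> 'M[R]_(m, n)) (g : R -> 'M[R]_(m, n)).
Hypothesis dk : forall i, mderiv J (k i) (kd i).
Hypothesis k0 : forall i t, (mu <= i)%N -> J t -> k i t = 0.
Hypothesis h0E : forall t, J t -> h 0%N t = g t + kd 0%N t.
Hypothesis hSE : forall i t, (i < mu)%N -> J t -> h i.+1 t = k i t + kd i.+1 t.
Hypothesis annh : forall l t, J t -> asum h l.+1 t = 0.

Let asumkE l t : J t -> asum k l t = \sum_(i < mu) k i t *m L i l t.
Proof. by move=> Jt; rewrite /asum big_ord_recr /= k0// mul0mx addr0. Qed.

Let dasum l t := \sum_(i < mu) (kd i t *m L i l t + k i t *m Ld i l t).

Let mderiv_asum l : mderiv J (asum k l) (dasum l).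
Proof.
apply: (eq_mderiv (F := fun t => \sum_(i < mu) k i t *m L i l t)
  (G := dasum l)) => // [t Jt|]; first by rewrite asumkE.
apply: mderiv_sum => i _; apply: mderivM; first exact: dk.
exact: array_deriv.
Qed.

(** Leibniz rule: in [D k (E D - A)] the coefficient of [D^l] is the derivative of the one in
    [k (E D - A)], here [dasum], plus the preceding one. *)
Let asumhE l t : J t -> asum h l t =
  g t *m L 0%N l t + dasum l t + (if l is l'.+1 then asum k l' t else 0).
Proof.
move=> Jt; have kdmu : kd mu t = 0.
  by apply: (mderiv_eq0 (@dk mu)) Jt => s Js; exact: k0.
rewrite /asum big_ord_recl /= h0E// mulmxDl -!addrA; congr (_ + _).
under eq_bigr => i _ do rewrite /= hSE ?mulmxDl//.
rewrite big_split /= addrCA.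
have -> : kd 0%N t *m L 0%N l t + \sum_(i < mu) kd (bump 0 i) t *m L (bump 0 i) l t
    = \sum_(i < mu) kd i t *m L i l t.
  have := big_ord_recl mu (fun i : 'I_mu.+1 => kd i t *m L i l t) => /= E.
  by rewrite -[LHS]E big_ord_recr /= kdmu mul0mx addr0.
rewrite addrC /dasum big_split /= -addrA; congr (_ + _).
case: l => [|l]; last rewrite -/(asum k l t) asumkE// -big_split /=.
  by rewrite addr0; apply: eq_bigr => i _; rewrite (arrayS0 HL).
by apply: eq_bigr => i _; rewrite (arraySS HL)// mulmxDr.
Qed.

(** If the coefficients of [k (E D - A)] vanish from order [l + 2] on, comparing those of [D^(l+2)]
    kills the one of order [l + 1], since [g (E D - A)] stops at order 1. The downward induction
    starts from the order bound [array_eq0]. *)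
Lemma minus_annih l t : J t -> asum k l.+1 t = 0.
Proof.
have H j : forall l, (mu.+1 <= l + j)%N -> forall t, J t -> asum k l.+1 t = 0.
  elim: j => [|j IH] {}l lj {}t Jt.
    rewrite /asum big1// => i _; rewrite array_eq0 ?mulmx0//; first by rewrite -ltnS.
    by rewrite ltnS; apply: leq_trans (ltn_ord i) _; rewrite -(addn0 l).
  have {}IH := IH l.+1; rewrite addSnnS in IH.
  have := @annh l.+1 t Jt; rewrite asumhE// (array02 HL)// mulmx0 add0r.
  by rewrite (mderiv_eq0 (@mderiv_asum l.+2)) ?add0r//; exact: IH.
by apply: (H mu.+1); rewrite leq_addl.
Qed.

Lemma minus_asum0 t : J t -> asum k 0 t = - (g t *m L 0%N 1%N t).
Proof.
move=> Jt; have := @annh 0%N t Jt; rewrite asumhE//.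
rewrite (mderiv_eq0 (@mderiv_asum 1%N)) ?addr0//; last by move=> ? ?; exact: minus_annih.
by rewrite addrC => /eqP; rewrite addr_eq0 => /eqP.
Qed.

End Minus.

(** Left division of [h] by [D], solved from the top: [k_i = h_(i+1) - k_(i+1)'] with [k_mu = 0].
    Each coefficient costs one derivative, [mu] in all. *)
Lemma ex_minus m (h : nat -> R -> 'M[R]_(m, n)) q j :
  (j <= mu)%N -> (forall i, msmooth J (q.+1 + mu) (h i)) ->
  (forall i t, (j < i)%N -> J t -> h i t = 0) ->
  exists k kd, [/\ forall i, msmooth J q.+1 (k i),
    forall i, mderiv J (k i) (kd i),
    forall i t, J t -> h i.+1 t = k i t + kd i.+1 t &
    forall i t, (j <= i)%N -> J t -> k i t = 0].
Proof.
move=> jmu sh h0.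
pose kk := fix kk (i : nat) : R -> 'M[R]_(m, n) :=
  if i is i'.+1 then fun t => h (mu - i')%N t - deriveI J (kk i') t else fun=> 0.
pose k i := kk (mu - i)%N.
have skk i : (i <= mu)%N -> msmooth J (q.+1 + mu - i) (kk i).
  elim: i => [|i IH] im; first exact: msmooth_cst.
  apply: msmoothB; first by apply: msmooth_le (sh _); rewrite leq_subr.
  apply: msmooth_deriveI => //; have := IH (ltnW im).
  by rewrite -subSn ?subSS// (leq_trans im)// leq_addl.
have sk i : msmooth J q.+1 (k i).
  apply: msmooth_le (skk _ (leq_subr _ _)).
  by rewrite -addnBA ?leq_subr// leq_addr.
exists k, (fun i => deriveI J (k i)); split=> //.
- by move=> i; apply: (mderiv_deriveI ab (sk i)).
- move=> i t Jt; have [imu|mui] := ltnP i mu.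
    rewrite /k -(subnSK imu) /= subKn// subrK//.
  rewrite h0//; last by rewrite (leq_ltn_trans jmu).
  have Z l : (mu <= l)%N -> k l = fun=> 0.
    by rewrite /k => /eqP ->.
  rewrite !Z//; last exact: leqW.
  by rewrite (mderiv_deriveI_eq ab (@mderiv_cst _ _ _ _ 0))// addr0.
- move=> i t ji; rewrite /k.
  have : (mu - i <= mu - j)%N by exact: leq_sub2l.
  elim: (mu - i)%N t => [//|l IH] t lj Jt /=.
  rewrite h0//; last by rewrite ltn_subRL addnC -ltn_subRL.
  rewrite (mderiv_deriveI_eq ab (G := fun=> 0) _ Jt) ?subrr//.
  apply: (eq_mderiv _ _ (@mderiv_cst _ _ _ _ 0)) => // s Js.
  by rewrite IH// ltnW.
Qed.

End OnJ.

End LocalArray.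

(** * Families of operators adapted to left division by [D] *)

Section AdaptedFamily.
Context {R : realType}.
Variables (n mu : nat) (L Ld : nat -> nat -> R -> 'M[R]_n).

(** The pointwise form of the implication from [h (E D - A) = 0] to [h = 0]. In the application it
    expresses the full row rank of [A2]. *)
Definition order0_inj (J : set R) := forall t (h : nat -> 'rV[R]_n), J t ->
  (forall l, \sum_(i < mu.+1) h i *m L i l.+1 t = 0) ->
  \sum_(i < mu.+1) h i *m L i 0%N t = 0 -> forall i, (i < mu.+1)%N -> h i = 0.

Lemma asum0_row_free J m (Z : nat -> R -> 'M[R]_(m, n)) t : order0_inj J ->
  J t -> (forall l, asum mu L Z l.+1 t = 0) -> row_free (pack mu.+1 (Z^~ t)) ->
  row_free (asum mu L Z 0 t).
Proof.
move=> inj Jt annZ fZ; apply: inj_row_free => c.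
have E l : c *m asum mu L Z l t = \sum_(i < mu.+1) (c *m Z i t) *m L i l t.
  by rewrite mulmx_sumr; apply: eq_bigr => i _; rewrite mulmxA.
rewrite E => c0; apply: (row_free_mul0 fZ); rewrite mul_pack -(pack0 mu.+1 1 n).
by apply/eq_packP; apply: (inj t) => // l; rewrite -E annZ mulmx0.
Qed.

(* As operators, [Z = D u Z + g], and [Z (E D - A)] has order 0. *)
Record adapted (J : set R) m (Z : nat -> R -> 'M[R]_(m, n)) (u : R -> 'M[R]_m)
    (g : R -> 'M[R]_(m, n)) (W : nat -> R -> 'M[R]_(m, n)) := Adapted {
  ad_smooth : forall i, msmooth J 2 (Z i);
  ad_smoothu : msmooth J 2 u;
  ad_smoothg : msmooth J 1 g;
  ad_vanish : forall i t, J t -> (mu < i)%N -> Z i t = 0;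
  ad_annih : forall l t, J t -> asum mu L Z l.+1 t = 0;
  ad_free : forall t, J t -> row_free (pack mu.+1 (Z^~ t));
  ad_uvanish : forall i t, J t -> (mu <= i)%N -> u t *m Z i t = 0;
  ad_deriv : forall i, mderiv J (fun t => u t *m Z i t) (W i);
  ad_rel0 : forall t, J t -> Z 0%N t = g t + W 0%N t;
  ad_relS : forall i t, J t -> Z i.+1 t = u t *m Z i t + W i.+1 t;
  ad_gfree : forall t, J t -> row_free (g t) }.

Arguments ad_smooth {J m Z u g W} _ i.
Arguments ad_vanish {J m Z u g W} _ i t.
Arguments ad_annih {J m Z u g W} _ l t.
Arguments ad_free {J m Z u g W} _ t.
Arguments ad_uvanish {J m Z u g W} _ i t.
Arguments ad_deriv {J m Z u g W} _ i.
Arguments ad_rel0 {J m Z u g W} _ t.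
Arguments ad_relS {J m Z u g W} _ i t.
Arguments ad_gfree {J m Z u g W} _ t.

Lemma adapted_subset (J J' : set R) m (Z : nat -> R -> 'M[R]_(m, n)) u g W :
  J' `<=` J -> adapted J Z u g W -> adapted J' Z u g W.
Proof.
move=> JJ [H1 H2 H3 H4 H5 H6 H7 H8 H9 H10 H11]; split.
- by move=> i; apply: (msmooth_subset JJ).
- exact: (msmooth_subset JJ).
- exact: (msmooth_subset JJ).
- by move=> i t /JJ; exact: H4.
- by move=> l t /JJ; exact: H5.
- by move=> t /JJ; exact: H6.
- by move=> i t /JJ; exact: H7.
- by move=> i; apply: (mderiv_subset JJ).
- by move=> t /JJ; exact: H9.
- by move=> i t /JJ; exact: H10.
- by move=> t /JJ; exact: H11.
Qed.

Lemma adapted0 (J : set R) : adapted J (fun _ _ => 0 : 'M[R]_(0, n)) (fun=> 0)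
  (fun=> 0) (fun _ _ => 0).
Proof.
have fl k (X : 'M[R]_(0, k)) : row_free X by rewrite /row_free -leqn0 rank_leq_row.
split=> *; rewrite ?mulmx0 ?addr0 ?fl//; try exact: msmooth_cst.
  by rewrite /asum big1// => i _; rewrite mul0mx.
by apply: (eq_mderiv _ _ (@mderiv_cst _ _ _ _ 0)) => t _; rewrite ?mulmx0.
Qed.

Notation itv a b := (`[a, b]%classic : set R).

Lemma itv_left (a b : R) : a < b -> itv a b a.
Proof. by move=> ab; rewrite /= in_itv /= lexx ltW. Qed.

Lemma near_extend (a b t : R) p m (F : R -> 'M[R]_(m, p)) (x : R -> 'rV[R]_p) :
  a < b -> itv a b t -> msmooth (itv a b) 0 F -> msmooth (itv a b) 0 x ->
  row_free (F t) -> ~~ (x t <= F t)%MS ->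
  exists a' b', [/\ a' < b', itv a' b' `<=` itv a b &
    forall s, itv a' b' s -> row_free (col_mx (F s) (x s))].
Proof.
move=> ab Jt sF sx fF nx.
apply: (near_row_free ab Jt (msmooth_col_mx sF sx)).
exact: row_free_extend.
Qed.

(* Replace [eta] by [eta^-], where [eta = D eta^- + g], as long as [eta^-] leaves
   the span of [Z] somewhere: the order drops each time. *)
Lemma descent (a b : R) m (Z : nat -> R -> 'M[R]_(m, n)) j
    (eta : nat -> R -> 'rV[R]_n) :
  a < b -> array_rec mu (itv a b) L Ld -> (j <= mu.+1)%N ->
  (forall i, msmooth (itv a b) 0 (Z i)) ->
  (forall i, msmooth (itv a b) (2 + mu + j * mu) (eta i)) ->
  (forall i t, (j <= i)%N -> itv a b t -> eta i t = 0) ->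
  (forall l t, itv a b t -> asum mu L eta l.+1 t = 0) ->
  (forall t, itv a b t -> row_free (pack mu.+1 (Z^~ t))) ->
  (forall t, itv a b t -> ~~ (pack mu.+1 (eta^~ t) <= pack mu.+1 (Z^~ t))%MS) ->
  exists a' b' (zeta k kd : nat -> R -> 'rV[R]_n), [/\ a' < b', itv a' b' `<=` itv a b,
    (forall i, msmooth (itv a' b') 2 (zeta i)) /\
    (forall i t, (mu < i)%N -> itv a' b' t -> zeta i t = 0),
    (forall l t, itv a' b' t -> asum mu L zeta l.+1 t = 0) /\
    (forall t, itv a' b' t ->
      ~~ (pack mu.+1 (zeta^~ t) <= pack mu.+1 (Z^~ t))%MS) &
    [/\ forall i, msmooth (itv a' b') 2 (k i),
     forall i, mderiv (itv a' b') (k i) (kd i),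
     forall i t, itv a' b' t -> zeta i.+1 t = k i t + kd i.+1 t,
     forall i t, (mu <= i)%N -> itv a' b' t -> k i t = 0 &
     forall t, itv a' b' t -> (pack mu.+1 (k^~ t) <= pack mu.+1 (Z^~ t))%MS]].
Proof.
elim: j a b eta => [|j IH] a b eta ab HL jmu sZ seta eta0 ann fZ nZ.
  (* With order bound 0 the family vanishes and lies in every span: the descent must have stopped
     earlier. *)
  have /negP[] := nZ a (itv_left ab); apply/pack_subP; exists 0 => i _.
  by rewrite mul0mx eta0//; exact: itv_left.
(* Each division consumes [mu] derivatives, which the term [j * mu] pays for; the last one still
   leaves class [C^2]. *)
have [|k [kd [sk dk etaE k0]]] :=
  @ex_minus _ _ mu _ _ ab _ eta (1 + mu + j * mu)%N j jmu _ eta0.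
  by move=> i; rewrite (_ : (_ + mu = 2 + mu + j.+1 * mu)%N)//; rewrite mulSn; lia.
have kmu i t : (mu <= i)%N -> itv a b t -> k i t = 0.
  by move=> mi; apply: k0; apply: leq_trans mi.
have [|/contrapT kZ] := pselect (~ forall t, itv a b t ->
    (pack mu.+1 (k^~ t) <= pack mu.+1 (Z^~ t))%MS); last first.
  exists a, b, eta, k, kd; split=> //.
    split=> [i|i t mi Jt]; last by apply: eta0 => //; apply: leq_trans jmu _.
    by apply: msmooth_le (seta i); lia.
  by split=> // i; apply: msmooth_le (sk i); lia.
move=> /existsNP[t] /not_implyP[Jt /negP nk].
have sP : msmooth (itv a b) 0 (fun t => pack mu.+1 (Z^~ t)) by apply: msmooth_pack.
have sQ : msmooth (itv a b) 0 (fun t => pack mu.+1 (k^~ t)).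
  by apply: msmooth_pack => i _; apply: msmooth_le (sk i).
have [a' [b' [ab' sub fk]]] := near_extend ab Jt sP sQ (fZ t Jt) nk.
have annk := minus_annih ab HL dk kmu (g := fun t => eta 0%N t - kd 0%N t) _ _ ann.
have {}annk l s : itv a b s -> asum mu L k l.+1 s = 0.
  by apply: annk => [r _|i r _ Jr]; [rewrite subrK|exact: etaE].
have [||||||||a'' [b'' [zeta [k' [kd' [H1 H2 H3 H4 H5]]]]]] := IH a' b' k ab'.
- exact: (array_rec_subset sub HL).
- exact: ltnW.
- by move=> i; apply: (msmooth_subset sub).
- by move=> i; apply: (msmooth_subset sub); exact: sk.
- by move=> i s ji /sub; exact: k0.
- by move=> l s /sub; exact: annk.
- by move=> s /fk/row_free_colP[].
- by move=> s /fk/row_free_colP[].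
by exists a'', b'', zeta, k', kd'; split=> //; exact: (subset_trans H2 sub).
Qed.

(** A row of [BB] outside the span of [Z] is lowered by [descent] to some [zeta = D e Z + gn]. It
    joins [Z] with the new row [(e, 0)] in [u], since its quotient involves only the old operators;
    what has to be shown is that [gn] leaves the span of [g] somewhere. *)
Lemma adapted_step (a b : R) m (Z : nat -> R -> 'M[R]_(m, n)) u g W q
    (BB : nat -> R -> 'M[R]_(q, n)) :
  a < b -> array_rec mu (itv a b) L Ld -> order0_inj (itv a b) ->
  adapted (itv a b) Z u g W -> (m < q)%N ->
  (forall i, msmooth (itv a b) (2 + mu + mu.+1 * mu) (BB i)) ->
  (forall i t, (mu < i)%N -> itv a b t -> BB i t = 0) ->
  (forall l t, itv a b t -> asum mu L BB l.+1 t = 0) ->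
  (forall t, itv a b t -> row_free (pack mu.+1 (BB^~ t))) ->
  exists a' b' (Z1 : nat -> R -> 'M[R]_(m + 1, n)) u1 g1 W1,
    [/\ a' < b', itv a' b' `<=` itv a b & adapted (itv a' b') Z1 u1 g1 W1].
Proof.
move=> ab HL inj ad mq sB B0 annB fB.
have Ja := itv_left ab.
have [i0 ni0] : exists i0, ~~ (pack mu.+1 (fun i => row i0 (BB i a)) <=
    pack mu.+1 (Z^~ a))%MS.
  apply/existsP; rewrite -negb_forall; apply/negP => /forallP H.
  have : (pack mu.+1 (BB^~ a) <= pack mu.+1 (Z^~ a))%MS.
    apply/row_subP => i; have := H i; congr (_ <= _)%MS.
    rewrite rowE mul_pack; apply/eq_packP => l _.
    by rewrite -rowE.
  move=> /mxrankS; rewrite (eqP (ad_free ad a Ja)) (eqP (fB a Ja)).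
  by rewrite leqNgt mq.
pose eta0 i t := row i0 (BB i t).
have rowM t l : asum mu L eta0 l t = row i0 (asum mu L BB l t).
  rewrite /asum linear_sum /=; apply: eq_bigr => i _.
  by rewrite row_mul.
have seta k J i : msmooth J k (BB i) -> msmooth J k (eta0 i).
  move=> H i' j'; apply: (eq_smooth _ (H i0 j')) => t _.
  by rewrite mxE.
have sP : msmooth (itv a b) 0 (fun t => pack mu.+1 (Z^~ t)).
  by apply: msmooth_pack => i _; apply: msmooth_le (ad_smooth ad i).
have sQ : msmooth (itv a b) 0 (fun t => pack mu.+1 (eta0^~ t)).
  by apply: msmooth_pack => i _; apply: seta; apply: msmooth_le (sB i).
have [a1 [b1 [ab1 sub1 f1]]] := near_extend ab Ja sP sQ (ad_free ad a Ja) ni0.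
have HL1 := array_rec_subset sub1 HL.
have [||||||a2 [b2 [zeta [k [kd [ab2 sub2 [szeta zeta0] [annz nz]
    [sk dk zetaE k0 kZ]]]]]]] :=
  @descent a1 b1 _ Z mu.+1 eta0 ab1 HL1 (leqnn _).
- by move=> i; apply: (msmooth_subset sub1); apply: msmooth_le (ad_smooth ad i).
- by move=> i; apply: seta; apply: (msmooth_subset sub1); exact: sB.
- by move=> i t mi /sub1 Jt; rewrite /eta0 B0// row0.
- by move=> l t /sub1 Jt; rewrite rowM annB// row0.
- by move=> t /f1/row_free_colP[].
- by move=> t /f1/row_free_colP[].
have sub := subset_trans sub2 sub1.
have HL2 := array_rec_subset sub HL.
have {}ad := adapted_subset sub ad.
have {}inj : order0_inj (itv a2 b2) by move=> t h /sub; exact: inj.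
pose e t := rcoef (pack mu.+1 (k^~ t)) (pack mu.+1 (Z^~ t)).
have se : msmooth (itv a2 b2) 2 e.
  apply: msmooth_rcoef; first exact: (ad_free ad).
    by apply: msmooth_pack => i _; exact: sk.
  by apply: msmooth_pack => i _; exact: (ad_smooth ad i).
have kE i t : itv a2 b2 t -> k i t = e t *m Z i t.
  move=> Jt; have [im|mi] := ltnP i mu.+1; last first.
    by rewrite (ad_vanish ad)// mulmx0 k0// ltnW.
  have := rcoef_sub (ad_free ad t Jt) (kZ t Jt); rewrite -/(e t) mul_pack.
  by move=> /eq_packP/(_ i im) ->.
pose gn t := zeta 0%N t - kd 0%N t.
have skd i : msmooth (itv a2 b2) 1 (kd i).
  have := msmooth_deriveI ab2 (sk i); apply: eq_msmooth => t Jt.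
  by rewrite (mderiv_deriveI_eq ab2 (dk i)).
have sgn : msmooth (itv a2 b2) 1 gn.
  by apply: msmoothB => //; exact: msmooth_le (szeta 0%N).
have [|/contrapT gng] := pselect (~ forall t, itv a2 b2 t -> (gn t <= g t)%MS).
  move=> /existsNP[t] /not_implyP[Jt /negP ng].
  have [a3 [b3 [ab3 sub3 f3]]] := near_extend ab2 Jt
    (msmooth_le (leq0n _) (ad_smoothg ad)) (msmooth_le (leq0n _) sgn) (ad_gfree ad t Jt) ng.
  have ad3 := adapted_subset sub3 ad.
  pose Z1 i t := col_mx (Z i t) (zeta i t).
  pose u1 t := block_mx (u t) 0 (e t) 0 : 'M[R]_(m + 1).
  exists a3, b3, Z1, u1, (fun t => col_mx (g t) (gn t)),
    (fun i t => col_mx (W i t) (kd i t)).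
  have uZ i s : itv a3 b3 s -> u1 s *m Z1 i s = col_mx (u s *m Z i s) (k i s).
    by move=> /sub3 Js; rewrite mul_block_col !mul0mx !addr0 -kE.
  split=> //; first exact: (subset_trans sub3 sub).
  split.
  - move=> i; apply: msmooth_col_mx; first exact: (ad_smooth ad3 i).
    exact: msmooth_subset sub3 (szeta i).
  - apply: msmooth_col_mx; apply: msmooth_row_mx.
    + exact: (ad_smoothu ad3).
    + exact: msmooth_cst.
    + exact: (msmooth_subset sub3 se).
    + exact: msmooth_cst.
  - apply: msmooth_col_mx; first exact: (ad_smoothg ad3).
    exact: (msmooth_subset sub3 sgn).
  - move=> i s Js mi; rewrite /Z1 (ad_vanish ad3)// zeta0 ?col_mx0//.
    exact: sub3.
  - move=> l s Js.
    have -> : asum mu L Z1 l.+1 s = col_mx (asum mu L Z l.+1 s) (asum mu L zeta l.+1 s).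
      rewrite /asum; elim/big_ind3 : _ => [|x y z x' y' z' -> ->|i _].
      - by rewrite col_mx0.
      - by rewrite add_col_mx.
      - by rewrite mul_col_mx.
    by rewrite (ad_annih ad3)// annz ?col_mx0//; exact: sub3.
  - move=> s Js; rewrite -col_pack; apply: row_free_extend; first exact: (ad_free ad3 s Js).
    by apply: nz; exact: sub3.
  - by move=> i s Js mi; rewrite uZ// (ad_uvanish ad3)// k0 ?col_mx0//; exact: sub3.
  - move=> i; apply: (eq_mderiv (F := fun s => col_mx (u s *m Z i s) (k i s))
      (G := fun t => col_mx (W i t) (kd i t))) => // [s Js|]; first by rewrite uZ.
    move=> i' j'; case: (split_ordP i') => l ->.
      by apply: (eq_has_deriv _ _ (ad_deriv ad3 i l j')) => s _; rewrite col_mxEu.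
    have D : mderiv (itv a3 b3) _ _ := mderiv_subset sub3 (dk i).
    by apply: (eq_has_deriv _ _ (D l j')) => s _; rewrite col_mxEd.
  - by move=> s Js; rewrite /Z1 (ad_rel0 ad3)// add_col_mx /gn subrK.
  - move=> i s Js; rewrite uZ// /Z1 (ad_relS ad3)// add_col_mx zetaE//.
    exact: sub3.
  - by move=> s Js; exact: f3.
have HuW : forall t, itv a2 b2 t ->
    asum mu L (fun i t => u t *m Z i t) 0 t = - (g t *m L 0%N 1%N t).
  apply: (minus_asum0 ab2 HL2 (ad_deriv ad) _ (ad_rel0 ad)).
  - by move=> i t mi Jt; exact: (ad_uvanish ad _ _ Jt mi).
  - by move=> i t _ Jt; exact: (ad_relS ad _ _ Jt).
  - exact: (ad_annih ad).
have HkW : forall t, itv a2 b2 t -> asum mu L k 0 t = - (gn t *m L 0%N 1%N t).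
  apply: (minus_asum0 ab2 HL2 dk k0 (h := zeta)) => //.
  - by move=> t _; rewrite subrK.
  - by move=> i t _ Jt; exact: zetaE.
(* If the new [g]-row [gn] were [x g] everywhere, then [e = x u] by injectivity of
   the order-0 part, whence [zeta - x Z = x' u Z], against independence. *)
pose x t := rcoef (gn t) (g t).
have sx : msmooth (itv a2 b2) 1 x.
  by apply: msmooth_rcoef => //; [exact: (ad_gfree ad)|exact: (ad_smoothg ad)].
have xg t : itv a2 b2 t -> gn t = x t *m g t.
  by move=> Jt; rewrite rcoef_sub// ?gng//; exact: (ad_gfree ad t Jt).
have ex t : itv a2 b2 t -> e t = x t *m u t.
  move=> Jt; apply/eqP; rewrite -subr_eq0; apply/eqP.
  have fa := asum0_row_free inj Jt (fun l => ad_annih ad l t Jt) (ad_free ad t Jt).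
  apply: (row_free_mul0 fa); rewrite mulmxBl -(mulmxA (x t)).
  have E : asum mu L (fun i t => e t *m Z i t) 0 t = asum mu L k 0 t.
    by apply: eq_asum => i _; rewrite kE.
  rewrite (mul_asum _ _ u) (mul_asum _ _ e) HuW// E.
  by rewrite HkW// xg// mulmxN mulmxA subrr.
have dx := mderiv_deriveI ab2 sx.
have kdE i t : itv a2 b2 t -> kd i t =
    deriveI (itv a2 b2) x t *m (u t *m Z i t) + x t *m W i t.
  move=> Jt; rewrite -(mderiv_deriveI_eq ab2 (dk i) Jt).
  have D : mderiv (itv a2 b2) (k i) (fun t =>
      deriveI (itv a2 b2) x t *m (u t *m Z i t) + x t *m W i t).
    apply: (eq_mderiv _ _ (mderivM dx (ad_deriv ad i))) => // s Js.
    by rewrite mulmxA -ex// -kE.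
  exact: (mderiv_deriveI_eq ab2 D Jt).
have Ja2 := itv_left ab2.
have /negP[] := nz a2 Ja2; apply/pack_subP.
exists (x a2 + deriveI (itv a2 b2) x a2 *m u a2) => -[|i] _;
  rewrite mulmxDl -(mulmxA (deriveI (itv a2 b2) x a2)).
  have -> : x a2 *m Z 0%N a2 = x a2 *m g a2 + x a2 *m W 0%N a2.
    by rewrite (ad_rel0 ad a2 Ja2) mulmxDr.
  rewrite -[LHS](subrK (kd 0%N a2)) -/(gn a2) xg// kdE//.
  by rewrite [X in _ + X]addrC addrA.
have -> : x a2 *m Z i.+1 a2 = e a2 *m Z i a2 + x a2 *m W i.+1 a2.
  by rewrite (ad_relS ad _ a2 Ja2) mulmxDr ex// mulmxA.
by rewrite zetaE// kE// kdE// [X in _ + X]addrC addrA.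
Qed.

End AdaptedFamily.

Arguments ad_smooth {R n mu L J m Z u g W} _ i.
Arguments ad_vanish {R n mu L J m Z u g W} _ i t.
Arguments ad_annih {R n mu L J m Z u g W} _ l t.
Arguments ad_free {R n mu L J m Z u g W} _ t.
Arguments ad_uvanish {R n mu L J m Z u g W} _ i t.
Arguments ad_deriv {R n mu L J m Z u g W} _ i.
Arguments ad_rel0 {R n mu L J m Z u g W} _ t.
Arguments ad_relS {R n mu L J m Z u g W} _ i t.
Arguments ad_gfree {R n mu L J m Z u g W} _ t.


(** * Full adapted families and the left kernel of [E K] *)

Section KeyFactLocal.
Context {R : realType}.
Variables (n mu q : nat) (L Ld : nat -> nat -> R -> 'M[R]_n).
Notation itv a b := (`[a, b]%classic : set R).

Lemma ex_adapted (a b : R) (BB : nat -> R -> 'M[R]_(q, n)) :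
  a < b -> array_rec mu (itv a b) L Ld -> order0_inj mu L (itv a b) ->
  (forall i, msmooth (itv a b) (2 + mu + mu.+1 * mu) (BB i)) ->
  (forall i t, (mu < i)%N -> itv a b t -> BB i t = 0) ->
  (forall l t, itv a b t -> asum mu L BB l.+1 t = 0) ->
  (forall t, itv a b t -> row_free (pack mu.+1 (BB^~ t))) ->
  forall m, (m <= q)%N ->
  exists a' b' (Z : nat -> R -> 'M[R]_(m, n)) u g W,
    [/\ a' < b', itv a' b' `<=` itv a b & adapted mu L (itv a' b') Z u g W].
Proof.
move=> ab HL inj sB B0 annB fB; elim=> [|m IH] mq.
  exists a, b, (fun _ _ => 0), (fun=> 0), (fun=> 0), (fun _ _ => 0).
  by split=> //; exact: adapted0.
have [a1 [b1 [Z [u [g [W [ab1 sub1 ad]]]]]]] := IH (ltnW mq).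
have inj1 : order0_inj mu L (itv a1 b1) by move=> t h /sub1; exact: inj.
have [a2 [b2 [Z' [u' [g' [W' [ab2 sub2 ad']]]]]]] :=
  adapted_step ab1 (array_rec_subset sub1 HL) inj1 ad mq
    (fun i => msmooth_subset sub1 (sB i))
    (fun i t mi Jt => B0 i t mi (sub1 t Jt))
    (fun l t Jt => annB l t (sub1 t Jt)) (fun t Jt => fB t (sub1 t Jt)).
rewrite -addn1; exists a2, b2, Z', u', g', W'; split=> //.
exact: (subset_trans sub2 sub1).
Qed.

(* Dimension count: the rows of [g] in a full adapted family span the left kernel
   of [E K], and [g + u D Z = Z - u' Z]. *)
Lemma kernel_coef (a b : R) (BB Z Zd : nat -> R -> 'M[R]_(q, n)) d
    (K : R -> 'M[R]_(n, d)) :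
  a < b -> array_rec mu (itv a b) L Ld ->
  (forall i, msmooth (itv a b) (2 + mu + mu.+1 * mu) (BB i)) ->
  (forall i t, (mu < i)%N -> itv a b t -> BB i t = 0) ->
  (forall l t, itv a b t -> asum mu L BB l.+1 t = 0) ->
  (forall t, itv a b t -> row_free (pack mu.+1 (BB^~ t))) ->
  (forall i, msmooth (itv a b) 1 (Z i)) ->
  (forall i, mderiv (itv a b) (Z i) (Zd i)) ->
  (forall i t, (mu < i)%N -> itv a b t -> Z i t = 0) ->
  (forall t, itv a b t -> row_free (pack mu.+1 (Z^~ t))) ->
  (forall t, itv a b t -> row_free (asum mu L Z 0 t)) ->
  (forall t m (h : nat -> 'M[R]_(m, n)), itv a b t ->
    (forall l, \sum_(i < mu.+1) h i *m L i l.+1 t = 0) ->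
    (pack mu.+1 h <= pack mu.+1 (Z^~ t))%MS) ->
  (forall t, itv a b t -> asum mu L Z 0 t *m K t = 0) ->
  (q <= n)%N ->
  (forall t, itv a b t -> \rank (L 0%N 1%N t *m K t) = (n - q)%N) ->
  exists2 t, itv a b t & forall m (P : 'M[R]_(m, n)),
    P *m L 0%N 1%N t *m K t = 0 ->
    exists v c, [/\ v *m asum mu L Z 0 t = - (P *m L 0%N 1%N t),
      P + v *m Zd 0%N t = c *m Z 0%N t &
      forall i, v *m Zd i.+1 t + v *m Z i t = c *m Z i.+1 t].
Proof.
move=> ab HL sB B0 annB fB sZ dZ Z0 fZ fa cpl aK qn rkEK.
have inj : order0_inj mu L (itv a b).
  move=> t h Jt /(cpl _ _ _ Jt) /pack_subP[c hc] h0 i im; rewrite hc//.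
  suff -> : c = 0 by rewrite mul0mx.
  apply: (row_free_mul0 (fa t Jt)); rewrite mulmx_sumr -[RHS]h0.
  by apply: eq_bigr => j _; rewrite mulmxA hc.
have [a' [b' [Y [u [g [W [ab' sub ad]]]]]]] :=
  ex_adapted ab HL inj sB B0 annB fB (leqnn q).
have HL' := array_rec_subset sub HL.
have Jt := itv_left ab'; set t := a' in Jt *.
pose C t := rcoef (pack mu.+1 (Y^~ t)) (pack mu.+1 (Z^~ t)).
have sC : msmooth (itv a' b') 1 C.
  apply: msmooth_rcoef; first by move=> s /sub; exact: fZ.
    by apply: msmooth_pack => i _; apply: msmooth_le (ad_smooth ad i).
  by apply: msmooth_pack => i _; apply: (msmooth_subset sub).
have YE i s : itv a' b' s -> Y i s = C s *m Z i s.
  move=> Js; have [im|mi] := ltnP i mu.+1; last first.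
    by rewrite (ad_vanish ad)// Z0// ?mulmx0//; exact: sub.
  have := rcoef_sub (fZ s (sub s Js)) (cpl s _ (Y^~ s) (sub s Js)
    (fun l => ad_annih ad l s Js)); rewrite -/(C s) mul_pack.
  by move=> /eq_packP/(_ i im) ->.
pose uC s := u s *m C s.
have duC : mderiv (itv a' b') uC (deriveI (itv a' b') uC).
  apply: (@mderiv_deriveI _ _ _ ab' 0); apply: msmoothM => //.
  exact: (msmooth_le _ (ad_smoothu ad)).
set D := deriveI _ uC in duC.
have WE i : W i t = D t *m Z i t + uC t *m Zd i t.
  have dW := ad_deriv ad i.
  rewrite -(mderiv_deriveI_eq ab' dW Jt).
  have dW' : mderiv (itv a' b') (fun s => u s *m Y i s)
      (fun s => D s *m Z i s + uC s *m Zd i s).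
    apply: (eq_mderiv _ _ (mderivM duC (mderiv_subset sub (dZ i)))) => // s Js.
    by rewrite YE// mulmxA.
  exact: (mderiv_deriveI_eq ab' dW' Jt).
have aY l : asum mu L Y l t = C t *m asum mu L Z l t.
  by rewrite (mul_asum _ _ C); apply: eq_asum => i _; rewrite YE.
have gE : g t *m L 0%N 1%N t = - (uC t *m asum mu L Z 0 t).
  have : asum mu L (fun i s => u s *m Y i s) 0 t = - (g t *m L 0%N 1%N t).
    apply: (minus_asum0 ab' HL' (ad_deriv ad) _ (ad_rel0 ad)) => //.
    - by move=> i s mi Js; exact: (ad_uvanish ad).
    - by move=> i s _ Js; exact: (ad_relS ad).
    - exact: (ad_annih ad).
  by rewrite -(mul_asum _ _ u) aY mulmxA => ->; rewrite opprK.
have Jt' := sub t Jt.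
exists t => // m P PEK.
have gker : (g t <= kermx (L 0%N 1%N t *m K t))%MS.
  by apply/sub_kermxP; rewrite mulmxA gE mulNmx -mulmxA aK// mulmx0 oppr0.
have kerg : (kermx (L 0%N 1%N t *m K t) <= g t)%MS.
  rewrite -(geq_leqif (mxrank_leqif_sup gker)) mxrank_ker rkEK// subKn//.
  by rewrite (eqP (ad_gfree ad t Jt)).
have /submxP[k Pk] : (P <= g t)%MS.
  by apply: submx_trans kerg; apply/sub_kermxP; rewrite mulmxA.
(* Read off from [k g = k (Y - D u Y)] with [Y = C Z]: the Leibniz rule splits the derivative of
   [u C Z] into [(u C)' Z + u C Z'], where the local [D] is [(u C)']. *)
exists (k *m uC t), (k *m (C t - D t)); split.
- by rewrite Pk -mulmxA -[k *m g t *m _]mulmxA gE mulmxN opprK.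
- have -> : P = k *m (Y 0%N t - W 0%N t) by rewrite Pk (ad_rel0 ad)// addrK.
  rewrite YE// WE -(mulmxA k (uC t)) -(mulmxA k (C t - D t)) -mulmxDr mulmxBl.
  congr (_ *m _).
  by rewrite opprD -!addrA addNr addr0.
- move=> i; rewrite -!(mulmxA k (uC t)) -(mulmxA k (C t - D t)) -mulmxDr mulmxBl.
  congr (_ *m _).
  rewrite -YE// (ad_relS ad)// WE YE// mulmxA -/(uC t).
  by rewrite [D t *m _ + _]addrC addrA addrK addrC.
Qed.

End KeyFactLocal.

(** * The derivative array as the coefficients of iterated derivatives *)

Section DerivativeArray.
Context {R : realType}.
Variables (n : nat) (tl tr : R) (E A : R -> 'M[R]_n).
Hypothesis tlr : tl < tr.
Local Notation I := (`[tl, tr]%classic : set R).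

Lemma mderivZ J m p (c : R) (F G : R -> 'M[R]_(m, p)) : mderiv J F G ->
  mderiv J (fun t => c *: F t) (fun t => c *: G t).
Proof.
move=> FG.
apply: (eq_mderiv _ _ (mderivM (@mderiv_cst _ _ _ _ c%:M) FG)) => t _.
  by rewrite mul_scalar_mx.
by rewrite mul0mx add0r mul_scalar_mx.
Qed.

(* [arr i l] is the coefficient of the [l]-th derivative of [x] in the [i]-th
   derivative of [E x' - A x]. *)
Fixpoint arr (i l : nat) : R -> 'M[R]_n :=
  match i, l with
  | 0, 0 => fun t => - A t
  | 0, 1 => E
  | 0, _ => fun=> 0
  | i'.+1, 0 => deriveI I (arr i' 0%N)
  | i'.+1, l'.+1 => fun t => deriveI I (arr i' l'.+1) t + arr i' l' t
  end.

Lemma msmooth_arr k i l : msmooth I (k + i) E -> msmooth I (k + i) A ->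
  msmooth I k (arr i l).
Proof.
elim: i k l => [|i IH] k l; rewrite ?addn0 ?addnS => sE sA.
  case: l => [|[|l]] //=; [exact: msmoothN|exact: msmooth_cst].
case: l => [|l] /=; first by apply: msmooth_deriveI => //; exact: IH.
apply: msmoothD; first by apply: msmooth_deriveI => //; exact: IH.
by apply: IH; [exact: msmooth_le sE|exact: msmooth_le sA].
Qed.

Lemma array_rec_arr mu : msmooth I mu E -> msmooth I mu A ->
  array_rec mu I arr (fun i l => deriveI I (arr i l)).
Proof.
move=> sE sA; split=> // i l im; apply: (@mderiv_deriveI _ _ _ tlr 0).
by apply: msmooth_arr; [exact: msmooth_le sE|exact: msmooth_le sA].
Qed.

Lemma arr0E i t : msmooth I i A -> I t -> arr i 0%N t = - derivenI I i A t.
Proof.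
elim: i t => [//|i IH] t sA It /=.
apply: (mderiv_deriveI_eq tlr (G := fun t => - derivenI I i.+1 A t)) It.
apply: eq_mderiv (mderivN (mderiv_derivenI tlr sA)) => // s Js.
by rewrite IH//; exact: msmooth_le sA.
Qed.

(** Pascal's rule matches the Leibniz recursion with the binomial entries of the array. For [j >= i]
    the subtraction [i - j - 1] truncates, but there ['C(i, j.+1)] vanishes. *)
Lemma arrSE i j t : msmooth I i E -> msmooth I i A -> I t ->
  arr i j.+1 t = 'C(i, j)%:R *: derivenI I (i - j)%N E t
     - 'C(i, j.+1)%:R *: derivenI I (i - j - 1)%N A t.
Proof.
elim: i j t => [|i IH] j t sE sA It.
  by case: j => [|j] /=; rewrite ?bin0n /= ?scale1r ?scale0r ?subrr ?subr0.
have sE' := msmooth_le (leqnSn i) sE; have sA' := msmooth_le (leqnSn i) sA.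
have -> : arr i.+1 j.+1 t = deriveI I (arr i j.+1) t + arr i j t by [].
have -> : deriveI I (arr i j.+1) t =
    'C(i, j)%:R *: derivenI I (i - j).+1 E t
    - 'C(i, j.+1)%:R *: derivenI I (i - j - 1).+1 A t.
  apply: (mderiv_deriveI_eq tlr (G := fun t =>
    'C(i, j)%:R *: derivenI I (i - j).+1 E t
    - 'C(i, j.+1)%:R *: derivenI I (i - j - 1).+1 A t)) It.
  have dE : mderiv I (derivenI I (i - j) E) (derivenI I (i - j).+1 E).
    by apply: mderiv_derivenI => //; apply: msmooth_le sE; lia.
  have dA : mderiv I (derivenI I (i - j - 1) A) (derivenI I (i - j - 1).+1 A).
    by apply: mderiv_derivenI => //; apply: msmooth_le sA; lia.
  have D : mderiv I _ _ :=
    mderivB (mderivZ (c := 'C(i, j)%:R) dE) (mderivZ (c := 'C(i, j.+1)%:R) dA).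
  apply: (eq_mderiv _ _ D) => // s Js.
  by rewrite IH.
have e1 : 'C(i, j.+1)%:R *: derivenI I (i - j - 1).+1 A t =
    'C(i, j.+1)%:R *: derivenI I (i - j) A t :> 'M[R]_n.
  have [ji|ij] := ltnP j i; first by congr (_ *: derivenI _ _ _ _); lia.
  by rewrite bin_small ?scale0r.
rewrite e1; case: j e1 => [|j] _.
  rewrite arr0E// !subn0 subn1 /= !bin0 bin1 !bin1 -addrA; congr (_ + _).
  by rewrite -natr1 scalerDl scale1r opprD.
rewrite IH// !binS !natrD !scalerDl opprD addrACA subSS; congr (_ + _).
  have [ji|ij] := leqP j.+1 i.
    by congr (_ *: derivenI _ _ _ _ + _); lia.
  by rewrite [in LHS]bin_small// [in RHS]bin_small// !scale0r.
by congr (- _ - _); congr (_ *: derivenI _ _ _ _); lia.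
Qed.

(** Inverse to [pack]. The value 0 beyond the last block is meaningful: [Z_(mu+1) = 0] is the
    starting point of the later descents in the order. *)
Definition blk N m (X : 'M[R]_(m, \sum_(i < N) n)) (i : nat) : 'M[R]_(m, n) :=
  if insub i is Some i' then submxrow X i' else 0.

Lemma pack_blk N m (X : 'M[R]_(m, \sum_(i < N) n)) : pack N (blk X) = X.
Proof.
rewrite -[RHS]submxrowK; apply/eq_mxrow => i.
by rewrite /blk valK.
Qed.

Lemma blk_ge N m (X : 'M[R]_(m, \sum_(i < N) n)) i : (N <= i)%N -> blk X i = 0.
Proof. by move=> Ni; rewrite /blk insubF// ltnNge Ni. Qed.

Variable mu : nat.
Hypothesis sE : msmooth I mu E.
Hypothesis sA : msmooth I mu A.

Lemma pack_M_array m (h : nat -> 'M[R]_(m, n)) t : I t ->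
  pack mu.+1 h *m M_array I mu E A t =
  pack mu.+1 (fun j => \sum_(i < mu.+1) h i *m arr i j.+1 t).
Proof.
move=> It; rewrite /pack /M_array mul_mxrow_mxblock; apply/eq_mxrow => j.
apply: eq_bigr => i _; rewrite arrSE//.
  by apply: msmooth_le sE; rewrite -ltnS.
by apply: msmooth_le sA; rewrite -ltnS.
Qed.

Lemma pack_stacked m p (h : nat -> 'M[R]_(m, n)) (F : R -> 'M[R]_(n, p)) t :
  pack mu.+1 h *m stacked I mu F t =
  \sum_(i < mu.+1) h i *m derivenI I i F t.
Proof. by rewrite /pack /stacked mul_mxrow_mxcol. Qed.

(** The left kernel of the array consists of the operators whose product with [E D - A] has order 0.
    The equations for [l > mu] have no column in the array; they hold because the coefficients
    vanish for reasons of order. *)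
Lemma annih_M_array m (h : nat -> 'M[R]_(m, n)) t : I t ->
  pack mu.+1 h *m M_array I mu E A t = 0 <->
  forall l, \sum_(i < mu.+1) h i *m arr i l.+1 t = 0.
Proof.
move=> It; rewrite pack_M_array// -(pack0 mu.+1 m n).
split=> [/eq_packP H l|H]; last by apply/eq_packP => j _.
have [lm|ml] := ltnP l mu.+1; first exact: H.
rewrite big1// => i _; rewrite (array_eq0 tlr (array_rec_arr sE sA)) ?mulmx0//.
  by rewrite -ltnS.
by rewrite ltnS; apply: leq_trans (ltn_ord i) ml.
Qed.

Lemma msmooth_M_array k : msmooth I (k + mu) E -> msmooth I (k + mu) A ->
  msmooth I k (M_array I mu E A).
Proof.
move=> sE' sA' i j.
pose i1 := tagnat.sig1 i; pose j1 := tagnat.sig1 j.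
have i1m : (i1 <= mu)%N by rewrite -ltnS.
have H : msmooth I k (arr i1 j1.+1).
  by apply: msmooth_arr; [apply: msmooth_le sE'|apply: msmooth_le sA'];
    rewrite leq_add2l.
apply: (eq_smooth _ (H (tagnat.sig2 i) (tagnat.sig2 j))) => t It.
rewrite /M_array [RHS]mxE arrSE//.
  exact: msmooth_le sE.
exact: msmooth_le sA.
Qed.

Lemma msmooth_stacked k p (F : R -> 'M[R]_(n, p)) : msmooth I (k + mu) F ->
  msmooth I k (stacked I mu F).
Proof.
move=> sF i j; pose i1 := tagnat.sig1 i.
have H : msmooth I k (derivenI I i1 F).
  apply: msmooth_derivenI => //; apply: msmooth_le sF.
  by rewrite leq_add2l -ltnS.
by apply: (eq_smooth _ (H (tagnat.sig2 i) j)) => t It; rewrite /stacked mxE.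
Qed.

End DerivativeArray.

(** * No new constraint one level above [mu] *)

Section KeyFact.
Context {R : realType}.
Variables (s n mu a d : nat) (tl tr : R) (E A : R -> 'M[R]_n).
Hypothesis tlr : tl < tr.
Local Notation I := (`[tl, tr]%classic : set R).
(** The last [mu] covers the derivatives inside the array and [2 + mu + mu.+1 * mu] the left
    divisions of the descent; [s + mu] derivatives of [A] make [A2] of class [C^s]. The demands are
    added up rather than optimized. *)
Local Notation rho := (s + (2 + mu + mu.+1 * mu) + mu)%N.
Hypothesis s0 : (0 < s)%N.
Hypothesis sE : msmooth I rho E.
Hypothesis sA : msmooth I rho A.
Variables (Z2 : R -> 'M[R]_(\sum_(i < mu.+1) n, a)) (K Z1 : R -> 'M[R]_(n, d)).
Hypothesis HH : hypH_with I s E A Z2 K Z1.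

Let sEmu : msmooth I mu E. Proof. by apply: msmooth_le sE; lia. Qed.
Let sAmu : msmooth I mu A. Proof. by apply: msmooth_le sA; lia. Qed.

Definition Zblk (i : nat) (t : R) : 'M[R]_(a, n) := blk (Z2 t)^T i.
Local Notation A2 := (hatA2 I A Z2).

Lemma msmooth_blk J k N m (X : R -> 'M[R]_(m, \sum_(i < N) n)) i :
  msmooth J k X -> msmooth J k (fun t => blk (X t) i).
Proof.
rewrite /blk; case: insubP => [i' _ _|_] sX; last exact: msmooth_cst.
move=> l j; apply: (eq_smooth _ (sX l (tagnat.Rank i' j))) => t _.
by rewrite mxE.
Qed.

Lemma pack_Zblk t : pack mu.+1 (Zblk^~ t) = (Z2 t)^T.
Proof. exact: pack_blk. Qed.

Lemma msmooth_Zblk i : msmooth I s (Zblk i).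
Proof.
by apply: msmooth_blk; apply: msmooth_tr; apply/(Ck_msmooth tlr); case: HH.
Qed.

Lemma mderiv_Zblk i : mderiv I (Zblk i) (deriveI I (Zblk i)).
Proof.
by apply: (@mderiv_deriveI _ _ _ tlr 0); apply: msmooth_le (msmooth_Zblk i).
Qed.

Lemma Zblk_ge i t : (mu < i)%N -> Zblk i t = 0.
Proof. exact: blk_ge. Qed.

Lemma hatA2E t : A2 t = \sum_(i < mu.+1) Zblk i t *m derivenI I i A t.
Proof. by rewrite /hatA2 -pack_Zblk pack_stacked. Qed.

Lemma asum_Zblk0 t : I t -> asum mu (arr tl tr E A) Zblk 0 t = - A2 t.
Proof.
move=> It; rewrite hatA2E /asum -sumrN; apply: eq_bigr => i _.
rewrite (arr0E _ tlr)// ?mulmxN//.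
by apply: msmooth_le sAmu; rewrite -ltnS.
Qed.

Lemma row_free_Z2T t : I t -> row_free (Z2 t)^T.
Proof. by move=> It; rewrite /row_free mxrank_tr (hypH_Z2_rank HH). Qed.

Lemma row_free_A2 t : I t -> row_free (A2 t).
Proof. by move=> It; rewrite /row_free (hypH_rankA2 HH). Qed.

Lemma A2K t : I t -> A2 t *m K t = 0.
Proof.
move=> It; have /eqmxP H := hypH_K_ker HH It.
have : (K t)^T *m (A2 t)^T = 0 by apply/sub_kermxP; rewrite H.
by rewrite -trmx_mul => /(congr1 trmx); rewrite trmxK trmx0.
Qed.

Lemma sub_A2 t m (X : 'M[R]_(m, n)) : I t -> X *m K t = 0 -> (X <= A2 t)%MS.
Proof.
move=> It XK; have sA2 : (A2 t <= kermx (K t))%MS by apply/sub_kermxP; exact: A2K.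
apply: submx_trans (_ : kermx (K t) <= _)%MS; first exact/sub_kermxP.
rewrite -(geq_leqif (mxrank_leqif_sup sA2)) mxrank_ker.
by rewrite (hypH_K_rank HH)// (hypH_rankA2 HH)// -(hypH_dim HH) addKn.
Qed.

Lemma a_le : (a <= \sum_(i < mu.+1) n)%N.
Proof.
have It : I tl by exact: itv_left.
by rewrite -[X in (X <= _)%N](hypH_Z2_rank HH It) rank_leq_row.
Qed.

Lemma left_kernel_M t m (X : 'M[R]_(m, \sum_(i < mu.+1) n)) : I t ->
  X *m M_array I mu E A t = 0 -> (X <= (Z2 t)^T)%MS.
Proof.
move=> It XM; have sub : ((Z2 t)^T <= kermx (M_array I mu E A t))%MS.
  by apply/sub_kermxP; exact: (hypH_Z2_null HH).
apply: submx_trans (_ : kermx (M_array I mu E A t) <= _)%MS; first exact/sub_kermxP.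
rewrite -(geq_leqif (mxrank_leqif_sup sub)) mxrank_ker mxrank_tr.
rewrite (hypH_Z2_rank HH)// (hypH_rankM HH)//.
have := a_le; rewrite sum_nat_const card_ord => H.
by rewrite subKn.
Qed.

(* [Z2] is only [C^s]; the formula below exhibits a basis of the left kernel that
   is as smooth as the derivative array itself. *)
Lemma ex_smooth_left_kernel (a0 b0 : R) : a0 < b0 ->
  `[a0, b0]%classic `<=` I ->
  exists a1 b1 (B : R -> 'M[R]_(a, \sum_(i < mu.+1) n)),
    [/\ a1 < b1, `[a1, b1]%classic `<=` `[a0, b0]%classic,
     msmooth `[a1, b1]%classic (2 + mu + mu.+1 * mu) B,
     forall t, `[a1, b1]%classic t -> B t *m M_array I mu E A t = 0 &
     forall t, `[a1, b1]%classic t -> row_free (B t)].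
Proof.
move=> ab sub; have Ja := itv_left ab; have Ia := sub _ Ja.
pose Zc := (Z2 a0)^T.
have sZ2 : msmooth I s Z2 by apply/(Ck_msmooth tlr); case: HH.
have sPhi : msmooth `[a0, b0]%classic 0 (fun t => (Z2 t)^T *m Zc^T).
  apply: msmoothM; last exact: msmooth_cst.
  by apply: msmooth_tr; apply: (msmooth_subset sub); apply: msmooth_le sZ2.
have fPhi0 : row_free ((Z2 a0)^T *m Zc^T).
  by rewrite row_free_unit; apply: gram_unit; exact: row_free_Z2T.
have [a1 [b1 [ab1 sub1 fPhi]]] := near_row_free ab Ja sPhi fPhi0.
have sub' := subset_trans sub1 sub.
pose M := M_array I mu E A.
pose X t := row_mx (M t) Zc^T.
have fX t : `[a1, b1]%classic t -> row_free (X t).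
  move=> Jt; apply: inj_row_free => c; rewrite mul_mx_row -row_mx0 => /eq_row_mx[cM cZ].
  have /submxP[y cy] := left_kernel_M (sub' t Jt) cM.
  have := fPhi t Jt => fP; rewrite cy (row_free_mul0 (C := y) fP) ?mul0mx//.
  by rewrite mulmxA -cy.
have sX : msmooth `[a1, b1]%classic (2 + mu + mu.+1 * mu) X.
  apply: msmooth_row_mx; last exact: msmooth_cst.
  apply: (msmooth_subset sub'); apply: msmooth_M_array => //.
    by apply: msmooth_le sE; lia.
  by apply: msmooth_le sA; lia.
exists a1, b1, (fun t => Zc *m invmx (X t *m (X t)^T)).
(* Since [Z2^T M = 0], multiplying [Z2^T] by [X X^T = M M^T + Zc^T Zc] leaves [(Z2^T Zc^T) Zc]. So
   the formula is [Z2^T] up to an invertible factor, written without the varying [Z2]. *)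
have BE t : `[a1, b1]%classic t -> Zc *m invmx (X t *m (X t)^T) =
    invmx ((Z2 t)^T *m Zc^T) *m (Z2 t)^T.
  move=> Jt; have uG := gram_unit (fX t Jt).
  have uP : (Z2 t)^T *m Zc^T \in unitmx by rewrite -row_free_unit fPhi.
  rewrite -[RHS](mulmxK uG); congr (_ *m _).
  rewrite mulmxA -[_ *m (Z2 t)^T *m _]mulmxA mul_mx_row (hypH_Z2_null HH (sub' t Jt)).
  by rewrite mul_mx_row mulmx0 mulVmx// tr_row_mx mul_row_col mul0mx add0r trmxK mul1mx.
split=> //.
- apply: msmoothM; first exact: msmooth_cst.
  apply: msmooth_inv; first by move=> t /fX; exact: gram_unit.
  by apply: msmoothM => //; exact: msmooth_tr.
- move=> t Jt; rewrite BE// -mulmxA (hypH_Z2_null HH (sub' t Jt)).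
  by rewrite mulmx0.
- move=> t Jt; rewrite BE//.
  have uP : (Z2 t)^T *m Zc^T \in unitmx by rewrite -row_free_unit fPhi.
  rewrite /row_free mxrankMfree ?row_free_Z2T//; last exact: sub'.
  by rewrite -/(row_free _) row_free_unit unitmx_inv.
Qed.

(* A projection whose rows span the left kernel of [E K]. *)
Definition Eproj t : 'M[R]_n :=
  1%:M - E t *m K t *m invmx ((Z1 t)^T *m E t *m K t) *m (Z1 t)^T.

(** [P E] vanishes on [K], and the rows of [A2] span everything that does: this is the [v] with
    [v A2 = P E], given by a Gram inverse and hence as smooth as its data. *)
Definition vcoef t : 'M[R]_(n, a) := rcoef (Eproj t *m E t) (A2 t).

Lemma Z1EK_unit t : I t -> (Z1 t)^T *m E t *m K t \in unitmx.
Proof. by move=> It; rewrite -row_free_unit /row_free (hypH_Z1EK HH). Qed.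

Lemma EprojEK t : I t -> Eproj t *m E t *m K t = 0.
Proof.
move=> It; rewrite /Eproj mulmxBl mul1mx mulmxBl -!mulmxA.
by rewrite (mulmxA _ (E t)) mulVmx ?Z1EK_unit// mulmx1 subrr.
Qed.

Lemma vcoefE t : I t -> vcoef t *m A2 t = Eproj t *m E t.
Proof.
move=> It; rewrite rcoef_sub//; first exact: row_free_A2.
by apply: sub_A2 => //; exact: EprojEK.
Qed.

Lemma msmooth_A2 : msmooth I s A2.
Proof.
apply: msmoothM; first by apply: msmooth_tr; apply/(Ck_msmooth tlr); case: HH.
by apply: msmooth_stacked => //; apply: msmooth_le sA; lia.
Qed.

Lemma msmooth_Eproj : msmooth I s Eproj.
Proof.
have sK : msmooth I s K by apply/(Ck_msmooth tlr); case: HH.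
have sZ1 : msmooth I s Z1 by apply/(Ck_msmooth tlr); case: HH.
have sE' : msmooth I s E by apply: msmooth_le sE; lia.
have sZ1T := msmooth_tr sZ1.
apply: msmoothB; first exact: msmooth_cst.
do 2?[apply: msmoothM => //]; first exact: msmoothM.
apply: msmooth_inv; first exact: Z1EK_unit.
by do 2?[apply: msmoothM => //].
Qed.

Lemma msmooth_vcoef : msmooth I s vcoef.
Proof.
apply: msmooth_rcoef; [exact: row_free_A2| |exact: msmooth_A2].
apply: msmoothM; first exact: msmooth_Eproj.
by apply: msmooth_le sE; lia.
Qed.

(** The coefficients of the operator [P + v D Z], with the derivation composed on the left of [Z].
    Its order may reach [mu + 1], hence the [mu.+2] blocks below. *)
Definition eta (i : nat) (t : R) : 'M[R]_n :=
  vcoef t *m deriveI I (Zblk i) t +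
  (if i is i'.+1 then vcoef t *m Zblk i' t else Eproj t).

(* The inclusion is a closed condition, hence it suffices to have it on a dense
   set. *)
Lemma key_fact_dense (a0 b0 : R) : a0 < b0 -> `[a0, b0]%classic `<=` I ->
  exists2 t, `[a0, b0]%classic t &
    (pack mu.+2 (eta^~ t) <= pack mu.+2 (Zblk^~ t))%MS.
Proof.
move=> ab sub.
have [a1 [b1 [B [ab1 sub1 sB annB fB]]]] := ex_smooth_left_kernel ab sub.
have sub' := subset_trans sub1 sub.
have HL := array_rec_arr tlr sEmu sAmu.
have [|||||||||||||t Jt H] := @kernel_coef R n mu a (arr tl tr E A) _ a1 b1
  (fun i t => blk (B t) i) Zblk (fun i => deriveI I (Zblk i)) d K ab1
  (array_rec_subset sub' HL).
- by move=> i; exact: msmooth_blk.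
- by move=> i t mi _; rewrite blk_ge.
- move=> l t Jt; apply: (annih_M_array tlr sEmu sAmu _ (sub' t Jt)).1.
  by rewrite pack_blk annB.
- by move=> t Jt; rewrite pack_blk fB.
- move=> i; apply: (msmooth_subset sub'); exact: msmooth_le (msmooth_Zblk i).
- by move=> i; apply: (mderiv_subset sub'); exact: mderiv_Zblk.
- by move=> i t mi _; exact: Zblk_ge.
- by move=> t /sub' It; rewrite pack_Zblk row_free_Z2T.
- move=> t /sub' It; rewrite asum_Zblk0// /row_free mxrank_opp.
  exact: row_free_A2.
- move=> t m h /sub' It /(annih_M_array tlr sEmu sAmu _ It).2 hM.
  by rewrite pack_Zblk; exact: left_kernel_M.
- by move=> t /sub' It; rewrite asum_Zblk0// mulNmx A2K// oppr0.
- by rewrite -(hypH_dim HH) leq_addl.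
- by move=> t /sub' It; rewrite (hypH_rankEK HH)// -(hypH_dim HH) addnK.
exists t; first exact: sub1.
have It := sub' t Jt.
have [v [c [vA c0 cS]]] := H _ (Eproj t) (EprojEK It).
have vE : v = vcoef t.
  apply/eqP; rewrite -subr_eq0; apply/eqP; apply: (row_free_mul0 (row_free_A2 It)).
  rewrite mulmxBl vcoefE//; move: vA; rewrite asum_Zblk0// mulmxN => /oppr_inj ->.
  by rewrite subrr.
apply/pack_subP; exists c => -[|i] _; rewrite /eta -vE; last exact: cS.
by rewrite addrC.
Qed.

Lemma ex_nonzero_itv (f : R -> R) t : smooth I 0 f -> I t -> f t != 0 ->
  exists a' b', [/\ a' < b', `[a', b']%classic `<=` I &
    forall s, `[a', b']%classic s -> f s != 0].
Proof.
move=> sf It ft.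
have U x : row_free (x%:M : 'M[R]_1) = (x != 0).
  by rewrite row_free_unit unitmxE det_scalar1 unitfE.
have sF : msmooth I 0 (fun t => (f t)%:M : 'M[R]_1).
  by move=> i j; apply: (eq_smooth _ sf) => u _; rewrite !ord1 mxE.
have [|a' [b' [H1 H2 H3]]] := near_row_free tlr It sF; first by rewrite U.
by exists a', b'; split=> // u /H3; rewrite U.
Qed.

(* Extending the derivative array by one row gives no new constraint: with
   [w E = v A2], the operator [w + v D Z] is a combination of the rows of [Z]. *)
Lemma key_fact t : I t -> exists c : 'M[R]_(n, a),
  Eproj t + vcoef t *m deriveI I (Zblk 0) t = c *m Zblk 0 t /\
  forall i, vcoef t *m deriveI I (Zblk i.+1) t + vcoef t *m Zblk i t =
    c *m Zblk i.+1 t.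
Proof.
move=> It.
pose Zp t := pack mu.+2 (Zblk^~ t); pose Ep t := pack mu.+2 (eta^~ t).
have fZ u : I u -> row_free (Zp u).
  move=> Iu; apply: inj_row_free => c; rewrite mul_pack -(pack0 mu.+2 1 n) => /eq_packP cZ.
  apply: (row_free_mul0 (row_free_Z2T Iu)); rewrite -pack_Zblk mul_pack -(pack0 mu.+1 1 n).
  by apply/eq_packP => i im; rewrite cZ// leqW.
have sZp : msmooth I 0 Zp.
  by apply: msmooth_pack => i _; apply: msmooth_le (msmooth_Zblk i).
have sEp : msmooth I 0 Ep.
  apply: msmooth_pack => i _; apply: msmoothD.
    apply: msmoothM; first exact: msmooth_le msmooth_vcoef.
    by apply: msmooth_deriveI => //; apply: msmooth_le (msmooth_Zblk i).
  case: i => [|i]; first exact: msmooth_le msmooth_Eproj.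
  apply: msmoothM; first exact: msmooth_le msmooth_vcoef.
  exact: msmooth_le (msmooth_Zblk i).
pose c u := rcoef (Ep u) (Zp u).
have sc : msmooth I 0 c by exact: msmooth_rcoef.
(* A nonzero entry of the continuous function [Ep - c Zp] would stay nonzero on an interval, and
   [key_fact_dense] provides a point there at which [Ep = c Zp]. *)
have Ec u : I u -> Ep u = c u *m Zp u.
  move=> Iu; apply/eqP; rewrite -subr_eq0; apply/eqP/matrixP => i j; rewrite [RHS]mxE.
  apply/eqP/negPn/negP => nz.
  have sf := msmoothB sEp (msmoothM sc sZp) i j.
  have [a' [b' [ab' sub nz']]] := ex_nonzero_itv sf Iu nz.
  have [w Jw /(rcoef_sub (fZ w (sub w Jw)))] := key_fact_dense ab' sub.
  rewrite -/(Ep w) -/(c w) => Ew; have := nz' w Jw.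
  by rewrite Ew subrr mxE eqxx.
exists (c t); have := Ec t It; rewrite /Ep /Zp mul_pack => /eq_packP H.
split=> [|i]; first by rewrite addrC; exact: (H 0%N).
have [im|mi] := ltnP i.+1 mu.+2; first exact: (H i.+1).
rewrite !Zblk_ge ?mulmx0 ?addr0//; try exact: leqW.
rewrite (mderiv_eq0 tlr (@mderiv_Zblk i.+1)) ?mulmx0// => u _.
by rewrite Zblk_ge// ltnW.
Qed.

End KeyFact.

(** * The reduced equation and its invariant form *)

Section Consequences.
Context {R : realType}.
Variables (s n mu a d : nat) (tl tr : R) (E A : R -> 'M[R]_n).
Hypothesis tlr : tl < tr.
Local Notation I := (`[tl, tr]%classic : set R).
Local Notation rho := (s + (2 + mu + mu.+1 * mu) + mu)%N.
Hypothesis s0 : (0 < s)%N.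
Hypothesis sE : msmooth I rho E.
Hypothesis sA : msmooth I rho A.
Variables (Z2 : R -> 'M[R]_(\sum_(i < mu.+1) n, a)) (K Z1 : R -> 'M[R]_(n, d)).
Hypothesis HH : hypH_with I s E A Z2 K Z1.
Local Notation A2 := (hatA2 I A Z2).
Local Notation Z := (Zblk Z2).
Local Notation Zd := (fun i => deriveI I (Zblk Z2 i)).
Local Notation P := (Eproj E K Z1).
Local Notation v := (vcoef tl tr E A Z2 K Z1).

(** The operator [Z] applied to [F]: it gives [A2] for [F = A] and [hatf2] for [F = f]. *)
Definition jet p (F : R -> 'M[R]_(n, p)) (t : R) :=
  \sum_(i < mu.+1) Z i t *m derivenI I i F t.

Definition djet p (F : R -> 'M[R]_(n, p)) (t : R) :=
  \sum_(i < mu.+1) (Zd i t *m derivenI I i F t + Z i t *m derivenI I i.+1 F t).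

Lemma mderiv_jet p (F : R -> 'M[R]_(n, p)) : msmooth I mu.+1 F ->
  mderiv I (jet F) (djet F).
Proof.
move=> sF; apply: mderiv_sum => i _; apply: mderivM.
  exact: (mderiv_Zblk tlr s0 HH).
by apply: mderiv_derivenI => //; apply: msmooth_le sF.
Qed.

Lemma key_sum t : I t -> exists c : 'M[R]_(n, a),
  [/\ P t + v t *m Zd 0%N t = c *m Z 0%N t,
   forall i, v t *m Zd i.+1 t + v t *m Z i t = c *m Z i.+1 t &
   forall p (F : R -> 'M[R]_(n, p)),
     P t *m F t + v t *m djet F t = c *m jet F t].
Proof.
move=> It; have [c [c0 cS]] := key_fact tlr s0 sE sA HH It.
exists c; split=> // p F; rewrite /djet /jet !mulmx_sumr.
(* The coefficient of order [mu + 1] of the identity, where [Z] has none; it removes the derivative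
   of order [mu + 1] of [F] from [v *m djet F]. *)
have vmu : v t *m Z mu t = 0.
  have zz u : Z mu.+1 u = 0 by rewrite Zblk_ge.
  have dz : mderiv I (Z mu.+1) (Zd mu.+1) by exact: (mderiv_Zblk tlr s0 HH).
  have := cS mu; rewrite zz mulmx0 (mderiv_eq0 tlr dz)// => <-.
  by rewrite mulmx0 add0r.
have E1 : \sum_(i < mu.+1) v t *m (Zd i t *m derivenI I i F t + Z i t *m derivenI I i.+1 F t)
  = \sum_(i < mu.+1) v t *m Zd i t *m derivenI I i F t
    + \sum_(i < mu) v t *m Z i t *m derivenI I i.+1 F t.
  under eq_bigr => i _ do rewrite mulmxDr !mulmxA.
  by rewrite big_split /= [X in _ + X]big_ord_recr /= vmu mul0mx addr0.
rewrite E1 big_ord_recl [in RHS]big_ord_recl !addrA /= mulmxA -c0 (mulmxDl (P t)).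
rewrite -!addrA; congr (_ + (_ + _)); rewrite -big_split /=.
by apply: eq_bigr => i _; rewrite mulmxA -cS mulmxDl.
Qed.

Lemma A2_jet t : A2 t = jet A t.
Proof. exact: hatA2E. Qed.

(** Differentiating the constraint and multiplying by [v] recovers, through [v D Z = c Z - P], the
    part [P] of the DAE that the projection by [Z1] drops. The terms with [c] disappear by the
    constraint itself. *)
Lemma residual p (F X X' : R -> 'M[R]_(n, p)) t : msmooth I mu.+1 F ->
  mderiv I X X' -> (forall u, I u -> A2 u *m X u = - jet F u) -> I t ->
  P t *m (F t + A t *m X t - E t *m X' t) = 0.
Proof.
move=> sF dX AX It.
have [c [_ _ H]] := key_sum It.
have sA' : msmooth I mu.+1 A by apply: msmooth_le sA; lia.
have D : mderiv I (fun u => jet A u *m X u + jet F u) _ :=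
  mderivD (mderivM (mderiv_jet sA') dX) (mderiv_jet sF).
have /(congr1 (mulmx (v t))) : djet A t *m X t + jet A t *m X' t + djet F t = 0.
  by apply: (mderiv_eq0 tlr D) => // u Iu; rewrite -A2_jet AX// addNr.
have vA : v t *m djet A t = c *m A2 t - P t *m A t.
  by rewrite A2_jet -H addrC addKr.
have vF : v t *m djet F t = c *m jet F t - P t *m F t.
  by rewrite -H addrC addKr.
rewrite !mulmxDr mulmx0 (mulmxA _ (djet A t)) (mulmxA _ (jet A t)) vA vF.
rewrite -(A2_jet t) (vcoefE HH)// mulmxBl -(mulmxA c) AX// mulmxN => H0.
rewrite mulmxN (mulmxA _ (A t)) (mulmxA _ (E t)).
apply/eqP; rewrite -oppr_eq0 -[X in _ == X]H0; apply/eqP.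
set x := P t *m F t; set y := P t *m A t *m X t; set z := P t *m E t *m X' t.
set w := c *m jet F t.
by apply/matrixP => i j; rewrite !mxE; ring.
Qed.

Lemma Eproj0_range p (X : 'M[R]_(n, p)) t : P t *m X = 0 ->
  X = E t *m K t *m (invmx ((Z1 t)^T *m E t *m K t) *m ((Z1 t)^T *m X)).
Proof.
rewrite /Eproj mulmxBl mul1mx => /eqP; rewrite subr_eq0 => /eqP H.
by rewrite {1}H !mulmxA.
Qed.

Lemma jet0 p t : I t -> jet (fun=> 0 : 'M[R]_(n, p)) t = 0.
Proof.
move=> It; rewrite /jet big1// => i _.
have Z0 k u : I u -> derivenI I k (fun=> 0 : 'M[R]_(n, p)) u = 0.
  elim: k u => [//|k IH] u Iu /=.
  apply: (mderiv_deriveI_eq tlr (G := fun=> 0)) Iu.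
  by apply: (eq_mderiv _ _ (@mderiv_cst _ _ _ _ 0)) => // w Iw; rewrite IH.
by rewrite Z0// mulmx0.
Qed.

Lemma residual0 p (X X' : R -> 'M[R]_(n, p)) t : mderiv I X X' ->
  (forall u, I u -> A2 u *m X u = 0) -> I t ->
  A t *m X t - E t *m X' t = E t *m K t *m
    (invmx ((Z1 t)^T *m E t *m K t) *m ((Z1 t)^T *m (A t *m X t - E t *m X' t))).
Proof.
move=> dX AX It; apply: Eproj0_range.
rewrite -[A t *m X t]add0r; apply: (@residual _ (fun=> 0) X X') => //.
  exact: msmooth_cst.
by move=> u Iu; rewrite AX// jet0// oppr0.
Qed.

(** The matrix of the ODE for [z] that results from inserting [x = K z] in the homogeneous reduced
    equation. *)
Definition reduced_matrix (t : R) : 'M[R]_d :=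
  invmx ((Z1 t)^T *m E t *m K t) *m
    ((Z1 t)^T *m (A t *m K t - E t *m deriveI I K t)).

Let sK : msmooth I s K. Proof. by apply/(Ck_msmooth tlr); case: HH. Qed.

Let dK : mderiv I K (deriveI I K).
Proof. by apply: (@mderiv_deriveI _ _ _ tlr 0); apply: msmooth_le sK. Qed.

Lemma msmooth_reduced_matrix : msmooth I s.-1 reduced_matrix.
Proof.
have sK' : msmooth I s.-1 K by apply: msmooth_le sK; exact: leq_pred.
have sZ1 : msmooth I s Z1 by apply/(Ck_msmooth tlr); case: HH.
have {}sZ1 : msmooth I s.-1 (fun t => (Z1 t)^T).
  by apply: msmooth_tr; apply: msmooth_le sZ1; exact: leq_pred.
have sE' : msmooth I s.-1 E by apply: msmooth_le sE; lia.
have sA' : msmooth I s.-1 A by apply: msmooth_le sA; lia.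
apply: msmoothM.
  apply: msmooth_inv; first exact: (Z1EK_unit HH).
  by do 2?[apply: msmoothM => //].
apply: msmoothM => //; apply: msmoothB; first exact: msmoothM.
apply: msmoothM => //; apply: msmooth_deriveI => //.
by rewrite prednK.
Qed.

(** By [residual0], [A K - E K'] lies in the range of [E K], so the equation projected by [Z1]
    already holds unprojected. *)
Lemma reduced_solution (Psi : R -> 'M[R]_d) :
  mderiv I Psi (fun t => reduced_matrix t *m Psi t) ->
  exists2 Y', mderiv I (fun t => K t *m Psi t) Y' &
    forall t, I t -> E t *m Y' t = A t *m (K t *m Psi t).
Proof.
move=> dPsi.
exists (fun t => deriveI I K t *m Psi t + K t *m (reduced_matrix t *m Psi t)).
  exact: mderivM.
move=> t It; have := residual0 dK (fun u Iu => A2K HH Iu) It.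
rewrite -/(reduced_matrix t) => H.
rewrite mulmxDr (mulmxA (E t) (K t)) (mulmxA (E t) (deriveI I K t)).
rewrite (mulmxA (E t *m K t)) -H.
by rewrite mulmxBl addrC (mulmxA (A t)) subrK.
Qed.

Hypothesis sadj : self_adjoint I E A.

(** Both halves of self-adjointness give [Y'^T E = - Y^T A^T = - Y^T (A + E')], which cancels the
    other two terms in the derivative of [Y^T E Y]. *)
Lemma form_cst p (Y Y' : R -> 'M[R]_(n, p)) : mderiv I Y Y' ->
  (forall t, I t -> E t *m Y' t = A t *m Y t) ->
  forall t u, I t -> I u -> (Y t)^T *m E t *m Y t = (Y u)^T *m E u *m Y u.
Proof.
move=> dY EY; apply: mderiv0_cst.
have dE : mderiv I E (deriveI I E).
  by apply: (@mderiv_deriveI _ _ _ tlr 0); apply: msmooth_le sE; lia.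
apply: (eq_mderiv _ _ (mderivM (mderivM (mderiv_tr dY) dE) dY)) => // t It.
have [ET AT] := sadj It.
have -> : (Y' t)^T *m E t = - ((Y t)^T *m (A t + deriveI I E t)).
  rewrite -AT -trmx_mul -EY// trmx_mul ET mulmxN opprK.
  by [].
rewrite -(mulmxA _ (E t) (Y' t)) EY// mulmxDr opprD subrK mulNmx mulmxA.
by rewrite addNr.
Qed.

(* For a solution [y] with [y^T E K = 0] the key fact gives
   [(v Z_i)' = - v Z_(i-1)] and [(v Z_0)' = - y^T], where [v A2 = y^T E]; descending
   from [Z_(mu+1) = 0] yields [y = 0]. *)
Lemma form_nondegenerate t0 : I t0 -> (K t0)^T *m E t0 *m K t0 \in unitmx.
Proof.
move=> It0; rewrite -row_free_unit; apply: inj_row_free => x xS.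
have sB : msmooth I 0 reduced_matrix by exact: msmooth_le msmooth_reduced_matrix.
have [Psi [dPsi Psi0 uPsi _]] := ex_fundamental_matrix tlr It0 sB.
have [Y' dY EY] := reduced_solution dPsi.
pose Y t := K t *m Psi t; rewrite -/Y in dY EY.
pose y t := x *m (Y t)^T.
have yEK t : I t -> y t *m E t *m K t = 0.
  move=> It; have F := form_cst dY EY It It0.
  have Y0 : Y t0 = K t0 by rewrite /Y Psi0 mulmx1.
  have H : x *m ((Y t)^T *m E t *m Y t) = 0 by rewrite F Y0 xS.
  have : y t *m E t *m K t *m Psi t = 0 by rewrite -H /y /Y !mulmxA.
  move=> /(congr1 (fun X => X *m invmx (Psi t))).
  by rewrite mulmxK ?uPsi// mul0mx.
have yP t : I t -> y t *m P t = y t.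
  by move=> It; rewrite /Eproj mulmxBr mulmx1 !mulmxA yEK// !mul0mx subr0.
have [v' dv] : exists v', mderiv I v v'.
  have := msmooth_vcoef tlr s0 sE sA HH => /(msmooth_le (k' := 1) s0)/msmooth_mderiv[v' dv _].
  by exists v'.
have dy : mderiv I y (fun t => x *m (Y' t)^T).
  apply: (eq_mderiv _ _ (mderivM (@mderiv_cst _ _ _ _ x) (mderiv_tr dY))) => // t _.
  by rewrite mul0mx add0r.
pose vy t := y t *m v t.
have [vy' dvy] : exists vy', mderiv I vy vy' by eexists; exact: mderivM dy dv.
have vyA t : I t -> vy t *m A2 t = y t *m E t.
  by move=> It; rewrite /vy -mulmxA (vcoefE HH)// mulmxA yP.
have dE : mderiv I E (deriveI I E).
  by apply: (@mderiv_deriveI _ _ _ tlr 0); apply: msmooth_le sE; lia.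
have sA' : msmooth I mu.+1 A by apply: msmooth_le sA; lia.
have dyE : mderiv I (fun t => y t *m E t) (fun t => - (y t *m A t)).
  apply: (eq_mderiv _ _ (mderivM dy dE)) => // t It.
  have [ET AT] := sadj It.
  have -> : x *m (Y' t)^T *m E t = - (y t *m (A t + deriveI I E t)).
    have Q : (Y' t)^T *m E t = - ((Y t)^T *m (A t)^T).
      by rewrite -trmx_mul -(EY t It) trmx_mul ET mulmxN opprK.
    by rewrite -mulmxA Q -AT mulmxN mulmxA.
  by rewrite mulmxDr opprD subrK.
have step t : I t -> [/\ y t = - (vy' t *m Z 0%N t + vy t *m Zd 0%N t) &
    forall i, vy t *m Z i t = - (vy' t *m Z i.+1 t + vy t *m Zd i.+1 t)].
  move=> It; have [c [c0 cS cF]] := key_sum It.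
  have E1 : vy' t *m A2 t + vy t *m djet A t = - (y t *m A t).
    have D1 := mderivM dvy (mderiv_jet sA').
    rewrite A2_jet -(mderiv_deriveI_eq tlr D1 It).
    apply: (mderiv_deriveI_eq tlr (G := fun t => - (y t *m A t))) It.
    apply: (eq_mderiv _ _ dyE) => // u Iu.
    by rewrite -A2_jet vyA.
  (* Two identities for [vy *m djet A] are compared: the derivative of [vy A2 = y E], whose right
     side has derivative [- y A], and the key fact applied to [A]. Independence of the rows of [A2]
     then cancels [A2]. *)
  have yc : y t *m c = - vy' t.
    apply/eqP; rewrite -addr_eq0; apply/eqP.
    have F1 : y t *m (c *m A2 t) = y t *m A t + vy t *m djet A t.
      by rewrite A2_jet -cF mulmxDr (mulmxA (y t) (P t)) yP// (mulmxA (y t) (v t)).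
    apply: (row_free_mul0 (row_free_A2 HH It)).
    rewrite mulmxDl -(mulmxA (y t) c) F1 -addrA [X in _ + X]addrC E1.
    by rewrite addrN.
  split=> [|i].
    have := congr1 (mulmx (y t)) c0.
    rewrite mulmxDr yP// (mulmxA (y t) c) yc (mulmxA (y t) (v t)) -/(vy t) => H.
    by rewrite opprD -mulNmx -H addrK.
  have := congr1 (mulmx (y t)) (cS i).
  rewrite mulmxDr !(mulmxA (y t) (v t)) (mulmxA (y t) c) yc -/(vy t) => H.
  by rewrite opprD -mulNmx -H addrC addKr.
have vyZ i : (i <= mu.+1)%N -> forall t, I t -> vy t *m Z (mu.+1 - i)%N t = 0.
  elim: i => [|i IH] im t It; first by rewrite subn0 Zblk_ge// mulmx0.
  rewrite (step t It).2 -subSn// subSS.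
  have D := mderivM dvy (@mderiv_Zblk _ _ _ _ _ _ _ _ _ _ tlr s0 _ _ _ HH (mu.+1 - i)%N).
  by rewrite (mderiv_eq0 tlr D _ It) ?oppr0//; exact: IH (ltnW im).
have : y t0 = 0.
  rewrite (step t0 It0).1.
  have D := mderivM dvy (@mderiv_Zblk _ _ _ _ _ _ _ _ _ _ tlr s0 _ _ _ HH 0%N).
  rewrite (mderiv_eq0 tlr D _ It0) ?oppr0// => t It.
  by have := vyZ mu.+1 (leqnn _) t It; rewrite subnn.
rewrite /y /Y Psi0 mulmx1; apply: row_free_mul0.
by rewrite /row_free mxrank_tr (hypH_K_rank HH).
Qed.

End Consequences.

(** * Adapted frames *)

Section SkewForms.
Context {R : realType}.

Lemma J_mxK p : J_mx p *m J_mx p = - 1%:M :> 'M[R]_(p + p).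
Proof.
rewrite /J_mx mulmx_block !(mul0mx, mulmx0, mul1mx, mulmx1, addr0, add0r).
by rewrite scalar_mx_block opp_block_mx !oppr0.
Qed.

Lemma J_mx_unit p : (J_mx p : 'M[R]_(p + p)) \in unitmx.
Proof.
have : J_mx p *m (- J_mx p) = 1%:M :> 'M[R]_(p + p) by rewrite mulmxN J_mxK opprK.
by move=> /mulmx1_unit[].
Qed.

Section Skew.
Variables (d : nat) (S : 'M[R]_d).
Hypotheses (Sskew : S^T = - S) (Sunit : S \in unitmx).

Let form_tr m1 m2 (X : 'M[R]_(d, m1)) (Y : 'M[R]_(d, m2)) :
  (X^T *m S *m Y)^T = - (Y^T *m S *m X).
Proof. by rewrite !trmx_mul trmxK Sskew mulNmx mulmxN mulmxA. Qed.

Let form_diag (x : 'cV[R]_d) : x^T *m S *m x = 0.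
Proof.
have := form_tr x x; rewrite [_^T](_ : _ = x^T *m S *m x); last first.
  by rewrite [x^T *m S *m x]mx11_scalar tr_scalar_mx.
move=> /eqP; rewrite -addr_eq0 -mulr2n -scaler_nat scaler_eq0 pnatr_eq0 /=.
by move/eqP.
Qed.

Lemma symplectic_dim_le p (C : 'M[R]_(d, p + p)) :
  C^T *m S *m C = J_mx p -> (p + p <= d)%N.
Proof.
move=> H; have := J_mx_unit p; rewrite -H -row_full_unit => /eqP rk.
by rewrite -[X in (X <= _)%N]rk; apply: leq_trans (mxrankM_maxr _ _) (rank_leq_row _).
Qed.

(** Some [x] is [S]-orthogonal to the columns of [C] for reasons of dimension. A partner [y0] of [x]
    is made orthogonal to [C] by the symplectic projection, whose sign comes from [J^-1 = - J]. *)
Lemma symplectic_extend p (C : 'M[R]_(d, p + p)) : (p + p < d)%N ->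
  C^T *m S *m C = J_mx p ->
  exists C' : 'M[R]_(d, (p + 1) + (p + 1)), C'^T *m S *m C' = J_mx (p + 1).
Proof.
move=> pd CSC.
have [x x0 Cx] : exists2 x : 'cV[R]_d, x != 0 & C^T *m S *m x = 0.
  have : kermx (C^T *m S)^T != 0.
    rewrite -mxrank_eq0 mxrank_ker subn_eq0 -ltnNge.
    by apply: leq_ltn_trans (rank_leq_col _) pd.
  move=> /rowV0Pn[z /sub_kermxP zk z0]; exists z^T.
    by rewrite -trmx0 (inj_eq trmx_inj).
  by apply: trmx_inj; rewrite trmx_mul trmxK zk trmx0.
pose w := x^T *m S.
have fw : row_free w.
  apply: inj_row_free => c; rewrite [c]mx11_scalar mul_scalar_mx => /eqP.
  rewrite scaler_eq0 => /orP[/eqP ->|/eqP w0]; first by rewrite raddf0.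
  move/negP: x0; case; rewrite -(inj_eq trmx_inj) trmx0.
  by rewrite -[x^T](mulmxK Sunit) -/w w0 mul0mx.
pose y0 := w^T *m invmx (w *m w^T).
have wy0 : w *m y0 = 1%:M by rewrite mulmxA mulmxV// gram_unit.
pose y := y0 + C *m (J_mx p *m (C^T *m S *m y0)).
have xC : x^T *m S *m C = 0.
  by apply: trmx_inj; rewrite form_tr Cx oppr0 trmx0.
have Cy : C^T *m S *m y = 0.
  by rewrite /y mulmxDr (mulmxA _ C) CSC mulmxA J_mxK mulNmx mul1mx addrN.
have xy : x^T *m S *m y = 1%:M.
  by rewrite /y mulmxDr (mulmxA _ C) xC mul0mx addr0.
have yx : y^T *m S *m x = - 1%:M.
  by apply: trmx_inj; rewrite form_tr xy linearN /= trmx1.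
have yC : y^T *m S *m C = 0.
  by apply: trmx_inj; rewrite form_tr Cy oppr0 trmx0.
set C1 := lsubmx C; set C2 := rsubmx C.
have CE : C = row_mx C1 C2 by rewrite hsubmxK.
have split2 m1 m2 (X1 X2 : 'M[R]_(d, m1)) (Y1 Y2 : 'M[R]_(d, m2)) :
    (row_mx X1 X2)^T *m S *m row_mx Y1 Y2 =
    block_mx (X1^T *m S *m Y1) (X1^T *m S *m Y2) (X2^T *m S *m Y1) (X2^T *m S *m Y2).
  by rewrite tr_row_mx mul_col_mx mul_col_row.
have split1 m1 m2 m3 m4 (X1 : 'M[R]_(d, m1)) (X2 : 'M[R]_(d, m2))
    (Y1 : 'M[R]_(d, m3)) (Y2 : 'M[R]_(d, m4)) :
    (row_mx X1 X2)^T *m S *m row_mx Y1 Y2 =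
    block_mx (X1^T *m S *m Y1) (X1^T *m S *m Y2) (X2^T *m S *m Y1) (X2^T *m S *m Y2).
  by rewrite tr_row_mx mul_col_mx mul_col_row.
have [c11 c12 c21 c22] : [/\ C1^T *m S *m C1 = 0, C1^T *m S *m C2 = 1%:M,
    C2^T *m S *m C1 = - 1%:M & C2^T *m S *m C2 = 0].
  by move: CSC; rewrite CE split2 /J_mx => /eq_block_mx[].
have colx (z : 'cV[R]_d) : C^T *m S *m z = 0 ->
    C1^T *m S *m z = 0 /\ C2^T *m S *m z = 0.
  rewrite CE tr_row_mx !mul_col_mx -[X in _ = X -> _]vsubmxK.
  by rewrite !linear0 => /eq_col_mx.
have rowx (z : 'cV[R]_d) : z^T *m S *m C = 0 ->
    z^T *m S *m C1 = 0 /\ z^T *m S *m C2 = 0.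
  rewrite CE mul_mx_row -[X in _ = X -> _]hsubmxK.
  by rewrite !linear0 => /eq_row_mx.
have [c1x c2x] := colx x Cx; have [c1y c2y] := colx y Cy.
have [xc1 xc2] := rowx x xC; have [yc1 yc2] := rowx y yC.
exists (row_mx (row_mx C1 x) (row_mx C2 y)).
rewrite split2 !split1 c11 c12 c21 c22 c1x c2x c1y c2y xc1 xc2 yc1 yc2 xy yx.
rewrite !form_diag /J_mx !scalar_mx_block opp_block_mx !oppr0.
by congr block_mx; rewrite -[RHS](@block_mx0 _ p 1 p 1).
Qed.

(** The parity of [d] comes out here: while [p + p < d] another pair fits, so extension can end only
    at [d = p + p], and [d.+1] rounds suffice because [p + p <= d] throughout. *)
Lemma skew_normal_form : exists p (C : 'M[R]_(d, p + p)),
  d = (p + p)%N /\ C^T *m S *m C = J_mx p.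
Proof.
suff /(_ d.+1) [p [C [CSC [dp|dp]]]] : forall k, exists p (C : 'M[R]_(d, p + p)),
    C^T *m S *m C = J_mx p /\ (d = (p + p)%N \/ (k <= p)%N).
- by exists p, C.
- have := symplectic_dim_le CSC; lia.
elim=> [|k [p [C [CSC [dp|kp]]]]].
- exists 0%N, (0 : 'M[R]_(d, 0 + 0)); split; last by right.
  by apply/matrixP => -[].
- by exists p, C; split=> //; left.
have := symplectic_dim_le CSC; rewrite leq_eqVlt => /orP[/eqP dp|pd].
  by exists p, C; split=> //; left.
have [C' CSC'] := symplectic_extend pd CSC.
by exists (p + 1)%N, C'; split=> //; right; rewrite addn1.
Qed.

End Skew.

(** The change of basis [G] is built by explicit formulas, so that it inherits smoothness: only
    products and inverse roots of positive functions occur. *)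
Lemma gram_schmidt (J : set R) k n m (U : R -> 'M[R]_(n, m)) :
  msmooth J k U -> (forall t, J t -> row_free (U t)^T) ->
  exists2 G : R -> 'M[R]_m, msmooth J k G &
    forall t, J t -> (U t *m G t)^T *m (U t *m G t) = 1%:M.
Proof.
elim: m U => [|m IH] U sU fU.
  exists (fun=> 0); first exact: msmooth_cst.
  by move=> t _; apply/matrixP => -[].
pose u t : 'cV[R]_n := lsubmx (U t : 'M[R]_(n, 1 + m)).
pose U' t : 'M[R]_(n, m) := rsubmx (U t : 'M[R]_(n, 1 + m)).
have UE t : U t = row_mx (u t) (U' t) by rewrite hsubmxK.
have su : msmooth J k u by exact: (@msmooth_lsubmx _ _ _ _ 1 m).
have sU' : msmooth J k U' by exact: (@msmooth_rsubmx _ _ _ _ 1 m).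
pose q t := ((u t)^T *m u t) 0 0.
have q0 t : J t -> 0 < q t.
  move=> Jt; rewrite lt_def; apply/andP; split; last first.
    by rewrite /q mxE sumr_ge0// => i _; rewrite mxE -expr2 sqr_ge0.
  apply/negP => /eqP qt; have : (u t)^T = 0.
    by apply: mulmx_tr_eq0; rewrite trmxK [LHS]mx11_scalar -/(q t) qt raddf0.
  move=> ut; have : row_mx 1%:M 0 *m (U t : 'M[R]_(n, 1 + m))^T = 0.
    by rewrite UE tr_row_mx mul_row_col ut mulmx0 mul0mx addr0.
  move=> /(row_free_mul0 (fU t Jt)) /(congr1 (@lsubmx _ 1 1 m)).
  rewrite row_mxKl => /matrixP/(_ 0 0).
  by rewrite !mxE eqxx => /eqP; rewrite oner_eq0.
have sq : smooth J k q by exact: (msmoothM (msmooth_tr su) su).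
pose c t := (Num.sqrt (q t))^-1.
have sc : smooth J k c.
  apply: smoothV; last exact: smooth_sqrt.
  by move=> t /q0 ?; rewrite gt_eqF// sqrtr_gt0.
pose v t := c t *: u t.
have sv : msmooth J k v by exact: msmoothZ.
have vv t : J t -> (v t)^T *m v t = 1%:M.
  move=> Jt; rewrite /v [(_ *: _)^T]linearZ /= -scalemxAl -scalemxAr scalerA.
  rewrite [_ *m _]mx11_scalar.
  rewrite -/(q t) scale_scalar_mx -expr2 /c exprVn sqr_sqrtr ?mulVf//.
    by rewrite gt_eqF// q0.
  by rewrite ltW// q0.
pose W t := U' t - v t *m ((v t)^T *m U' t).
have sW : msmooth J k W.
  apply: msmoothB => //; apply: msmoothM => //; apply: msmoothM => //.
  exact: msmooth_tr.
have fW t : J t -> row_free (W t)^T.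
  move=> Jt; apply: inj_row_free => x; rewrite /W linearB /= mulmxBr.
  rewrite !trmx_mul trmxK => /eqP; rewrite subr_eq0 => /eqP H.
  pose y := x *m (U' t)^T *m v t.
  have : row_mx (- (c t *: y)) x *m (U t : 'M[R]_(n, 1 + m))^T = 0.
    rewrite UE tr_row_mx mul_row_col H mulNmx -scalemxAl scalemxAr.
    by rewrite -linearZ /= -/(v t) /y !mulmxA addNr.
  move=> /(row_free_mul0 (fU t Jt)) /(congr1 (@rsubmx _ 1 1 m)).
  by rewrite row_mxKr => ->; apply/matrixP => i j; rewrite !mxE.
have [G' sG' HG'] := IH W sW fW.
exists (fun t => block_mx (c t)%:M (- (c t *: ((v t)^T *m U' t *m G' t))) 0 (G' t)).
  apply: (@msmooth_col_mx _ _ _ 1 m (1 + m)); apply: (@msmooth_row_mx _ _ _ _ 1 m) => //.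
  - by move=> i j; apply: (eq_smooth _ sc) => t _; rewrite !ord1 mxE.
  - apply: msmoothN; apply: msmoothZ => //; apply: msmoothM => //.
    by apply: msmoothM => //; exact: msmooth_tr.
  - exact: msmooth_cst.
move=> t Jt.
have E0 : row_mx (u t) (U' t) *m
    block_mx (c t)%:M (- (c t *: ((v t)^T *m U' t *m G' t))) 0 (G' t)
    = row_mx (v t) (W t *m G' t).
  rewrite mul_row_block mul_mx_scalar mulmx0 addr0; congr row_mx.
  rewrite mulmxN -scalemxAr scalemxAl -/(v t) /W mulmxBl addrC.
  by rewrite !mulmxA.
have vW : (v t)^T *m W t = 0.
  by rewrite /W mulmxBr (mulmxA _ (v t)) vv// mul1mx subrr.
have E1 : (row_mx (v t) (W t *m G' t))^T *m row_mx (v t) (W t *m G' t) =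
    1%:M :> 'M[R]_(1 + m).
  rewrite tr_row_mx mul_col_row vv// HG'// mulmxA vW mul0mx.
  have -> : (W t *m G' t)^T *m v t = 0.
    by apply: trmx_inj; rewrite trmx_mul trmxK mulmxA vW mul0mx trmx0.
  by rewrite -(@scalar_mx_block _ 1 m).
by rewrite UE; move: E1; rewrite -E0.
Qed.

End SkewForms.

(** * Orthonormal frames of the restricted class *)

Section Frame.
Context {R : realType}.

Lemma columns_span_kerI m n d (V : 'M[R]_(n, d)) (B : 'M[R]_(m, n)) :
  B *m V = 0 -> \rank V = d -> (d + \rank B)%N = n -> columns_span_ker V B.
Proof.
move=> BV rV dn; rewrite /columns_span_ker.
have sub : (V^T <= kermx B^T)%MS by apply/sub_kermxP; rewrite -trmx_mul BV trmx0.
rewrite -(geq_leqif (mxrank_leqif_eq sub)) mxrank_ker !mxrank_tr rV.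
by rewrite leq_subLR addnC dn.
Qed.

Lemma columns_span_kerP m n d p (V : 'M[R]_(n, d)) (B : 'M[R]_(m, n))
    (X : 'M[R]_(n, p)) :
  columns_span_ker V B -> B *m X = 0 -> exists Y, X = V *m Y.
Proof.
move=> /eqmxP VB BX; have : (X^T <= V^T)%MS.
  by rewrite VB; apply/sub_kermxP; rewrite -trmx_mul BX trmx0.
move=> /submxP[Y XY]; exists Y^T; apply: trmx_inj.
by rewrite trmx_mul trmxK.
Qed.

Section RestrictedFrame.
Variables (n p s : nat) (J : set R) (E : R -> 'M[R]_n) (U : R -> 'M[R]_(n, p + p)).
Hypothesis sE : msmooth J s E.
Hypothesis Eskew : forall t, J t -> (E t)^T = - E t.
Hypothesis sU : msmooth J s U.
Hypothesis UEU : forall t, J t -> (U t)^T *m E t *m U t = J_mx p.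

Let row_free_UT t : J t -> row_free (U t)^T.
Proof.
move=> Jt; apply: inj_row_free => c cU.
rewrite -[c](mulmxK (J_mx_unit p)) -(UEU Jt) !mulmxA cU.
by rewrite !mul0mx.
Qed.

Let U1 t : 'M[R]_(n, p) := lsubmx (U t).
Let U2 t : 'M[R]_(n, p) := rsubmx (U t).
Let UE t : U t = row_mx (U1 t) (U2 t). Proof. by rewrite hsubmxK. Qed.

Let UEU_blocks t : J t -> [/\ (U1 t)^T *m E t *m U1 t = 0,
  (U1 t)^T *m E t *m U2 t = 1%:M, (U2 t)^T *m E t *m U1 t = - 1%:M &
  (U2 t)^T *m E t *m U2 t = 0].
Proof.
move=> Jt; have := UEU Jt.
by rewrite UE tr_row_mx mul_col_mx mul_col_row /J_mx => /eq_block_mx[].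
Qed.

Let gram_unitr m q (X : 'M[R]_(m, q)) (G : 'M[R]_q) :
  (X *m G)^T *m (X *m G) = 1%:M -> G \in unitmx.
Proof. by rewrite mulmxA => /mulmx1_unit[]. Qed.

(* Orthonormalizing the Lagrangian half [U2] first makes the lower right block of
   [V^T E V] vanish, so that [W2^T (V^T E V) W2 = J] can be solved explicitly. *)
Lemma restricted_frame : exists (V : R -> 'M[R]_(n, p + p)) (G : R -> 'M[R]_(p + p))
    (K21 K22 : R -> 'M[R]_p),
  [/\ msmooth J s V, msmooth J s K21, msmooth J s K22 &
   forall t, J t -> [/\ (V t)^T *m V t = 1%:M, V t = U t *m G t,
     K22 t \in unitmx &
     (V t *m block_mx 1%:M 0 (K21 t) (K22 t))^T *m E t *m
       (V t *m block_mx 1%:M 0 (K21 t) (K22 t)) = J_mx p]].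
Proof.
have sU1 : msmooth J s U1 by exact: msmooth_lsubmx.
have sU2 : msmooth J s U2 by exact: msmooth_rsubmx.
have fU2 t : J t -> row_free (U2 t)^T.
  move=> Jt; apply: inj_row_free => c cU.
  have : row_mx 0 c *m (U t)^T = 0.
    by rewrite UE tr_row_mx mul_row_col mul0mx add0r.
  by move=> /(row_free_mul0 (row_free_UT Jt)); rewrite -row_mx0 => /eq_row_mx[].
have [G2 sG2 HG2] := gram_schmidt sU2 fU2.
have [V2 V2E] : exists V2, forall t, V2 t = U2 t *m G2 t by eexists.
have {}HG2 t : J t -> (V2 t)^T *m V2 t = 1%:M by rewrite V2E; exact: HG2.
have sV2 : msmooth J s V2.
  by apply: eq_msmooth (msmoothM sU2 sG2) => t _; rewrite V2E.
pose W t := U1 t - V2 t *m ((V2 t)^T *m U1 t).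
have sW : msmooth J s W.
  by apply: msmoothB => //; apply: msmoothM => //; apply: msmoothM => //; exact: msmooth_tr.
have fW t : J t -> row_free (W t)^T.
  move=> Jt; apply: inj_row_free => x; rewrite /W linearB /= mulmxBr.
  rewrite !trmx_mul trmxK => /eqP; rewrite subr_eq0 => /eqP H.
  have : row_mx x (- (x *m (U1 t)^T *m V2 t *m (G2 t)^T)) *m (U t)^T = 0.
    have V2T : (V2 t)^T = (G2 t)^T *m (U2 t)^T by rewrite V2E trmx_mul.
    rewrite UE tr_row_mx mul_row_col [X in X + _]H mulNmx.
    by rewrite -(mulmxA _ (G2 t)^T) -V2T !mulmxA addrN.
  by move=> /(row_free_mul0 (row_free_UT Jt)); rewrite -row_mx0 => /eq_row_mx[].
have [G1 sG1 HG1] := gram_schmidt sW fW.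
have [V1 V1E] : exists V1, forall t, V1 t = W t *m G1 t by eexists.
have {}HG1 t : J t -> (V1 t)^T *m V1 t = 1%:M by rewrite V1E; exact: HG1.
have sV1 : msmooth J s V1.
  by apply: eq_msmooth (msmoothM sW sG1) => t _; rewrite V1E.
have uG1 t : J t -> G1 t \in unitmx by move=> /HG1; rewrite V1E; exact: gram_unitr.
have uG2 t : J t -> G2 t \in unitmx by move=> /HG2; rewrite V2E; exact: gram_unitr.
pose S11 t := (V1 t)^T *m E t *m V1 t.
pose S12 t := (V1 t)^T *m E t *m V2 t.
have S22 t : J t -> (V2 t)^T *m E t *m V2 t = 0.
  move=> Jt; have [_ _ _ u22] := UEU_blocks Jt.
  rewrite V2E trmx_mul -[(G2 t)^T *m _ *m _]mulmxA -(mulmxA (G2 t)^T).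
  by rewrite (mulmxA _ (U2 t)) u22 mul0mx mulmx0.
(* [W] differs from [U1] by combinations of the columns of the isotropic [U2], so [W^T E U2] is
   still the identity and [S12] is a product of invertible factors. *)
have S12E t : J t -> S12 t = (G1 t)^T *m G2 t.
  move=> Jt; have [_ u12 _ u22] := UEU_blocks Jt.
  have WU : (W t)^T *m E t *m U2 t = 1%:M.
    rewrite /W linearB /= !mulmxBl u12 V2E !trmx_mul trmxK -!mulmxA.
    by rewrite (mulmxA _ (E t)) u22 !mulmx0 subr0.
  rewrite /S12 V1E V2E trmx_mul -[(G1 t)^T *m _ *m _]mulmxA -(mulmxA (G1 t)^T).
  by rewrite (mulmxA _ (U2 t)) WU mul1mx.
have uS12 t : J t -> S12 t \in unitmx.
  by move=> Jt; rewrite S12E// unitmx_mul unitmx_tr uG1// uG2.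
have sS12 : msmooth J s S12.
  by apply: msmoothM => //; apply: msmoothM => //; exact: msmooth_tr.
have sS11 : msmooth J s S11.
  by apply: msmoothM => //; apply: msmoothM => //; exact: msmooth_tr.
have S21 t : J t -> (V2 t)^T *m E t *m V1 t = - (S12 t)^T.
  by move=> Jt; rewrite /S12 !trmx_mul trmxK Eskew// mulNmx mulmxN opprK mulmxA.
have S11T t : J t -> (S11 t)^T = - S11 t.
  by move=> Jt; rewrite /S11 !trmx_mul trmxK Eskew// mulNmx mulmxN mulmxA.
(* [V^T E V] has the blocks [S11], [S12], [- S12^T] and 0, so the requirement reads [S12 K22 = 1]
   and [S11 + S12 K21 - (S12 K21)^T = 0]. As [S11] is skew, [S12 K21 = - S11 / 2] solves the
   latter. *)
pose K22 t := invmx (S12 t).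
pose K21 t := (- 2^-1) *: (K22 t *m S11 t).
have sK22 : msmooth J s K22 by exact: msmooth_inv.
exists (fun t => row_mx (V1 t) (V2 t)),
  (fun t => block_mx (G1 t) 0 (- (G2 t *m ((V2 t)^T *m U1 t) *m G1 t)) (G2 t)), K21, K22.
split=> //; first exact: msmooth_row_mx.
  apply: msmoothZ; first exact: smooth_cst.
  exact: msmoothM.
move=> t Jt; split.
- have V2W : (V2 t)^T *m W t = 0.
    by rewrite /W mulmxBr (mulmxA _ (V2 t)) HG2// mul1mx subrr.
  have V21 : (V2 t)^T *m V1 t = 0 by rewrite V1E mulmxA V2W mul0mx.
  rewrite tr_row_mx mul_col_row HG1// HG2// V21.
  have -> : (V1 t)^T *m V2 t = 0 by apply: trmx_inj; rewrite trmx_mul trmxK V21 trmx0.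
  by rewrite -scalar_mx_block.
- rewrite UE mul_row_block mulmx0 add0r; congr row_mx; last exact: V2E.
  by rewrite V1E /W mulmxBl mulmxN V2E !mulmxA.
- by rewrite /K22 unitmx_inv uS12.
have S12K22 : S12 t *m K22 t = 1%:M by rewrite mulmxV// uS12.
have S12K21 : S12 t *m K21 t = (- 2^-1) *: S11 t.
  by rewrite -scalemxAr mulmxA S12K22 mul1mx.
have K22S : (K22 t)^T *m (S12 t)^T = 1%:M by rewrite -trmx_mul S12K22 trmx1.
have K21S : (K21 t)^T *m (S12 t)^T = 2^-1 *: S11 t.
  by rewrite -trmx_mul S12K21 linearZ /= S11T// scaleNr scalerN opprK.
rewrite trmx_mul -[X in X *m _]mulmxA -[LHS]mulmxA.
rewrite [_ *m (_ *m block_mx _ _ _ _)](_ : _ =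
    block_mx (2^-1 *: S11 t) 1%:M (- (S12 t)^T) 0); last first.
  rewrite mulmxA tr_row_mx mul_col_mx mul_col_row -/(S11 t) -/(S12 t) S21// S22//.
  rewrite mulmx_block !mulmx1 !mulmx0 !mul0mx S12K21 S12K22 !add0r addr0.
  congr block_mx.
  rewrite -[X in X + _]scale1r -scalerDl; congr (_ *: _); lra.
rewrite tr_block_mx mulmx_block trmx1 trmx0 !(mul1mx, mul0mx, mulmx0, mulmxN).
by rewrite K21S K22S subrr !(addr0, add0r).
Qed.

End RestrictedFrame.
End Frame.

(** * The inherent equation *)

Section InherentODE.
Context {R : realType}.
Variables (s n mu a : nat) (tl tr : R) (E A : R -> 'M[R]_n) (f : R -> 'cV[R]_n).
Hypothesis tlr : tl < tr.
Local Notation I := (`[tl, tr]%classic : set R).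
Local Notation rho := (s + (2 + mu + mu.+1 * mu) + mu)%N.
Hypothesis s0 : (0 < s)%N.
Hypothesis sE : msmooth I rho E.
Hypothesis sA : msmooth I rho A.
Hypothesis sf : msmooth I rho f.
Hypothesis sadj : self_adjoint I E A.

Lemma symplectic_frame d (Z2 : R -> 'M[R]_(\sum_(i < mu.+1) n, a))
    (K Z1 : R -> 'M[R]_(n, d)) : hypH_with I s E A Z2 K Z1 ->
  exists p (U : R -> 'M[R]_(n, p + p)), [/\ d = (p + p)%N, msmooth I s U,
    forall t, I t -> (U t)^T *m E t *m U t = J_mx p &
    forall t, I t -> hatA2 I A Z2 t *m U t = 0].
Proof.
move=> HH; have It := itv_left tlr.
have sK : msmooth I s K by apply/(Ck_msmooth tlr); case: HH.
have uS := form_nondegenerate tlr s0 sE sA HH sadj It.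
have sB := msmooth_reduced_matrix tlr s0 sE sA HH.
have [Psi [dPsi Psi0 uPsi sPsi]] := ex_fundamental_matrix tlr It sB.
have [Y' dY EY] := reduced_solution tlr s0 sE sA HH dPsi.
have skew : ((K tl)^T *m E tl *m K tl)^T = - ((K tl)^T *m E tl *m K tl).
  by rewrite !trmx_mul trmxK (sadj It).1 mulNmx mulmxN mulmxA.
have [p [C [dp CSC]]] := skew_normal_form skew uS.
exists p, (fun t => K t *m Psi t *m C); split=> //.
(* The flow regains the derivative that [K] loses in [reduced_matrix], so the frame is of class
   [C^s]. *)
- apply: msmoothM; last exact: msmooth_cst.
  by apply: msmoothM => //; rewrite prednK// in sPsi.
- move=> t Jt; have := form_cst tlr s0 sE sadj dY EY Jt It.
  rewrite Psi0 mulmx1 => F; rewrite -CSC -F trmx_mul.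
  by rewrite !mulmxA.
- by move=> t Jt; rewrite !mulmxA (A2K HH Jt) !mul0mx.
Qed.

Section Frame.
Variables (d p : nat) (Z2 : R -> 'M[R]_(\sum_(i < mu.+1) n, a)).
Variables (K Z1 : R -> 'M[R]_(n, d)).
Hypothesis HH : hypH_with I s E A Z2 K Z1.
Hypothesis dp : d = (p + p)%N.
Local Notation A2 := (hatA2 I A Z2).
Variables (T2 : R -> 'M[R]_(n, p + p)) (T2' : R -> 'M[R]_(n, a)).
Hypothesis sT2 : msmooth I s T2.
Hypothesis sT2' : msmooth I s T2'.
Hypothesis A2T2 : forall t, I t -> A2 t *m T2 t = 0.
Hypothesis T2ET2 : forall t, I t -> (T2 t)^T *m E t *m T2 t = J_mx p.
Hypothesis A2T2' : forall t, I t -> A2 t *m T2' t \in unitmx.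
Local Notation T2d := (deriveI I T2).
Local Notation T2d' := (deriveI I T2').

(* Since [T2^T E T2 = J], these are the solutions of [E T2 X = A T2 - E T2'] and of
   its inhomogeneous analogue; they do not mention [Z1]. *)
Definition ode_matrix (t : R) : 'M[R]_(p + p) :=
  - J_mx p *m ((T2 t)^T *m (A t *m T2 t - E t *m T2d t)).

Local Notation h := (elimh I A f Z2 T2').
Local Notation hd := (deriveI I h).

Definition ode_source (t : R) : 'cV[R]_(p + p) :=
  - J_mx p *m ((T2 t)^T *m (f t + A t *m (T2' t *m h t)
    - E t *m (T2d' t *m h t + T2' t *m hd t))).

Let rank_T2 t : I t -> \rank (T2 t) = (p + p)%N.
Proof.
move=> It; apply/eqP; rewrite eqn_leq rank_leq_col /=.
have := @J_mx_unit R p; rewrite -(T2ET2 It) -row_full_unit => /eqP rk.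
by rewrite -[X in (X <= _)%N]rk mxrankM_maxr.
Qed.

Let dT2 : mderiv I T2 T2d.
Proof. by apply: (@mderiv_deriveI _ _ _ tlr 0); apply: msmooth_le sT2. Qed.

Let dT2' : mderiv I T2' T2d'.
Proof. by apply: (@mderiv_deriveI _ _ _ tlr 0); apply: msmooth_le sT2'. Qed.

Lemma hatf2_jet t : hatf2 I f Z2 t = jet tl tr Z2 f t.
Proof. by rewrite /hatf2 -pack_Zblk pack_stacked. Qed.

Lemma msmooth_elimh : msmooth I s h.
Proof.
apply: msmoothN; apply: msmoothM.
  apply: msmooth_inv => //; apply: msmoothM => //.
  exact: (msmooth_A2 tlr s0 sA HH).
apply: msmoothM; first by apply: msmooth_tr; apply/(Ck_msmooth tlr); case: HH.
by apply: msmooth_stacked => //; apply: msmooth_le sf; lia.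
Qed.

Let dh : mderiv I h hd.
Proof. by apply: (@mderiv_deriveI _ _ _ tlr 0); apply: msmooth_le msmooth_elimh. Qed.

(** [T2] and [K] span the same kernel, so [E T2] and [E K] have the same range; on it [T2^T] reads
    off the coordinates up to the factor [J]. *)
Let range_T2 q t (X : 'M[R]_(n, q)) : I t -> Eproj E K Z1 t *m X = 0 ->
  X = E t *m T2 t *m (- J_mx p *m ((T2 t)^T *m X)).
Proof.
move=> It PX.
have spanT2 : columns_span_ker (T2 t) (A2 t).
  apply: columns_span_kerI; rewrite ?A2T2 ?rank_T2//.
  by rewrite (hypH_rankA2 HH)// -dp (hypH_dim HH).
have [G KG] := columns_span_kerP spanT2 (A2K HH It).
have [Y XY] : exists Y, X = E t *m T2 t *m Y.
  have := Eproj0_range PX; set Q := invmx _ *m _ => XE.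
  by exists (G *m Q); rewrite {1}XE KG !mulmxA.
have -> : (T2 t)^T *m X = J_mx p *m Y by rewrite XY !mulmxA T2ET2.
by rewrite (mulmxA (- _)) mulNmx J_mxK opprK mul1mx.
Qed.

Lemma ode_matrixE t : I t ->
  A t *m T2 t - E t *m T2d t = E t *m T2 t *m ode_matrix t.
Proof.
move=> It; apply: range_T2 => //.
rewrite -[A t *m T2 t]add0r.
apply: (residual tlr s0 sE sA HH (F := fun=> 0) (X := T2) (X' := T2d)) => //.
  exact: msmooth_cst.
by move=> u Iu; rewrite A2T2// jet0// oppr0.
Qed.

(** [T2' h] is a particular solution of the algebraic constraint, so that [residual] applies to
    it. *)
Lemma ode_sourceE t : I t ->
  f t + A t *m (T2' t *m h t) - E t *m (T2d' t *m h t + T2' t *m hd t) =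
  E t *m T2 t *m ode_source t.
Proof.
move=> It; apply: range_T2 => //.
apply: (residual tlr s0 sE sA HH (F := f) (X := fun t => T2' t *m h t)
  (X' := fun t => T2d' t *m h t + T2' t *m hd t)) => //.
- by apply: msmooth_le sf; lia.
- exact: mderivM.
- move=> u Iu; rewrite /elimh mulmxN mulmxN mulmxA mulmxA mulmxV ?A2T2'//.
  by rewrite mul1mx hatf2_jet.
Qed.

(** Other witnesses change [Z2^T] by an invertible left factor [C], which cancels in [elimh], while
    [elimG] is 0 since [A2 T2 = 0]. Both sides of the projected equation then carry the factor
    [Z1b^T E T2], and cancelling it leaves matrices independent of the witnesses. *)
Lemma inherent_ode_frame (Z2b : R -> 'M[R]_(\sum_(i < mu.+1) n, a))
    (Kb Z1b : R -> 'M[R]_(n, p + p)) :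
  hypH_with I s E A Z2b Kb Z1b ->
  (forall t, I t -> hatA2 I A Z2b t *m T2 t = 0) /\
  (forall t, I t -> hatA2 I A Z2b t *m T2' t \in unitmx) /\
  inherent_ode I E A f Z2b Z1b T2 T2' ode_matrix ode_source.
Proof.
move=> HHb.
have sEmu : msmooth I mu E by apply: msmooth_le sE; lia.
have sAmu : msmooth I mu A by apply: msmooth_le sA; lia.
have CZ t : I t -> exists2 C : 'M[R]_a, C \in unitmx & (Z2b t)^T = C *m (Z2 t)^T.
  move=> It; have := left_kernel_M tlr HH It (hypH_Z2_null HHb It).
  move=> /submxP[C ZC]; exists C => //; rewrite -row_free_unit /row_free.
  by rewrite -(mxrankMfree _ (row_free_Z2T HH It)) -ZC mxrank_tr (hypH_Z2_rank HHb).
have CA2 t C : (Z2b t)^T = C *m (Z2 t)^T -> hatA2 I A Z2b t = C *m A2 t.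
  by move=> ZC; rewrite /hatA2 ZC mulmxA.
have Cf2 t C : (Z2b t)^T = C *m (Z2 t)^T -> hatf2 I f Z2b t = C *m hatf2 I f Z2 t.
  by move=> ZC; rewrite /hatf2 ZC mulmxA.
have A2bT2 t : I t -> hatA2 I A Z2b t *m T2 t = 0.
  by move=> It; have [C uC ZC] := CZ t It; rewrite (CA2 t C)// -mulmxA A2T2// mulmx0.
have uA2b t : I t -> hatA2 I A Z2b t *m T2' t \in unitmx.
  move=> It; have [C uC ZC] := CZ t It.
  by rewrite (CA2 t C)// -mulmxA unitmx_mul uC A2T2'.
split=> //; split=> // t It.
have G0 u : I u -> elimG I A Z2b T2 T2' u = 0.
  by move=> Iu; rewrite /elimG A2bT2// mulmx0 oppr0.
have dG0 : deriveI I (elimG I A Z2b T2 T2') t = 0.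
  apply: (mderiv_deriveI_eq tlr (G := fun=> 0)) It.
  by apply: (eq_mderiv _ _ (@mderiv_cst _ _ _ _ 0)) => // u Iu; rewrite G0.
have hE u : I u -> elimh I A f Z2b T2' u = h u.
  move=> Iu; have [C uC ZC] := CZ u Iu.
  rewrite /elimh (CA2 u C)// (Cf2 u C)// -(mulmxA C).
  rewrite -{1}[hatf2 I f Z2 u](mulKVmx (A2T2' Iu)) (mulmxA C (A2 u *m T2' u)).
  rewrite mulKmx//.
  by rewrite unitmx_mul uC A2T2'.
have dhE : deriveI I (elimh I A f Z2b T2') t = hd t.
  apply: (mderiv_deriveI_eq tlr (G := hd)) It.
  by apply: (eq_mderiv _ _ dh) => // u Iu; rewrite hE.
have NE : Defs.elimN I E A Z2b Z1b T2 T2' t = (Z1b t)^T *m E t *m T2 t.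
  by rewrite /Defs.elimN (G0 t It) (mulmx0 _ (hatE1 E Z1b t *m T2' t)) addr0.
have uN : (Z1b t)^T *m E t *m T2 t \in unitmx.
  have [G TG] := columns_span_kerP (hypH_K_ker HHb It) (A2bT2 t It).
  rewrite TG mulmxA unitmx_mul (Z1EK_unit HHb It) -row_full_unit.
  have := rank_T2 It; rewrite TG => rk.
  by rewrite /row_full eqn_leq rank_leq_row -[X in (X <= _)%N]rk mxrankM_maxr.
split; [exact: uA2b|by rewrite NE|rewrite NE|rewrite NE].
- have -> : elimB I E A Z2b Z1b T2 T2' t =
      (Z1b t)^T *m (A t *m T2 t - E t *m T2d t).
    rewrite /elimB (G0 t It) dG0 (mulmx0 _ (_ - _)) (mulmx0 _ (_ *m T2' t)).
    by rewrite addr0 subr0 /hatA1 /hatE1 mulmxBr !(mulmxA (Z1b t)^T).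
  rewrite (ode_matrixE It).
  by rewrite (mulmxA (Z1b t)^T) (mulmxA (Z1b t)^T) mulKmx.
- rewrite /elimb dhE (hE t It) /hatA1 /hatE1 /hatf1.
  have -> : (Z1b t)^T *m f t + ((Z1b t)^T *m A t *m T2' t
      - (Z1b t)^T *m E t *m T2d' t) *m h t - (Z1b t)^T *m E t *m T2' t *m hd t =
      (Z1b t)^T *m (f t + A t *m (T2' t *m h t)
        - E t *m (T2d' t *m h t + T2' t *m hd t)).
    rewrite mulmxBr mulmxDr mulmxDr mulmxDr mulmxBl opprD.
    by rewrite !(mulmxA (Z1b t)^T) !(mulmxA _ (T2' t)) !(mulmxA _ (T2d' t)) !addrA.
  by rewrite (ode_sourceE It) (mulmxA (Z1b t)^T) (mulmxA (Z1b t)^T) mulKmx.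
Qed.

Lemma msmooth_ode_matrix : msmooth I 0 ode_matrix.
Proof.
have sT : msmooth I 0 T2 by apply: msmooth_le sT2.
have sE0 : msmooth I 0 E by apply: msmooth_le sE.
have sA0 : msmooth I 0 A by apply: msmooth_le sA.
apply: msmoothM; first exact: msmooth_cst.
apply: msmoothM; first exact: msmooth_tr.
apply: msmoothB; first exact: msmoothM.
apply: msmoothM => //; apply: msmooth_deriveI => //.
exact: msmooth_le sT2.
Qed.

Lemma ode_matrix_hamiltonian t : I t ->
  (ode_matrix t)^T *m J_mx p + J_mx p *m ode_matrix t = 0.
Proof.
move=> It.
have dE : mderiv I E (deriveI I E).
  by apply: (@mderiv_deriveI _ _ _ tlr 0); apply: msmooth_le sE; lia.
have D := mderivM (mderivM (mderiv_tr dT2) dE) dT2.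
have D1 : deriveI I (fun t => (T2 t)^T *m E t *m T2 t) t = 0.
  apply: (mderiv_deriveI_eq tlr (G := fun=> 0)) It.
  by apply: (eq_mderiv _ _ (@mderiv_cst _ _ _ _ (J_mx p))) => // u Iu; rewrite T2ET2.
have [ET AT] := sadj It.
have EdT : E t *m T2d t = A t *m T2 t - E t *m T2 t *m ode_matrix t.
  by rewrite -ode_matrixE// opprB addrC subrK.
have dTE : (T2d t)^T *m E t = - ((T2 t)^T *m (A t + deriveI I E t))
    - (ode_matrix t)^T *m ((T2 t)^T *m E t).
  have -> : (T2d t)^T *m E t = - (E t *m T2d t)^T.
    by rewrite trmx_mul ET mulmxN opprK.
  rewrite EdT linearB /= (trmx_mul (A t)) (trmx_mul (E t *m T2 t)) (trmx_mul (E t)).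
  by rewrite AT ET opprB !mulmxN addrC.
(* In the derivative of [T2^T E T2 = J] both outer terms are replaced through [EdT] and [dTE]; the
   terms with [A] and [E'] cancel, and [- (M^T J + J M)] remains for [M] the matrix of the ODE. *)
have H := mderiv_deriveI_eq tlr D It; rewrite D1 dTE in H.
have e1 : (ode_matrix t)^T *m ((T2 t)^T *m E t) *m T2 t = (ode_matrix t)^T *m J_mx p.
  by rewrite -mulmxA T2ET2.
have e2 : (T2 t)^T *m E t *m T2d t =
    (T2 t)^T *m A t *m T2 t - J_mx p *m ode_matrix t.
  rewrite -(mulmxA _ (E t)) EdT mulmxBr !(mulmxA (T2 t)^T) T2ET2//.
apply/eqP; rewrite -oppr_eq0; apply/eqP; rewrite [RHS]H e2.
rewrite !mulmxDl !mulNmx e1 mulmxDr mulmxDl.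
set x := (T2 t)^T *m A t *m T2 t; set y := _ *m deriveI I E t *m T2 t.
set z := _ *m J_mx p; set w := J_mx p *m _.
by apply/matrixP => i j; rewrite !mxE; ring.
Qed.

Lemma symplectic_flow_ode_matrix : symplectic_flow I ode_matrix.
Proof.
move=> t0 It0; split.
  have [X [dX X0 _ _]] := ex_fundamental_matrix tlr It0 msmooth_ode_matrix.
  by exists X; split=> // t It; move/mderivP: dX; apply.
move=> Phi [Phi0 /mderivP dPhi] t It.
have D : mderiv I (fun t => (Phi t)^T *m J_mx p *m Phi t) (fun=> 0).
  apply: (eq_mderiv _ _ (mderivM (mderivM (mderiv_tr dPhi)
    (@mderiv_cst _ _ _ _ (J_mx p))) dPhi)) => // u Iu.
  move: (ode_matrix_hamiltonian Iu); move: (ode_matrix u) => M HM.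
  rewrite mulmx0 addr0 trmx_mul !mulmxA -mulmxDl -(mulmxA _ M^T).
  by rewrite -(mulmxA _ _ M) -mulmxDr HM mulmx0 mul0mx.
by rewrite (mderiv0_cst D It It0) Phi0 trmx1 mul1mx mulmx1.
Qed.

End Frame.
End InherentODE.

Theorem theorem4p2 (n mu a d s : nat) (hs : (0 < s)%N) :
  exists r : nat,
  forall (R : realType) (tl tr : R), tl < tr ->
  let I : set R := `[tl, tr]%classic in
  forall (E A : R -> 'M[R]_n) (f : R -> 'cV[R]_n),
  Ck I r E -> Ck I r A -> Ck I r f ->
  hypH I s mu a d E A ->
  self_adjoint I E A ->
  exists (p : nat) (hn : (p + p + a)%N = n)
    (T2 : R -> 'M[R]_(n, p + p)) (T2' : R -> 'M[R]_(n, a))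
    (At : R -> 'M[R]_(p + p)) (ft : R -> 'cV[R]_(p + p)),
  let Q : R -> 'M[R]_n :=
    fun t => castmx (erefl n, hn) (row_mx (T2 t) (T2' t)) in
  [/\ d = (2 * p)%N,
      Ck I s Q,
      forall t, I t -> Q t \in unitmx,
      forall (Z2 : R -> 'M[R]_(\sum_(i < mu.+1) n, a))
             (K Z1 : R -> 'M[R]_(n, p + p)),
        hypH_with I s E A Z2 K Z1 ->
        restricted_class I s E A Z2 T2 T2' /\
        inherent_ode I E A f Z2 Z1 T2 T2' At ft
    & symplectic_flow I At].
Proof.
exists (s + (2 + mu + mu.+1 * mu) + mu)%N => R tl tr tlr I E A f.
move=> /(Ck_msmooth tlr) sE /(Ck_msmooth tlr) sA /(Ck_msmooth tlr) sf.
move=> [Z2 [K [Z1 HH]]] sadj.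
have [p [U [dp sU UEU A2U]]] := symplectic_frame tlr hs sE sA sadj HH.
have sEs : msmooth I s E by apply: msmooth_le sE; lia.
have [V [G [K21 [K22 [sV sK21 sK22 HV]]]]] :=
  restricted_frame sEs (fun t It => (sadj t It).1) sU UEU.
have hn : (p + p + a)%N = n by rewrite -dp (hypH_dim HH).
pose W t := block_mx 1%:M 0 (K21 t) (K22 t) : 'M[R]_(p + p).
pose T2 t := V t *m W t.
(* With this completion [A2 T2'] is the Gram matrix of the independent rows of [A2]; other witnesses
   only multiply it by an invertible factor. *)
pose T2' t := (hatA2 I A Z2 t)^T.
have sA2 := msmooth_A2 tlr hs sA HH.
have sT2 : msmooth I s T2.
  apply: msmoothM => //; apply: msmooth_col_mx; apply: msmooth_row_mx => //.
    exact: msmooth_cst.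
  exact: msmooth_cst.
have sT2' : msmooth I s T2' by exact: msmooth_tr.
have A2V t : I t -> hatA2 I A Z2 t *m V t = 0.
  by move=> It; have [_ -> _ _] := HV t It; rewrite mulmxA A2U// mul0mx.
have A2T2 t : I t -> hatA2 I A Z2 t *m T2 t = 0.
  by move=> It; rewrite mulmxA A2V// mul0mx.
have T2ET2 t : I t -> (T2 t)^T *m E t *m T2 t = J_mx p.
  by move=> It; have [] := HV t It.
have A2T2' t : I t -> hatA2 I A Z2 t *m T2' t \in unitmx.
  by move=> It; apply: gram_unit; exact: (row_free_A2 HH It).
exists p, hn, T2, T2', (ode_matrix tl tr E A T2), (ode_source tl tr E A f Z2 T2 T2').
split.
- by rewrite dp mul2n addnn.
- apply/(Ck_msmooth tlr) => i j.
  have sQ := msmooth_row_mx sT2 sT2'.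
  apply: (eq_smooth _ (sQ i (cast_ord (esym hn) j))) => t It.
  by rewrite castmxE cast_ord_id.
- move=> t It.
  have T2free : row_free (row_mx (T2 t) (T2' t))^T.
    apply: inj_row_free => c; rewrite tr_row_mx -[c]hsubmxK mul_row_col.
    set c1 := lsubmx c; set c2 := rsubmx c => H.
    have c20 : c2 = 0.
      have /(congr1 (fun X => X *m (hatA2 I A Z2 t)^T)) := H.
      rewrite mulmxDl -!mulmxA -!trmx_mul A2T2// trmx0 mulmx0 add0r mul0mx.
      by apply: row_free_mul0; rewrite row_free_unit unitmx_tr A2T2'.
    have c10 : c1 = 0.
      rewrite c20 mul0mx addr0 in H.
      rewrite -[c1](mulmxK (@J_mx_unit R p)) -(T2ET2 t It) !mulmxA H.
      by rewrite !mul0mx.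
    by rewrite c10 c20 row_mx0.
  rewrite -unitmx_tr -row_free_unit trmx_cast /=.
  by rewrite row_free_castmx.
- move=> Z2b Kb Z1b HHb.
  have [A2bT2 [uA2b ode]] := inherent_ode_frame tlr hs sE sA sf HH dp sT2 sT2'
    A2T2 T2ET2 A2T2' HHb.
  split=> //; exists V, K21, K22; split; try exact/(Ck_msmooth tlr).
  move=> t It; have [VV VU uK22 TET] := HV t It; split=> //; last exact: uA2b.
  have uW : W t \in unitmx.
    have := @J_mx_unit R p; rewrite -(T2ET2 t It) mulmxA unitmx_mul.
    by case/andP.
  apply: columns_span_kerI.
  + by rewrite -[V t](mulmxK uW) -/(T2 t) mulmxA A2bT2// mul0mx.
  + apply/eqP; rewrite eqn_leq rank_leq_col /=.
    have rk : \rank ((V t)^T *m V t) = (p + p)%N by rewrite VV mxrank1.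
    by rewrite -[X in (X <= _)%N]rk mxrankM_maxr.
  + by rewrite (hypH_rankA2 HHb).
- exact: (symplectic_flow_ode_matrix tlr hs sE sA sadj HH dp sT2 A2T2 T2ET2).
Qed.
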